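(* Let $\lambda(t)=t|\log t|$. (a) Suppose that $f\in A^{-\infty}$ and $|f|$ is bounded from below on $\mathbf D$ by a positive constant. Then $G_+(f)$ is a countable union of sets each having finite $H_\lambda$ measure. (b) There exists $f\in A^{-\infty}$ such that $|f|$ is bounded from below by a positive constant and $H_\lambda(D_+(f))=\infty$.
   Context: $\mathbf D$ is the open unit disc, $\mathbf T$ the unit circle. $A^{-\infty}$ is the set of analytic functions $f$ in $\mathbf D$ with $|f(z)|\le C(1-|z|)^{-k}$ for some constants $C,k$. For $f\in A^{-\infty}$: $D_+(f)=\{\theta\in[0,2\pi):\ \liminf_{r\to1}\frac{\log|f(re^{i\theta})|}{|\log(1-r)|}>0\}$ and $G_+(f)=\{\theta\in[0,2\pi):\ \limsup_{r\to1}\frac{\log|f(re^{i\theta})|}{|\log(1-r)|}>0\}$, identified with subsets of $\mathbf T$. For increasing $\lambda$ with $\lambda(0)=0$, $H_\lambda(C)=\lim_{\epsilon\to0}\inf\{\sum_s\lambda(|J_s|): C\subset\bigcup_s J_s,\ |J_s|<\epsilon\}$ over coverings by arcs $J_s$ of $\mathbf T$. *)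

(* Defs.v *)
From Stdlib Require Import Reals Lra ZArith.
From Coquelicot Require Import Coquelicot.
Open Scope R_scope.

Definition inD (z : C) : Prop := Cmod z < 1.

Definition holomorphic_on_D (f : C -> C) : Prop :=
  forall z : C, inD z -> @ex_derive C_AbsRing C_NormedModule f z.

Definition A_minus_infty (f : C -> C) : Prop :=
  holomorphic_on_D f /\
  exists Cc k : R, forall z : C, inD z ->
    Cmod (f z) <= Cc * Rpower (1 - Cmod z) (- k).

Definition polar (r theta : R) : C := (r * cos theta, r * sin theta).

(* log|f(re^{i theta})| / |log(1-r)|, considered only where f(re^{i theta}) <> 0
   (where it is 0 the ratio is -infinity). *)
Definition ratio (f : C -> C) (theta r : R) : R :=
  ln (Cmod (f (polar r theta))) / Rabs (ln (1 - r)).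

Definition liminf_pos (f : C -> C) (theta : R) : Prop :=
  exists eps : R, 0 < eps /\ exists r0 : R, 0 <= r0 < 1 /\
    forall r : R, r0 < r < 1 ->
      0 < Cmod (f (polar r theta)) /\ eps <= ratio f theta r.

Definition limsup_pos (f : C -> C) (theta : R) : Prop :=
  exists eps : R, 0 < eps /\ forall r0 : R, 0 <= r0 < 1 ->
    exists r : R, r0 < r < 1 /\
      0 < Cmod (f (polar r theta)) /\ eps <= ratio f theta r.

Definition in_period (theta : R) : Prop := 0 <= theta < 2 * PI.

(* D_+(f) and G_+(f) as subsets of [0, 2 pi) (identified with T). *)
Definition Dplus (f : C -> C) (theta : R) : Prop := in_period theta /\ liminf_pos f theta.
Definition Gplus (f : C -> C) (theta : R) : Prop := in_period theta /\ limsup_pos f theta.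

Definition arc (a l : R) (theta : R) : Prop :=
  in_period theta /\
  exists t : R, 0 <= t <= l /\ exists k : Z, theta = a + t + 2 * PI * IZR k.

Definition arc_cover (A : R -> Prop) (eps : R) (J : nat -> R * R) : Prop :=
  (forall s, 0 <= snd (J s) < eps) /\
  (forall theta, A theta -> exists s, arc (fst (J s)) (snd (J s)) theta).

(* sum_s lambda(|J_s|), in [0, +oo] (for lambda >= 0). *)
Definition cover_sum (lam : R -> R) (J : nat -> R * R) : Rbar :=
  Sup_seq (fun n => Finite (sum_f_R0 (fun s => lam (snd (J s))) n)).

(* inf over coverings with arcs shorter than eps (+oo if no finite-sum covering). *)
Definition H_pre (lam : R -> R) (A : R -> Prop) (eps : R) : Rbar :=
  Glb_Rbar (fun x : R => exists J, arc_cover A eps J /\ cover_sum lam J = Finite x).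

(* H_lambda(A) = lim_{eps -> 0} H_pre eps; H_pre is nonincreasing in eps,
   so the limit equals the supremum along eps = 1/(n+1). *)
Definition H_lambda (lam : R -> R) (A : R -> Prop) : Rbar :=
  Sup_seq (fun n => H_pre lam A (/ (INR n + 1))).

Definition lam_log (t : R) : R := t * Rabs (ln t).

(* Main.v *)
(** (a) Subtracting [ln c], [v = ln |f| - ln c] is a nonnegative harmonic function, hence on every
    circle [|z| = rho < 1] it is represented by its Poisson integral, with total mass
    [2 pi v(0)]. If [v(r e^(i theta)) >= eps |ln (1 - r)|], splitting the Poisson integral into
    dyadic shells around [theta] yields a dyadic interval [I] near [theta], of length at least about
    [1 - r], with [mass I >= c eps lambda |I|]. The maximal intervals with this property are
    disjoint, so their triples cover the limsup set at a cost at most [C v(0) / eps]. The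
    dependence on [rho] is removed by a diagonal argument on the predicate selecting the
    intervals.

    (b) Let [mu] be the law of a point whose binary digits are independent, fair except at the
    positions [2 ^ j], where a 1 has the summable probability [/ (4 * 2 ^ j)]. The density of
    [mu] on cells of generation [n] is at most [n], and at least [c n] along digit sequences that
    eventually vanish at the positions [2 ^ j]. By Harnack's inequality for the Poisson kernel the
    Poisson integral [u] of [mu] satisfies [u <= C |ln (1 - r)|] everywhere and
    [u >= c |ln (1 - r)|] on the radii ending at these sequences. Take [f = exp (u + i u~)]. The
    set of sequences vanishing at [2 ^ j] for all [j > i] carries a probability measure
    whose cells of generation [n >= 2 ^ i] have mass at most [n / 2 ^ i / 2 ^ n], so covering it by
    short arcs costs at least [c 2 ^ i], for every [i]. *)
Require Import Defs.
From Stdlib Require Import Reals Lra Lia ZArith Factorial Classical ClassicalEpsilon.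
From Coquelicot Require Import Coquelicot.
Open Scope R_scope.

(** * Complex differentiability *)

(** Neither part constructs a measure. In (a) the boundary measure is replaced by the masses on
    circles of radius rho. Instead of a weak limit as rho tends to 1, only one bit per dyadic
    interval is kept, whether it is selected, and each inequality on costs involves finitely many
    intervals, so it can be checked at a single suitable rho. The function v is handled as the real
    part of holomorphic functions on smaller closed discs; hence the Cauchy and Poisson formulas,
    proved here from pointwise complex differentiability.

    In (b) an integral against a digit law is a limit of finite averages over the binary tree, taken
    only for Lipschitz integrands: Poisson and Herglotz kernels and their derivatives. By (a) the
    set in (b) has to be a countable union of sets of finite measure, so the infinite measure must
    come from pieces whose measures grow, here like [2 ^ i]. Forcing zeros at all positions [2 ^ j]
    would leave a single piece; the small positive probability of a 1 there lets one function serve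
    all pieces. In the lower bound for coverings, Poisson kernels replace indicators of arcs, which
    keeps the integrands Lipschitz. *)

Lemma continuous_C {U : UniformSpace} (f : U -> C) (x : U) :
  continuous (fun y => fst (f y)) x -> continuous (fun y => snd (f y)) x ->
  @continuous U C_UniformSpace f x.
Proof.
  intros H1 H2 P [e He]. change (locally x (fun y => P (f y))).
  apply (filter_imp (fun y => ball (fst (f x)) e (fst (f y)) /\ ball (snd (f x)) e (snd (f y)))).
  - intros y [A B]. apply He. split; assumption.
  - apply filter_and.
    + apply H1. exists e; intros; assumption.
    + apply H2. exists e; intros; assumption.
Qed.

Lemma continuous_fst_C {U : UniformSpace} (f : U -> C) (x : U) :
  @continuous U C_UniformSpace f x -> continuous (fun y => fst (f y)) x.
Proof.
  intros H P [e He]. unfold filtermap.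
  apply (filter_imp (fun y => @ball C_UniformSpace (f x) e (f y))).
  - intros y [A B]. apply He, A.
  - apply H. exists e; intros; assumption.
Qed.

Lemma continuous_snd_C {U : UniformSpace} (f : U -> C) (x : U) :
  @continuous U C_UniformSpace f x -> continuous (fun y => snd (f y)) x.
Proof.
  intros H P [e He]. unfold filtermap.
  apply (filter_imp (fun y => @ball C_UniformSpace (f x) e (f y))).
  - intros y [A B]. apply He, B.
  - apply H. exists e; intros; assumption.
Qed.

Lemma continuous_Rplus {U : UniformSpace} (f g : U -> R) (x : U) :
  continuous f x -> continuous g x -> continuous (fun y => f y + g y) x.
Proof. exact (@continuous_plus U R_AbsRing R_NormedModule f g x). Qed.

Lemma continuous_Ropp {U : UniformSpace} (f : U -> R) (x : U) :
  continuous f x -> continuous (fun y => - f y) x.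
Proof. exact (@continuous_opp U R_AbsRing R_NormedModule f x). Qed.

Lemma continuous_Rminus {U : UniformSpace} (f g : U -> R) (x : U) :
  continuous f x -> continuous g x -> continuous (fun y => f y - g y) x.
Proof. exact (@continuous_minus U R_AbsRing R_NormedModule f g x). Qed.

Lemma continuous_Rmult {U : UniformSpace} (f g : U -> R) (x : U) :
  continuous f x -> continuous g x -> continuous (fun y => f y * g y) x.
Proof. exact (@continuous_mult U R_AbsRing f g x). Qed.

Lemma continuous_Rinv_comp {U : UniformSpace} (f : U -> R) (x : U) :
  continuous f x -> f x <> 0 -> continuous (fun y => / f y) x.
Proof. intros H1 H2. apply (continuous_comp f Rinv); [exact H1 | now apply continuous_Rinv]. Qed.

Lemma continuous_Cplus {U : UniformSpace} (f g : U -> C) (x : U) :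
  @continuous U C_UniformSpace f x -> @continuous U C_UniformSpace g x ->
  @continuous U C_UniformSpace (fun y => (f y + g y)%C) x.
Proof.
  intros Hf Hg. apply continuous_C; simpl; apply continuous_Rplus.
  - exact (continuous_fst_C _ _ Hf).
  - exact (continuous_fst_C _ _ Hg).
  - exact (continuous_snd_C _ _ Hf).
  - exact (continuous_snd_C _ _ Hg).
Qed.

Lemma continuous_Copp {U : UniformSpace} (f : U -> C) (x : U) :
  @continuous U C_UniformSpace f x ->
  @continuous U C_UniformSpace (fun y => (- f y)%C) x.
Proof.
  intros Hf. apply continuous_C; simpl; apply continuous_Ropp.
  - exact (continuous_fst_C _ _ Hf).
  - exact (continuous_snd_C _ _ Hf).
Qed.

Lemma continuous_Cmult {U : UniformSpace} (f g : U -> C) (x : U) :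
  @continuous U C_UniformSpace f x -> @continuous U C_UniformSpace g x ->
  @continuous U C_UniformSpace (fun y => (f y * g y)%C) x.
Proof.
  intros Hf Hg.
  pose proof (continuous_fst_C _ _ Hf). pose proof (continuous_snd_C _ _ Hf).
  pose proof (continuous_fst_C _ _ Hg). pose proof (continuous_snd_C _ _ Hg).
  apply continuous_C; simpl.
  - apply continuous_Rminus; now apply continuous_Rmult.
  - apply continuous_Rplus; now apply continuous_Rmult.
Qed.

Lemma Cnz_sq (z : C) : z <> 0%C -> fst z * fst z + snd z * snd z <> 0.
Proof.
  intros H E. apply H. destruct z as [a b]; simpl in E.
  assert (a = 0) by nra. assert (b = 0) by nra. subst. reflexivity.
Qed.

Lemma continuous_Cinv {U : UniformSpace} (f : U -> C) (x : U) :
  @continuous U C_UniformSpace f x -> f x <> 0%C ->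
  @continuous U C_UniformSpace (fun y => (/ f y)%C) x.
Proof.
  intros Hf Hn.
  pose proof (continuous_fst_C _ _ Hf) as H1. pose proof (continuous_snd_C _ _ Hf) as H2.
  assert (K : continuous (fun y => / (fst (f y) * (fst (f y) * 1) + snd (f y) * (snd (f y) * 1))) x).
  { apply continuous_Rinv_comp.
    - apply continuous_Rplus.
      + apply continuous_Rmult; [exact H1|]. apply continuous_Rmult; [exact H1 | apply continuous_const].
      + apply continuous_Rmult; [exact H2|]. apply continuous_Rmult; [exact H2 | apply continuous_const].
    - rewrite !Rmult_1_r. now apply Cnz_sq. }
  apply continuous_C; simpl; apply continuous_Rmult; auto.
  now apply continuous_Ropp.
Qed.

Ltac as_C := match goal with |- @eq _ ?a ?b => change (@eq C a b) end.
Ltac as_R := match goal with |- @eq _ ?a ?b => change (@eq R a b) end.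

(** Carathéodory's form of complex differentiability: products, compositions and inverses
    reduce to algebra and continuity at one point. *)
Definition cdiff (f : C -> C) (z l : C) : Prop :=
  exists phi : C -> C, @continuous C_UniformSpace C_UniformSpace phi z /\ phi z = l /\
    @locally C_UniformSpace z (fun w => f w = (f z + phi w * (w - z))%C).

Lemma locally_Cmod (z : C) (P : C -> Prop) :
  @locally C_UniformSpace z P <->
  exists d, 0 < d /\ forall w, Cmod (w - z) < d -> P w.
Proof.
  split.
  - intros [e He]. exists e. split; [apply cond_pos|]. intros w Hw. apply He.
    apply C_NormedModule_mixin_compat1. exact Hw.
  - intros (d & Hd & H). 
    (* Balls of [C_UniformSpace] are squares; the square of half-side d / sqrt 2 lies in the disc of
       radius d. *)
    assert (Hs : 0 < d / sqrt 2) by (apply Rdiv_lt_0_compat; [lra | apply Rlt_sqrt2_0]).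
    exists (mkposreal _ Hs). intros w Hw. apply H.
    generalize (C_NormedModule_mixin_compat2 z w (mkposreal _ Hs) Hw). simpl.
    intros K. replace d with (sqrt 2 * (d / sqrt 2)). exact K.
    field. apply Rgt_not_eq, Rlt_sqrt2_0.
Qed.

Lemma continuous_Cmod (f : C -> C) (z : C) :
  @continuous C_UniformSpace C_UniformSpace f z <->
  forall e, 0 < e -> exists d, 0 < d /\ forall w, Cmod (w - z) < d -> Cmod (f w - f z) < e.
Proof.
  split.
  - intros H e He.
    apply locally_Cmod. apply (H (fun y => Cmod (y - f z) < e)).
    apply locally_Cmod. exists e. split; auto.
  - intros H P HP. apply locally_Cmod in HP. destruct HP as (e & He & HP).
    destruct (H e He) as (d & Hd & K). apply locally_Cmod. exists d. split; auto.
Qed.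

Lemma Ceq_dec_sub (w z : C) : (w - z)%C = 0%C -> w = z.
Proof. intros H. replace w with ((w - z) + z)%C by ring. rewrite H. ring. Qed.

Lemma cdiff_iff (f : C -> C) (z l : C) :
  cdiff f z l <->
  forall e, 0 < e -> exists d, 0 < d /\
    forall w, Cmod (w - z) < d -> Cmod (f w - f z - l * (w - z)) <= e * Cmod (w - z).
Proof.
  split.
  - intros (phi & Hc & Hl & Hf) e He.
    apply locally_Cmod in Hf. destruct Hf as (d1 & Hd1 & Hf).
    destruct (proj1 (continuous_Cmod _ _) Hc e He) as (d2 & Hd2 & Hp).
    exists (Rmin d1 d2). split; [now apply Rmin_pos|]. intros w Hw.
    rewrite (Hf w) by (eapply Rlt_le_trans; [exact Hw | apply Rmin_l]).
    replace (f z + phi w * (w - z) - f z - l * (w - z))%C with ((phi w - phi z) * (w - z))%C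
      by (rewrite Hl; ring).
    rewrite Cmod_mult. apply Rmult_le_compat_r; [apply Cmod_ge_0|].
    apply Rlt_le, Hp. eapply Rlt_le_trans; [exact Hw | apply Rmin_r].
  - intros H.
    exists (fun w => if excluded_middle_informative (w = z) then l else ((f w - f z) / (w - z))%C).
    destruct (excluded_middle_informative (z = z)) as [_|N]; [|now destruct N].
    split; [|split].
    + apply continuous_Cmod. intros e He. destruct (H (e/2)) as (d & Hd & K); [lra|].
      exists d. split; auto. intros w Hw.
      destruct (excluded_middle_informative (z = z)) as [_|N]; [|now destruct N].
      destruct (excluded_middle_informative (w = z)) as [E|N].
      * replace (l - l)%C with (RtoC 0) by ring. rewrite Cmod_0. exact He.
      * assert (N' : (w - z)%C <> 0%C) by (intros E; apply N; now apply Ceq_dec_sub).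
        replace ((f w - f z) / (w - z) - l)%C with ((f w - f z - l * (w - z)) / (w - z))%C
          by (field; exact N').
        rewrite Cmod_div by exact N'. specialize (K w Hw).
        apply Cmod_gt_0 in N'. apply Rle_lt_trans with (e/2); [|lra].
        apply Rle_div_l; lra.
    + reflexivity.
    + apply locally_Cmod. exists 1. split; [lra|]. intros w _.
      destruct (excluded_middle_informative (w = z)) as [E|N].
      * rewrite E. ring.
      * field. intros E; apply N; now apply Ceq_dec_sub.
Qed.

Lemma is_derive_cdiff (f : C -> C) (z l : C) :
  @is_derive C_AbsRing C_NormedModule f z l <-> cdiff f z l.
Proof.
  rewrite cdiff_iff. split.
  - intros [_ H] e He.
    specialize (H z (fun P HP => HP) (mkposreal e He)).
    destruct H as [d Hd]. exists d. split; [apply cond_pos|]. intros w Hw.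
    specialize (Hd w Hw). simpl in Hd.
    change (Cmod ((f w - f z) - (w - z) * l)%C <= e * Cmod (w - z)%C) in Hd.
    replace (l * (w - z))%C with ((w - z) * l)%C by ring. exact Hd.
  - intros H. split.
    + apply is_linear_scal_l.
    + intros x Hx.
      assert (x = z) by (symmetry; apply (@is_filter_lim_locally_unique C_AbsRing (AbsRing_NormedModule C_AbsRing) z x Hx)).
      subst x. intros [e He]. destruct (H e He) as (d & Hd & K).
      exists (mkposreal d Hd). intros w Hw. specialize (K w Hw).
      change (Cmod ((f w - f z) - (w - z) * l)%C <= e * Cmod (w - z)%C).
      replace (l * (w - z))%C with ((w - z) * l)%C in K by ring. exact K.
Qed.

Lemma cdiff_continuous (f : C -> C) (z l : C) :
  cdiff f z l -> @continuous C_UniformSpace C_UniformSpace f z.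
Proof.
  intros (phi & Hc & Hl & Hf).
  apply (continuous_ext_loc _ (fun w => (f z + phi w * (w - z))%C)).
  - revert Hf. apply filter_imp. intros w ->. reflexivity.
  - apply continuous_Cplus; [apply continuous_const|].
    apply continuous_Cmult; [exact Hc|].
    apply continuous_Cplus; [apply continuous_id | apply continuous_const].
Qed.

Lemma cdiff_ext_loc (f g : C -> C) (z l : C) :
  @locally C_UniformSpace z (fun w => f w = g w) -> cdiff f z l -> cdiff g z l.
Proof.
  intros H (phi & Hc & Hl & Hf). exists phi. split; [exact Hc|]. split; [exact Hl|].
  pose proof (locally_singleton _ _ H) as Hz.
  generalize (filter_and _ _ H Hf). apply filter_imp.
  intros w [A B]. rewrite <- A, <- Hz. exact B.
Qed.

Lemma cdiff_const (c z : C) : cdiff (fun _ => c) z 0%C.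
Proof.
  exists (fun _ => RtoC 0). split; [apply continuous_const|]. split; [reflexivity|].
  apply filter_forall. intros (w1, w2). as_C. apply injective_projections; simpl; ring.
Qed.

Lemma cdiff_id (z : C) : cdiff (fun w => w) z 1%C.
Proof.
  exists (fun _ => RtoC 1). split; [apply continuous_const|]. split; [reflexivity|].
  apply filter_forall. intros (w1, w2). as_C. apply injective_projections; simpl; ring.
Qed.

Lemma cdiff_plus (f g : C -> C) (z l m : C) :
  cdiff f z l -> cdiff g z m -> cdiff (fun w => (f w + g w)%C) z (l + m)%C.
Proof.
  intros (p & Hp & Hl & Hf) (q & Hq & Hm & Hg).
  exists (fun w => (p w + q w)%C). split; [now apply continuous_Cplus|].
  split; [now rewrite Hl, Hm|].
  generalize (filter_and _ _ Hf Hg). apply filter_imp.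
  intros w [-> ->]. as_C. ring.
Qed.

Lemma cdiff_mult (f g : C -> C) (z l m : C) :
  cdiff f z l -> cdiff g z m -> cdiff (fun w => (f w * g w)%C) z (l * g z + f z * m)%C.
Proof.
  intros Df Dg. pose proof (cdiff_continuous _ _ _ Dg) as Cg.
  destruct Df as (p & Hp & Hl & Hf), Dg as (q & Hq & Hm & Hg).
  exists (fun w => (p w * g w + f z * q w)%C). split; [|split].
  - apply continuous_Cplus; apply continuous_Cmult; auto. apply continuous_const.
  - now rewrite Hl, Hm.
  - generalize (filter_and _ _ Hf Hg). apply filter_imp.
    intros w [-> ->]. as_C. ring.
Qed.

Lemma cdiff_comp (f g : C -> C) (z l m : C) :
  cdiff f (g z) l -> cdiff g z m -> cdiff (fun w => f (g w)) z (l * m)%C.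
Proof.
  intros Df Dg. pose proof (cdiff_continuous _ _ _ Dg) as Cg.
  destruct Df as (p & Hp & Hl & Hf), Dg as (q & Hq & Hm & Hg).
  exists (fun w => (p (g w) * q w)%C). split; [|split].
  - apply continuous_Cmult; auto. apply (continuous_comp g p); auto.
  - now rewrite Hl, Hm.
  - specialize (Cg _ Hf). unfold filtermap in Cg.
    generalize (filter_and _ _ Cg Hg). apply filter_imp.
    intros w [A B]. cbv beta in A, B |- *. revert A B. generalize (g w) (f (g w)). intros gw fgw A B. rewrite A, B. as_C. ring.
Qed.

Lemma cdiff_inv (f : C -> C) (z l : C) :
  cdiff f z l -> f z <> 0%C -> cdiff (fun w => (/ f w)%C) z (- l / (f z * f z))%C.
Proof.
  intros Df N. pose proof (cdiff_continuous _ _ _ Df) as Cf.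
  destruct Df as (p & Hp & Hl & Hf).
  exists (fun w => (- p w * / (f w * f z))%C). split; [|split].
  - apply continuous_Cmult; [now apply continuous_Copp|].
    apply continuous_Cinv; [|now apply Cmult_neq_0].
    apply continuous_Cmult; [exact Cf | apply continuous_const].
  - now rewrite Hl.
  - assert (Nl : @locally C_UniformSpace z (fun w => f w <> 0%C)).
    { apply continuous_Cmod with (e := Cmod (f z)) in Cf; [|now apply Cmod_gt_0].
      apply locally_Cmod. destruct Cf as (d & Hd & K). exists d. split; auto.
      intros w Hw E. specialize (K w Hw). rewrite E in K.
      replace (0 - f z)%C with (- f z)%C in K by ring. rewrite Cmod_opp in K. lra. }
    generalize (filter_and _ _ Hf Nl). apply filter_imp.
    intros w [A B]. 
    assert (E : (p w * (w - z) = f w - f z)%C) by (rewrite A; as_C; ring).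
    replace (- p w * / (f w * f z) * (w - z))%C with (- (p w * (w - z)) * / (f w * f z))%C by ring.
    rewrite E. as_C. field. now split.
Qed.

(** Used for [Cexp] and [herglotz_transform], whose second-order remainders have explicit bounds. *)
Lemma cdiff_bigO (f : C -> C) (z l : C) (B d : R) : 0 < d ->
  (forall w, Cmod (w - z) < d -> Cmod (f w - f z - l * (w - z)) <= B * Cmod (w - z) ^ 2) ->
  cdiff f z l.
Proof.
  intros Hd H. apply cdiff_iff. intros e He.
  assert (HB : 0 < Rabs B + 1) by (generalize (Rabs_pos B); lra).
  exists (Rmin d (e / (Rabs B + 1))). split.
  - apply Rmin_pos; auto. now apply Rdiv_lt_0_compat.
  - intros w Hw. eapply Rle_trans; [apply H; eapply Rlt_le_trans; [exact Hw | apply Rmin_l]|].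
    pose proof (Cmod_ge_0 (w - z)) as P0.
    assert (P1 : Cmod (w - z) < e / (Rabs B + 1)) by (eapply Rlt_le_trans; [exact Hw | apply Rmin_r]).
    apply (Rmult_lt_compat_r (Rabs B + 1)) in P1; [|lra].
    replace (e / (Rabs B + 1) * (Rabs B + 1)) with e in P1 by (field; lra).
    generalize (Rle_abs B). intros. nra.
Qed.

(** * The complex exponential and a logarithm on the right half-plane *)

Definition Cexp (z : C) : C := (exp (fst z) * cos (snd z), exp (fst z) * sin (snd z)).

Lemma Cmod_Cexp (z : C) : Cmod (Cexp z) = exp (fst z).
Proof.
  unfold Cmod, Cexp; simpl.
  replace (_ + _) with (exp (fst z) * exp (fst z) * (Rsqr (sin (snd z)) + Rsqr (cos (snd z))))
    by (unfold Rsqr; ring).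
  rewrite sin2_cos2, Rmult_1_r. apply sqrt_square. apply Rlt_le, exp_pos.
Qed.

Lemma Cexp_plus (z w : C) : Cexp (z + w) = (Cexp z * Cexp w)%C.
Proof.
  unfold Cexp, Cmult; simpl. rewrite exp_plus, cos_plus, sin_plus. f_equal; ring.
Qed.

Lemma Cmod_le_Rabs (z : C) : Cmod z <= Rabs (fst z) + Rabs (snd z).
Proof.
  unfold Cmod. pose proof (Rabs_pos (fst z)). pose proof (Rabs_pos (snd z)).
  rewrite <- (sqrt_square (Rabs (fst z) + Rabs (snd z))) by lra.
  apply sqrt_le_1_alt. rewrite <- (pow2_abs (fst z)), <- (pow2_abs (snd z)). nra.
Qed.

Lemma Rabs_fst_Cmod (z : C) : Rabs (fst z) <= Cmod z.
Proof. eapply Rle_trans; [apply Rmax_l | apply Rmax_Cmod]. Qed.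

Lemma Rabs_snd_Cmod (z : C) : Rabs (snd z) <= Cmod z.
Proof. eapply Rle_trans; [apply Rmax_r | apply Rmax_Cmod]. Qed.

Lemma exp_minus_1_bound (x : R) : Rabs x <= 1/2 -> Rabs (exp x - 1 - x) <= 2 * x ^ 2.
Proof.
  intros Hx. apply Rabs_le_between in Hx.
  pose proof (exp_ineq1_le x). pose proof (exp_ineq1_le (-x)) as H2.
  rewrite exp_Ropp in H2.
  assert (exp x <= / (1 - x)).
  { replace (exp x) with (/ / exp x) by (rewrite Rinv_inv; reflexivity). apply Rinv_le_contravar; lra. }
  assert (/ (1 - x) <= 1 + x + 2 * x ^ 2).
  { apply Rmult_le_reg_r with (1 - x); [lra|]. rewrite Rinv_l by lra. nra. }
  rewrite Rabs_pos_eq; lra.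
Qed.

Lemma cos_minus_1_bound (x : R) : Rabs (cos x - 1) <= x ^ 2.
Proof.
  replace x with (2 * (x / 2)) at 1 by field. rewrite cos_2a_sin.
  replace (1 - 2 * sin (x/2) * sin (x/2) - 1) with (- (2 * (sin (x/2))^2)) by ring.
  rewrite Rabs_Ropp, Rabs_pos_eq by nra.
  assert (Rabs (sin (x/2)) <= Rabs (x/2)).
  { destruct (MVT_gen sin 0 (x/2) cos) as (c & _ & E).
    - intros; apply is_derive_Reals; apply derivable_pt_lim_sin.
    - intros; apply continuity_sin.
    - rewrite sin_0, !Rminus_0_r in E. rewrite E, Rabs_mult.
      assert (Rabs (cos c) <= 1) by (apply Rabs_le; apply COS_bound).
      pose proof (Rabs_pos (x/2)). nra. }
  rewrite <- (pow2_abs (sin (x/2))). pose proof (pow2_abs (x/2)).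
  pose proof (Rabs_pos (sin (x/2))). nra.
Qed.

Lemma Rabs_sin_le (x : R) : Rabs (sin x) <= Rabs x.
Proof.
  destruct (MVT_gen sin 0 x cos) as (c & _ & E).
  - intros; apply is_derive_Reals; apply derivable_pt_lim_sin.
  - intros; apply continuity_sin.
  - rewrite sin_0, !Rminus_0_r in E. rewrite E, Rabs_mult.
    assert (Rabs (cos c) <= 1) by (apply Rabs_le; apply COS_bound).
    pose proof (Rabs_pos x). nra.
Qed.

Lemma sin_minus_x_bound (x : R) : Rabs x <= 1 -> Rabs (sin x - x) <= x ^ 2.
Proof.
  intros Hx.
  destruct (MVT_gen (fun t => sin t - t) 0 x (fun t => cos t - 1)) as (c & Hc & E).
  - intros. auto_derive; auto. ring.
  - intros. apply continuity_pt_minus; [apply continuity_sin | apply continuity_pt_id].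
  - rewrite sin_0, !Rminus_0_r in E. rewrite E, Rabs_mult.
    assert (Rabs c <= Rabs x).
    { unfold Rmin, Rmax in Hc. destruct (Rle_dec 0 x).
      rewrite !Rabs_pos_eq; lra. rewrite !Rabs_left1; lra. }
    pose proof (cos_minus_1_bound c). pose proof (pow2_abs c). pose proof (pow2_abs x).
    pose proof (Rabs_pos c). assert (c^2 <= Rabs x) by nra. nra.
Qed.

Lemma cdiff_Cexp (z : C) : cdiff Cexp z (Cexp z).
Proof.
  apply (cdiff_bigO _ _ _ (8 * exp (fst z)) (1/2)); [lra|].
  intros w Hw. set (h := (w - z)%C) in *.
  replace w with (z + h)%C by (unfold h; ring). rewrite Cexp_plus.
  replace (Cexp z * Cexp h - Cexp z - Cexp z * h)%C with (Cexp z * (Cexp h - 1 - h))%C by ring.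
  rewrite Cmod_mult, Cmod_Cexp.
  enough (Cmod (Cexp h - 1 - h) <= 8 * Cmod h ^ 2) by (pose proof (exp_pos (fst z)); nra).
  pose proof (Rabs_fst_Cmod h) as A. pose proof (Rabs_snd_Cmod h) as B.
  clearbody h. destruct h as [x y]. simpl in A, B. set (m := Cmod (x, y)) in *.
  pose proof (exp_minus_1_bound x ltac:(lra)) as X.
  pose proof (cos_minus_1_bound y) as Y. pose proof (sin_minus_x_bound y ltac:(lra)) as Z.
  assert (X2 : x ^ 2 <= m ^ 2) by (rewrite <- (pow2_abs x); pose proof (Rabs_pos x); nra).
  assert (Y2 : y ^ 2 <= m ^ 2) by (rewrite <- (pow2_abs y); pose proof (Rabs_pos y); nra).
  eapply Rle_trans; [apply Cmod_le_Rabs|]. unfold Cexp; simpl.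
  apply Rabs_le_between in A. apply Rabs_le_between in B.
  assert (E1 : Rabs (exp x * cos y + - (1) + - x) <= 4 * m^2).
  { replace (exp x * cos y + - (1) + - x) with ((exp x - 1 - x) * cos y + (1 + x) * (cos y - 1))
      by ring.
    eapply Rle_trans; [apply Rabs_triang|]. rewrite !Rabs_mult.
    assert (Rabs (cos y) <= 1) by (apply Rabs_le, COS_bound).
    rewrite (Rabs_pos_eq (1+x)) by lra.
    pose proof (Rabs_pos (cos y)). pose proof (Rabs_pos (exp x - 1 - x)). pose proof (Rabs_pos (cos y - 1)).
    assert (Rabs (exp x - 1 - x) * Rabs (cos y) <= Rabs (exp x - 1 - x)) by nra.
    assert ((1+x) * Rabs (cos y - 1) <= 3/2 * Rabs (cos y - 1)) by nra. lra. }
  assert (E2 : Rabs (exp x * sin y + - 0 + - y) <= 4 * m^2).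
  { replace (exp x * sin y + - 0 + - y) with ((exp x - 1 - x) * sin y + ((1 + x) * (sin y - y)
      + x * y)) by ring. 
    eapply Rle_trans; [apply Rabs_triang|].
    eapply Rle_trans; [apply Rplus_le_compat_l, Rabs_triang|]. rewrite !Rabs_mult.
    assert (Rabs (sin y) <= 1/2) by (eapply Rle_trans; [apply Rabs_sin_le | apply Rabs_le; lra]).
    rewrite (Rabs_pos_eq (1+x)) by lra.
    pose proof (Rabs_pos (sin y)). pose proof (Rabs_pos (exp x - 1 - x)). pose proof (Rabs_pos (sin y - y)).
    assert (Rabs (exp x - 1 - x) * Rabs (sin y) <= Rabs (exp x - 1 - x) * (1/2)) by nra.
    assert ((1+x) * Rabs (sin y - y) <= 3/2 * Rabs (sin y - y)) by nra.
    assert (Rabs x * Rabs y <= m * m).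
    { apply Rmult_le_compat; try apply Rabs_pos; apply Rabs_le; lra. }
    lra. }
  simpl in E1, E2. lra.
Qed.

(** A logarithm of [w] only for [0 < fst w]. *)
Definition Clog (w : C) : C := (ln (Cmod w), atan (snd w / fst w)).

Lemma Cexp_Clog (w : C) : 0 < fst w -> Cexp (Clog w) = w.
Proof.
  intros Hw. destruct w as [a b]. simpl in Hw. unfold Cexp, Clog; simpl.
  assert (M : 0 < Cmod (a, b)).
  { apply Cmod_gt_0. intros E. injection E as -> ->. lra. }
  rewrite exp_ln by exact M.
  rewrite cos_atan, sin_atan.
  assert (E : Cmod (a, b) = a * sqrt (1 + (b/a)²)).
  { unfold Cmod; simpl.
    replace (a * sqrt (1 + (b / a)²)) with (sqrt (a * a) * sqrt (1 + (b / a)²))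
      by (rewrite sqrt_square by lra; reflexivity).
    rewrite <- sqrt_mult by (unfold Rsqr; nra). f_equal. unfold Rsqr. field. lra. }
  assert (S : 0 < sqrt (1 + (b/a)²)) by (apply sqrt_lt_R0; unfold Rsqr; nra).
  rewrite E. f_equal; field; lra.
Qed.

(** Inverse function rule: if p is the slope function of [Cexp] at [Clog w], then the inverse of p
    composed with [Clog] is a slope function of [Clog] at w. Only the continuity of [Clog] has to be
    checked by hand. *)
Lemma cdiff_Clog (w : C) : 0 < fst w -> cdiff Clog w (/ w)%C.
Proof.
  intros Hw.
  assert (Nw : w <> 0%C) by (intros ->; simpl in Hw; lra).
  assert (C1 : @continuous C_UniformSpace R_UniformSpace (fun v => fst v) w)
    by (apply (continuous_fst_C (fun v => v)), continuous_id).
  assert (C2 : @continuous C_UniformSpace R_UniformSpace (fun v => snd v) w)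
    by (apply (continuous_snd_C (fun v => v)), continuous_id).
  assert (CL : @continuous C_UniformSpace C_UniformSpace Clog w).
  { apply continuous_C; simpl.
    - apply (continuous_comp (fun w : C_UniformSpace => Cmod w) ln).
      + unfold Cmod. apply (continuous_comp (fun w : C_UniformSpace => fst w ^ 2 + snd w ^ 2) sqrt).
        * simpl. apply continuous_Rplus.
          -- apply continuous_Rmult; [exact C1|].
             apply continuous_Rmult; [exact C1 | apply continuous_const].
          -- apply continuous_Rmult; [exact C2|].
             apply continuous_Rmult; [exact C2 | apply continuous_const].
        * apply continuous_sqrt.
      + apply continuity_pt_filterlim. apply derivable_continuous_pt.
        exists (/ Cmod w). apply derivable_pt_lim_ln. now apply Cmod_gt_0.
    - apply (continuous_comp (fun w : C_UniformSpace => snd w / fst w) atan).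
      + apply continuous_Rmult; [exact C2|].
        apply continuous_Rinv_comp; [exact C1 | lra].
      + apply continuous_atan. }
  destruct (cdiff_Cexp (Clog w)) as (p & Hp & Hl & Hf).
  rewrite Cexp_Clog in Hl by exact Hw.
  exists (fun v => (/ p (Clog v))%C). split; [|split].
  - apply continuous_Cinv.
    + apply (continuous_comp Clog p); auto.
    + now rewrite Hl.
  - now rewrite Hl.
  - assert (L1 : @locally C_UniformSpace w (fun v => 0 < fst v)).
    { apply locally_Cmod. exists (fst w). split; auto. intros v Hv.
      pose proof (Rabs_fst_Cmod (v - w)) as K. destruct v, w; simpl in *.
      apply Rabs_le_between in K. lra. }
    assert (L2 : @locally C_UniformSpace w (fun v => p (Clog v) <> 0%C)).
    { assert (CC : @continuous C_UniformSpace C_UniformSpace (fun v => p (Clog v)) w)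
        by (apply (continuous_comp Clog p); auto).
      apply continuous_Cmod with (e := Cmod w) in CC; [|now apply Cmod_gt_0].
      apply locally_Cmod. destruct CC as (d & Hd & K). exists d. split; auto.
      intros v Hv E. specialize (K v Hv). rewrite E, Hl in K.
      replace (0 - w)%C with (- w)%C in K by ring. rewrite Cmod_opp in K. lra. }
    generalize (filter_and _ _ (filter_and _ _ L1 L2) (CL _ Hf)). apply filter_imp.
    intros v [[A B] E]. rewrite !Cexp_Clog in E by assumption.
    replace (v - w)%C with (p (Clog v) * (Clog v - Clog w))%C
      by (transitivity ((w + p (Clog v) * (Clog v - Clog w)) - w)%C; [as_C; ring | now rewrite <- E]).
    as_C.
    field. exact B.
Qed.

(** * Goursat's theorem *)

Definition curve_diff (g g' : R -> C) (t : R) : Prop :=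
  is_derive (fun t => fst (g t)) t (fst (g' t)) /\ is_derive (fun t => snd (g t)) t (snd (g' t)).

Lemma curve_diff_continuous (g g' : R -> C) (t : R) :
  curve_diff g g' t -> @continuous R_UniformSpace C_UniformSpace g t.
Proof.
  intros [H1 H2]. apply continuous_C.
  - apply (ex_derive_continuous (V := R_NormedModule)). eexists; exact H1.
  - apply (ex_derive_continuous (V := R_NormedModule)). eexists; exact H2.
Qed.

(** Contour integrals are taken of real parts only, so that they are integrals of real functions; an
    imaginary part is reached by multiplying the integrand by [Ci]. *)
Lemma continuous_form (G : C -> C) (g g' : R -> C) (t : R) :
  curve_diff g g' t -> @continuous R_UniformSpace C_UniformSpace g' t ->
  (exists l, cdiff G (g t) l) ->
  continuous (fun t => fst (G (g t) * g' t)%C) t.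
Proof.
  intros H1 H2 [l Hl]. apply (continuous_fst_C (fun t => (G (g t) * g' t)%C)).
  apply continuous_Cmult; [|exact H2].
  apply (continuous_comp g G); [now apply curve_diff_continuous with g'|].
  now apply cdiff_continuous with l.
Qed.

(** The affine part [g0 + l (w - z0)] of [G] has a primitive, so only the remainder
    contributes to the integral. *)
Lemma edge_estimate (G : C -> C) (g g' : R -> C) (a b M : R) (z0 g0 l : C) : a <= b ->
  (forall t, a <= t <= b -> curve_diff g g' t) ->
  (forall t, a <= t <= b -> @continuous R_UniformSpace C_UniformSpace g' t) ->
  (forall t, a <= t <= b -> exists l, cdiff G (g t) l) ->
  (forall t, a <= t <= b -> Rabs (fst ((G (g t) - g0 - l * (g t - z0)) * g' t)%C) <= M) ->
  Rabs (RInt (fun t => fst (G (g t) * g' t)%C) a b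
    - (fst (g0 * g b + l * ((g b - z0) * (g b - z0)) / 2)%C
       - fst (g0 * g a + l * ((g a - z0) * (g a - z0)) / 2)%C)) <= (b - a) * M.
Proof.
  intros Hab Hd Hc HG HM.
  set (T := fun t => fst ((g0 + l * (g t - z0)) * g' t)%C).
  assert (IT : is_RInt T a b (fst (g0 * g b + l * ((g b - z0) * (g b - z0)) / 2)%C
       - fst (g0 * g a + l * ((g a - z0) * (g a - z0)) / 2)%C)).
  { apply (is_RInt_derive (V := R_CompleteNormedModule)
      (fun t => fst (g0 * g t + l * ((g t - z0) * (g t - z0)) / 2)%C) T);
    rewrite Rmin_left, Rmax_right by lra; intros t Ht.
    - destruct (Hd t Ht) as [H1 H2]. unfold T.
      apply (is_derive_ext (fun t => fst g0 * fst (g t) - snd g0 * snd (g t)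
        + (fst l * ((fst (g t) - fst z0)^2 - (snd (g t) - snd z0)^2)
           - snd l * (2 * (fst (g t) - fst z0) * (snd (g t) - snd z0))) / 2)).
      + intros s. simpl. field.
      + set (p := fun t => fst (g t)) in *. set (q := fun t => snd (g t)) in *.
        change (fst (g t)) with (p t). change (snd (g t)) with (q t).
        evar_last.
        { apply (is_derive_ext (fun t => fst g0 * p t - snd g0 * q t
        + (fst l * ((p t - fst z0)^2 - (q t - snd z0)^2)
           - snd l * (2 * (p t - fst z0) * (q t - snd z0))) / 2)); [reflexivity|].
          auto_derive; [|reflexivity].
          repeat split; first [eexists; exact H1 | eexists; exact H2]. }
        replace (Derive (fun x => p x) t) with (fst (g' t))
          by (symmetry; apply is_derive_unique; exact H1).
        replace (Derive (fun x => q x) t) with (snd (g' t))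
          by (symmetry; apply is_derive_unique; exact H2).
        unfold p, q. simpl. field.
    - apply (continuous_fst_C (fun t => ((g0 + l * (g t - z0)) * g' t)%C)).
      apply continuous_Cmult; [|now apply Hc].
      apply continuous_Cplus; [apply continuous_const|].
      apply continuous_Cmult; [apply continuous_const|].
      apply continuous_Cplus; [now apply curve_diff_continuous with g', Hd | apply continuous_const]. }
  assert (IG : ex_RInt (fun t => fst (G (g t) * g' t)%C) a b).
  { apply (ex_RInt_continuous (V := R_CompleteNormedModule)).
    rewrite Rmin_left, Rmax_right by lra. intros t Ht. apply continuous_form; auto. }
  rewrite <- (is_RInt_unique _ _ _ _ IT).
  assert (ET : ex_RInt T a b) by (eexists; exact IT).
  change (Rabs (minus (RInt (fun t => fst (G (g t) * g' t)%C) a b) (RInt T a b)) <= (b - a) * M).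
  rewrite <- (RInt_minus (V := R_CompleteNormedModule)) by assumption.
  apply abs_RInt_le_const; auto.
  - apply (ex_RInt_minus (V := R_NormedModule)); assumption.
  - intros t Ht. eapply Rle_trans; [|apply (HM t Ht)]. right. f_equal.
    unfold minus, plus, opp, T; simpl. ring.
Qed.

(** If P failed on the unit square, it would fail on nested squares shrinking to a point, against
    the local hypothesis at that point. *)
Lemma square_bisection (P : R -> R -> R -> Prop) :
  (forall x y h, 0 <= x -> x + h <= 1 -> 0 <= y -> y + h <= 1 -> 0 < h ->
     P x y (h/2) -> P (x + h/2) y (h/2) -> P x (y + h/2) (h/2) ->
     P (x + h/2) (y + h/2) (h/2) -> P x y h) ->
  (forall x0 y0, 0 <= x0 <= 1 -> 0 <= y0 <= 1 -> exists d, 0 < d /\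
     forall x y h, 0 < h < d -> 0 <= x -> x + h <= 1 -> 0 <= y -> y + h <= 1 ->
       x <= x0 <= x + h -> y <= y0 <= y + h -> P x y h) ->
  P 0 0 1.
Proof.
  intros Hq Hl. apply NNPP. intros Hn.
  set (h := fun n => / 2 ^ n).
  assert (hp : forall n, 0 < h n) by (intros n; apply Rinv_0_lt_compat, pow_lt; lra).
  assert (hS : forall n, h (S n) = h n / 2)
    by (intros n; unfold h; simpl; rewrite Rinv_mult; field; apply pow_nonzero; lra).
  (* Selects the corner of a quarter on which P fails. The last quarter needs no test: P holds on
     the other three. *)
  set (step := fun (n : nat) (p : R * R) => let (x, y) := p in let k := h n / 2 in
    if excluded_middle_informative (P x y k) then
    if excluded_middle_informative (P (x + k) y k) then
    if excluded_middle_informative (P x (y + k) k) then (x + k, y + k)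
    else (x, y + k) else (x + k, y) else (x, y)).
  set (s := fix s n := match n with O => (0, 0) | S n => step n (s n) end).
  assert (Inv : forall n, 0 <= fst (s n) /\ fst (s n) + h n <= 1 /\
    0 <= snd (s n) /\ snd (s n) + h n <= 1 /\ ~ P (fst (s n)) (snd (s n)) (h n)).
  { induction n as [|n IH].
    - simpl. unfold h; simpl. rewrite Rinv_1. repeat split; try lra. exact Hn.
    - change (s (S n)) with (step n (s n)). rewrite hS. pose proof (hp n).
      destruct (s n) as [x y]. simpl in IH |- *. destruct IH as (A & B & C & D & E).
      repeat destruct excluded_middle_informative; simpl; repeat split; try lra; try assumption.
      intros F. apply E. apply Hq; auto. }
  assert (Mono : forall n, fst (s n) <= fst (s (S n)) <= fst (s n) + h n - h (S n) /\
                           snd (s n) <= snd (s (S n)) <= snd (s n) + h n - h (S n)).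
  { intros n. change (s (S n)) with (step n (s n)). rewrite hS. pose proof (hp n).
    destruct (s n) as [x y]. simpl. repeat destruct excluded_middle_informative; simpl; lra. }
  assert (Lim : forall u : nat -> R, (forall n, 0 <= u n /\ u n + h n <= 1) ->
    (forall n, u n <= u (S n) <= u n + h n - h (S n)) ->
    exists u0, 0 <= u0 <= 1 /\ forall n, u n <= u0 <= u n + h n).
  { intros u Hu Hm.
    destruct (ex_finite_lim_seq_incr u 1) as [u0 Hu0].
    - intros n; apply Hm.
    - intros n. specialize (Hu n). pose proof (hp n). lra.
    - assert (M1 : forall n m, u n <= u (m + n)%nat <= u n + h n - h (m + n)%nat).
      { intros n m. induction m as [|m IH]; simpl; [lra|].
        pose proof (Hm (m + n)%nat). simpl in *. lra. }
      exists u0. assert (K : forall n, u n <= u0 <= u n + h n).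
      { intros n. pose proof (proj1 (is_lim_seq_incr_n u n u0) Hu0) as L. split.
        - apply (is_lim_seq_le (fun _ => u n) (fun m => u (m + n)%nat) (u n) u0); auto.
          + intros m; apply M1. + apply is_lim_seq_const.
        - apply (is_lim_seq_le (fun m => u (m + n)%nat) (fun _ => u n + h n) u0 (u n + h n)); auto.
          + intros m. pose proof (M1 n m). pose proof (hp (m + n)%nat). lra.
          + apply is_lim_seq_const. }
      split; [|exact K]. pose proof (K O). pose proof (Hu O). lra. }
  destruct (Lim (fun n => fst (s n))) as (x0 & Hx0 & Kx).
  { intros n. destruct (Inv n) as (A & B & _). auto. } { intros n; apply Mono. }
  destruct (Lim (fun n => snd (s n))) as (y0 & Hy0 & Ky).
  { intros n. destruct (Inv n) as (_ & _ & A & B & _). auto. } { intros n; apply Mono. }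
  destruct (Hl x0 y0 Hx0 Hy0) as (d & Hd & K).
  destruct (pow_lt_1_zero (/2) ltac:(rewrite Rabs_pos_eq; lra) d Hd) as [N HN].
  specialize (HN N (Nat.le_refl N)). rewrite pow_inv in HN. fold (h N) in HN.
  rewrite Rabs_pos_eq in HN by (apply Rlt_le, hp).
  destruct (Inv N) as (A & B & C & D & E). apply E. apply K; auto.
Qed.

(** The derivative of [G] is not assumed continuous, so Stokes' formula is not available and
    the parameter square is bisected instead. *)
Section Goursat.
Variables (G : C -> C) (Phi Phix Phiy : R -> R -> C) (L : R).
Hypothesis HL : 0 < L.
Hypothesis HG : forall x y, 0 <= x <= 1 -> 0 <= y <= 1 -> exists l, cdiff G (Phi x y) l.
Hypothesis Hx : forall x y, curve_diff (fun x => Phi x y) (fun x => Phix x y) x.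
Hypothesis Hy : forall x y, curve_diff (Phi x) (Phiy x) y.
Hypothesis Cx : forall x y, @continuous R_UniformSpace C_UniformSpace (fun x => Phix x y) x.
Hypothesis Cy : forall x y, @continuous R_UniformSpace C_UniformSpace (Phiy x) y.
Hypothesis Bx : forall x y, 0 <= x <= 1 -> 0 <= y <= 1 -> Cmod (Phix x y) <= L.
Hypothesis By : forall x y, 0 <= x <= 1 -> 0 <= y <= 1 -> Cmod (Phiy x y) <= L.

Let ex (y x : R) := fst (G (Phi x y) * Phix x y)%C.
Let ey (x y : R) := fst (G (Phi x y) * Phiy x y)%C.

(** The integral of G along the image of the positively oriented boundary of a square. *)
Let bd (x y h : R) := RInt (ex y) x (x + h) + RInt (ey (x + h)) y (y + h)
   - RInt (ex (y + h)) x (x + h) - RInt (ey x) y (y + h).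

Let ex_int y a b : 0 <= y <= 1 -> 0 <= a <= 1 -> 0 <= b <= 1 -> ex_RInt (ex y) a b.
Proof.
  intros. apply (ex_RInt_continuous (V := R_CompleteNormedModule)). intros t Ht.
  apply (continuous_form G (fun x => Phi x y) (fun x => Phix x y)); auto. apply HG; auto.
  unfold Rmin, Rmax in Ht; destruct Rle_dec; lra.
Qed.

Let ey_int x a b : 0 <= x <= 1 -> 0 <= a <= 1 -> 0 <= b <= 1 -> ex_RInt (ey x) a b.
Proof.
  intros. apply (ex_RInt_continuous (V := R_CompleteNormedModule)). intros t Ht.
  apply (continuous_form G (Phi x) (Phiy x)); auto. apply HG; auto.
  unfold Rmin, Rmax in Ht; destruct Rle_dec; lra.
Qed.

Let mvt_comp (f f' : R -> R) (a b : R) : 0 <= a <= 1 -> 0 <= b <= 1 ->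
  (forall t, 0 <= t <= 1 -> is_derive f t (f' t)) ->
  (forall t, 0 <= t <= 1 -> Rabs (f' t) <= L) -> Rabs (f b - f a) <= L * Rabs (b - a).
Proof.
  intros Ha Hb Hd HM.
  assert (I : forall t, Rmin a b <= t <= Rmax a b -> 0 <= t <= 1)
    by (intros t; unfold Rmin, Rmax; destruct Rle_dec; lra).
  destruct (MVT_gen f a b f') as (c & Hc & E).
  - intros t Ht. apply Hd, I. lra.
  - intros t Ht. apply continuity_pt_filterlim.
    apply (ex_derive_continuous (V := R_NormedModule)). eexists. now apply Hd, I.
  - rewrite E, Rabs_mult. apply Rmult_le_compat_r; [apply Rabs_pos|]. now apply HM, I.
Qed.

Let Phi_lip x y u v : 0 <= x <= 1 -> 0 <= y <= 1 -> 0 <= u <= 1 -> 0 <= v <= 1 ->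
  Cmod (Phi u v - Phi x y) <= 2 * L * (Rabs (u - x) + Rabs (v - y)).
Proof.
  intros X Y U V.
  replace (Phi u v - Phi x y)%C with ((Phi u v - Phi x v) + (Phi x v - Phi x y))%C by ring.
  eapply Rle_trans; [apply Cmod_triangle|].
  assert (Cmod (Phi u v - Phi x v) <= 2 * L * Rabs (u - x)).
  { eapply Rle_trans; [apply Cmod_le_Rabs|]. simpl.
    assert (Rabs (fst (Phi u v) - fst (Phi x v)) <= L * Rabs (u - x)).
    { apply (mvt_comp (fun x => fst (Phi x v)) (fun x => fst (Phix x v))); auto.
      - intros; apply Hx.
      - intros. eapply Rle_trans; [apply Rabs_fst_Cmod | auto]. }
    assert (Rabs (snd (Phi u v) - snd (Phi x v)) <= L * Rabs (u - x)).
    { apply (mvt_comp (fun x => snd (Phi x v)) (fun x => snd (Phix x v))); auto.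
      - intros; apply Hx.
      - intros. eapply Rle_trans; [apply Rabs_snd_Cmod | auto]. }
    unfold Rminus in *. lra. }
  assert (Cmod (Phi x v - Phi x y) <= 2 * L * Rabs (v - y)).
  { eapply Rle_trans; [apply Cmod_le_Rabs|]. simpl.
    assert (Rabs (fst (Phi x v) - fst (Phi x y)) <= L * Rabs (v - y)).
    { apply (mvt_comp (fun y => fst (Phi x y)) (fun y => fst (Phiy x y))); auto.
      - intros; apply Hy.
      - intros. eapply Rle_trans; [apply Rabs_fst_Cmod | auto]. }
    assert (Rabs (snd (Phi x v) - snd (Phi x y)) <= L * Rabs (v - y)).
    { apply (mvt_comp (fun y => snd (Phi x y)) (fun y => snd (Phiy x y))); auto.
      - intros; apply Hy.
      - intros. eapply Rle_trans; [apply Rabs_snd_Cmod | auto]. }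
    unfold Rminus in *. lra. }
  lra.
Qed.

Let bd_local eps x0 y0 : 0 < eps -> 0 <= x0 <= 1 -> 0 <= y0 <= 1 ->
  exists d, 0 < d /\
     forall x y h, 0 < h < d -> 0 <= x -> x + h <= 1 -> 0 <= y -> y + h <= 1 ->
       x <= x0 <= x + h -> y <= y0 <= y + h -> Rabs (bd x y h) <= eps * (h * h).
Proof.
  intros He X0 Y0. destruct (HG x0 y0 X0 Y0) as [l Hl].
  (* By [Phi_lip] the image of the square stays within [4 * L * h] of z0, so each of the four edges
     contributes at most [h * (e * (4 * L * h) * L)]. *)
  assert (He' : 0 < eps / (16 * L * L)) by (apply Rdiv_lt_0_compat; nra).
  set (e := eps / (16 * L * L)) in *.
  destruct (proj1 (cdiff_iff _ _ _) Hl e He') as (d & Hd & K).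
  exists (d / (4 * L)). split; [apply Rdiv_lt_0_compat; lra|].
  intros x y h Hh X1 X2 Y1 Y2 XX YY.
  assert (Hdh : 4 * L * h < d).
  { destruct Hh as [_ Hh]. apply (Rmult_lt_compat_l (4 * L)) in Hh; [|lra].
    replace (4 * L * (d / (4 * L))) with d in Hh by (field; lra). exact Hh. }
  set (z0 := Phi x0 y0) in *. set (g0 := G z0) in *.
  assert (Near : forall u v w, x <= u <= x + h -> y <= v <= y + h -> Cmod w <= L ->
     Rabs (fst ((G (Phi u v) - g0 - l * (Phi u v - z0)) * w)%C) <= e * (4 * L * h) * L).
  { intros u v w Hu Hv Hw.
    assert (D : Cmod (Phi u v - z0) <= 4 * L * h).
    { eapply Rle_trans; [apply Phi_lip; lra|].
      assert (Rabs (u - x0) <= h) by (apply Rabs_le; lra).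
      assert (Rabs (v - y0) <= h) by (apply Rabs_le; lra). nra. }
    eapply Rle_trans; [apply Rabs_fst_Cmod|]. rewrite Cmod_mult.
    apply Rmult_le_compat; try apply Cmod_ge_0; auto.
    eapply Rle_trans; [apply K; lra|]. apply Rmult_le_compat_l; lra. }
  pose proof (edge_estimate G (fun x => Phi x y) (fun x => Phix x y) x (x + h)
    (e * (4 * L * h) * L) z0 g0 l ltac:(lra) ltac:(auto) ltac:(auto)
    ltac:(intros; apply HG; lra)
    ltac:(intros; apply Near; try lra; apply Bx; lra)) as E1.
  pose proof (edge_estimate G (fun x => Phi x (y + h)) (fun x => Phix x (y + h)) x (x + h)
    (e * (4 * L * h) * L) z0 g0 l ltac:(lra) ltac:(auto) ltac:(auto)
    ltac:(intros; apply HG; lra)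
    ltac:(intros; apply Near; try lra; apply Bx; lra)) as E2.
  pose proof (edge_estimate G (Phi x) (Phiy x) y (y + h)
    (e * (4 * L * h) * L) z0 g0 l ltac:(lra) ltac:(auto) ltac:(auto)
    ltac:(intros; apply HG; lra)
    ltac:(intros; apply Near; try lra; apply By; lra)) as E3.
  pose proof (edge_estimate G (Phi (x + h)) (Phiy (x + h)) y (y + h)
    (e * (4 * L * h) * L) z0 g0 l ltac:(lra) ltac:(auto) ltac:(auto)
    ltac:(intros; apply HG; lra)
    ltac:(intros; apply Near; try lra; apply By; lra)) as E4.
  unfold bd, ex, ey. cbv beta in E1, E2, E3, E4.
  (* The primitive of the affine part: its corner values cancel around the boundary. *)
  set (S := fun w : C => fst (g0 * w + l * ((w - z0) * (w - z0)) / 2)%C) in *.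
  fold (S (Phi x y)) in E1, E3. fold (S (Phi (x + h) y)) in E1, E4.
  fold (S (Phi x (y + h))) in E2, E3. fold (S (Phi (x + h) (y + h))) in E2, E4.
  replace (eps * (h * h)) with (4 * ((x + h - x) * (e * (4 * L * h) * L))).
  2:{ unfold e. field. lra. }
  replace (y + h - y) with (x + h - x) in E3, E4 by ring.
  apply Rabs_le_between in E1, E2, E3, E4. apply Rabs_le. lra.
Qed.

Lemma goursat_square :
  RInt (fun x => fst (G (Phi x 0) * Phix x 0)%C) 0 1
  + RInt (fun y => fst (G (Phi 1 y) * Phiy 1 y)%C) 0 1
  - RInt (fun x => fst (G (Phi x 1) * Phix x 1)%C) 0 1
  - RInt (fun y => fst (G (Phi 0 y) * Phiy 0 y)%C) 0 1 = 0.
Proof.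
  assert (A : forall eps, 0 < eps -> Rabs (bd 0 0 1) <= eps * (1 * 1)).
  { intros eps He.
    apply (square_bisection (fun x y h => Rabs (bd x y h) <= eps * (h * h))).
    - intros x y h X1 X2 Y1 Y2 Hh.
      assert (E : bd x y h = bd x y (h/2) + bd (x + h/2) y (h/2) + bd x (y + h/2) (h/2)
        + bd (x + h/2) (y + h/2) (h/2)).
      { unfold bd. replace (x + h / 2 + h / 2) with (x + h) by field.
        replace (y + h / 2 + h / 2) with (y + h) by field.
        rewrite <- (RInt_Chasles (V := R_CompleteNormedModule) (ex y) x (x + h/2) (x + h))
          by (apply ex_int; lra).
        rewrite <- (RInt_Chasles (V := R_CompleteNormedModule) (ex (y + h)) x (x + h/2) (x + h))
          by (apply ex_int; lra).
        rewrite <- (RInt_Chasles (V := R_CompleteNormedModule) (ey x) y (y + h/2) (y + h))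
          by (apply ey_int; lra).
        rewrite <- (RInt_Chasles (V := R_CompleteNormedModule) (ey (x + h)) y (y + h/2) (y + h))
          by (apply ey_int; lra).
        unfold plus; simpl. ring. }
      intros A1 A2 A3 A4. rewrite E.
      apply Rabs_le_between in A1, A2, A3, A4. apply Rabs_le. nra.
    - intros. now apply bd_local. }
  change (RInt (ex 0) 0 1 + RInt (ey 1) 0 1 - RInt (ex 1) 0 1 - RInt (ey 0) 0 1 = 0).
  assert (Z : bd 0 0 1 = 0).
  { destruct (Req_dec (bd 0 0 1) 0) as [|N]; auto. apply Rabs_pos_lt in N.
    specialize (A (Rabs (bd 0 0 1) / 2) ltac:(lra)). lra. }
  unfold bd in Z. rewrite !Rplus_0_l in Z. exact Z.
Qed.
End Goursat.

(** * Poisson's formula *)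

Definition holo_disc (F : C -> C) (rho : R) : Prop :=
  forall w, Cmod w <= rho -> exists l, cdiff F w l.

Lemma Cmod_polar (r t : R) : 0 <= r -> Cmod (polar r t) = r.
Proof.
  intros Hr. unfold Cmod, polar; simpl.
  replace (_ + _) with (r * r * (Rsqr (sin t) + Rsqr (cos t))) by (unfold Rsqr; ring).
  rewrite sin2_cos2, Rmult_1_r. now apply sqrt_square.
Qed.

Lemma polar_period (r t : R) : polar r (t + 2 * PI) = polar r t.
Proof.
  unfold polar.
  now rewrite cos_plus, sin_plus, cos_2PI, sin_2PI, !Rmult_1_r, !Rmult_0_r, Rminus_0_r, Rplus_0_r.
Qed.

Lemma continuous_polar (r t : R) : @continuous R_UniformSpace C_UniformSpace (polar r) t.
Proof.
  apply continuous_C; simpl; apply (ex_derive_continuous (V := R_NormedModule)); auto_derive; auto.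
Qed.

Lemma ex_RInt_cont (f : R -> R) (a b : R) : (forall t, continuous f t) -> ex_RInt f a b.
Proof. intros H. apply (ex_RInt_continuous (V := R_CompleteNormedModule)). auto. Qed.

(** The form dw / (i (w - a)) on the circle w = [polar rho t], written in the parameter t, since dw
    = i w dt. *)
Definition cauchy_kernel (rho : R) (a : C) (t : R) : C := (polar rho t / (polar rho t - a))%C.

Section Cauchy.
Variables (F : C -> C) (rho : R) (a : C).
Hypothesis Hrho : 0 < rho.
Hypothesis Ha : Cmod a < rho.
Hypothesis HF : holo_disc F rho.

Lemma polar_sub_neq_0 t : (polar rho t - a)%C <> 0%C.
Proof.
  intros E. apply Ceq_dec_sub in E. rewrite <- E, Cmod_polar in Ha; lra.
Qed.

Lemma Cmod_polar_sub_ge t : rho - Cmod a <= Cmod (polar rho t - a).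
Proof.
  pose proof (Cmod_triangle (polar rho t - a) a) as H.
  replace (polar rho t - a + a)%C with (polar rho t) in H by ring. rewrite Cmod_polar in H; lra.
Qed.

Lemma Cmod_polar_sub_le t : Cmod (polar rho t - a) <= 2 * rho.
Proof.
  pose proof (Cmod_triangle (polar rho t) (- a)) as H. rewrite Cmod_opp, Cmod_polar in H by lra.
  unfold Cminus. lra.
Qed.

Lemma homotopy_in_disc tau t : 0 <= tau <= 1 ->
  Cmod (a + tau * (polar rho t - a))%C <= rho.
Proof.
  intros Ht. replace (a + tau * (polar rho t - a))%C with ((RtoC (1 - tau)) * a + tau * polar rho t)%C
    by (rewrite RtoC_minus; ring).
  eapply Rle_trans; [apply Cmod_triangle|]. rewrite !Cmod_mult, !Cmod_R, Cmod_polar by lra.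
  rewrite !Rabs_pos_eq by lra. nra.
Qed.

Lemma continuous_cauchy_kernel t :
  @continuous R_UniformSpace C_UniformSpace (cauchy_kernel rho a) t.
Proof.
  apply continuous_Cmult; [apply continuous_polar|].
  apply continuous_Cinv; [|apply polar_sub_neq_0].
  apply continuous_Cplus; [apply continuous_polar | apply continuous_const].
Qed.

Lemma continuous_homotopy tau t : 0 <= tau <= 1 ->
  @continuous R_UniformSpace C_UniformSpace
    (fun t => (F (a + tau * (polar rho t - a)) * cauchy_kernel rho a t)%C) t.
Proof.
  intros Ht. apply continuous_Cmult; [|apply continuous_cauchy_kernel].
  apply (continuous_comp (fun t => (a + tau * (polar rho t - a))%C) F).
  - apply continuous_Cplus; [apply continuous_const|].
    apply continuous_Cmult; [apply continuous_const|].
    apply continuous_Cplus; [apply continuous_polar | apply continuous_const].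
  - destruct (HF (a + tau * (polar rho t - a))%C) as [l Hl]; [now apply homotopy_in_disc|].
    now apply cdiff_continuous with l.
Qed.

Let J (tau : R) :=
  RInt (fun t => fst (F (a + tau * (polar rho t - a)) * cauchy_kernel rho a t)%C) 0 (2 * PI).

(** Under the homotopy [a + tau (polar rho t - a)] the form [F(w) dw / (w - a)] pulls back to the
    same kernel in [t] for every [tau]. *)
Lemma homotopy_invariance eta : 0 < eta < 1 -> J 1 = J eta.
Proof.
  intros He.
  (* [T x] stays in [eta, 1], so the parameter square is mapped into the disc without the point
     a. *)
  set (T := fun x => eta + (1 - eta) * x).
  set (Phi := fun x y => (a + T x * (polar rho (2 * PI * y) - a))%C).
  set (Phix := fun (x y : R) => (RtoC (1 - eta) * (polar rho (2 * PI * y) - a))%C).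
  set (Phiy := fun x y => (RtoC (T x * (2 * PI)) * (Ci * polar rho (2 * PI * y)))%C).
  (* The factor [- Ci] is 1 / i; it makes the pullback along the circles the real multiple [2 * PI]
     of the kernel integrand. *)
  set (G := fun w => (- Ci * (F w * / (w - a)))%C).
  assert (TP : forall x, 0 <= x <= 1 -> 0 < T x <= 1) by (intros x Hx; unfold T; nra).
  pose proof PI_RGT_0 as HPI. pose proof PI_4 as HPI4.
  assert (NZ : forall x y, 0 <= x <= 1 -> (Phi x y - a)%C <> 0%C).
  { intros x y Hx. unfold Phi. replace (a + T x * (polar rho (2 * PI * y) - a) - a)%C with
      (T x * (polar rho (2 * PI * y) - a))%C by ring.
    apply Cmult_neq_0; [|apply polar_sub_neq_0]. intros E. apply RtoC_inj in E.
    specialize (TP x Hx). lra. }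
  assert (GS := goursat_square G Phi Phix Phiy (8 * rho) ltac:(lra)).
  assert (EY : forall x y, 0 <= x <= 1 -> fst (G (Phi x y) * Phiy x y)%C =
    2 * PI * fst (F (Phi x y) * cauchy_kernel rho a (2 * PI * y))%C).
  { intros x y Hx. 
    replace (2 * PI * fst (F (Phi x y) * cauchy_kernel rho a (2 * PI * y))%C) with
     (fst (RtoC (2 * PI) * (F (Phi x y) * cauchy_kernel rho a (2 * PI * y)))%C)
      by (simpl; ring).
    f_equal. unfold G, Phiy. specialize (NZ x y Hx). 
    unfold cauchy_kernel. pose proof (polar_sub_neq_0 (2 * PI * y)) as NP.
    replace (Phi x y - a)%C with (T x * (polar rho (2 * PI * y) - a))%C in NZ |- *
      by (unfold Phi; ring).
    assert (NT : RtoC (T x) <> 0%C) by (intros E; apply NZ; rewrite E; ring).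
    generalize (F (Phi x y)). intros fv. rewrite RtoC_mult.
    generalize dependent (polar rho (2 * PI * y)). intros p NZ NP.
    replace (- Ci * (fv * / (T x * (p - a))) * (T x * RtoC (2 * PI) * (Ci * p)))%C with
      (- (Ci * Ci) * (fv * / (T x * (p - a))) * (T x * RtoC (2 * PI) * p))%C by ring.
    replace (Ci * Ci)%C with (- RtoC 1)%C by (unfold Ci, Cmult, Copp, RtoC; simpl; f_equal; ring).
    field. now split. }
  assert (Lin : forall x, 0 <= x <= 1 ->
     RInt (fun y => fst (G (Phi x y) * Phiy x y)%C) 0 1 = J (T x)).
  { intros x Hx. unfold J.
    assert (E := RInt_comp_lin (V := R_CompleteNormedModule)
      (fun t => fst (F (a + T x * (polar rho t - a)) * cauchy_kernel rho a t)%C) (2 * PI) 0 0 1).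
    replace (2 * PI * 0 + 0) with 0 in E by ring. replace (2 * PI * 1 + 0) with (2 * PI) in E by ring.
    rewrite <- E.
    - apply RInt_ext. intros y _. rewrite EY by exact Hx. unfold Phi, scal; simpl. unfold mult; simpl.
      now rewrite Rplus_0_r.
    - apply ex_RInt_cont. intros t.
      apply (continuous_fst_C (fun t => (F (a + T x * (polar rho t - a)) * cauchy_kernel rho a t)%C)).
      apply continuous_homotopy. specialize (TP x Hx). lra. }
  (* The two radial edges coincide because the circle closes up, so their contributions cancel. *)
  assert (Top : RInt (fun x => fst (G (Phi x 1) * Phix x 1)%C) 0 1 =
                RInt (fun x => fst (G (Phi x 0) * Phix x 0)%C) 0 1).
  { apply RInt_ext. intros x _. unfold Phi, Phix.
    replace (2 * PI * 1) with (2 * PI * 0 + 2 * PI) by ring. now rewrite polar_period. }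
  rewrite Top, (Lin 1), (Lin 0) in GS by lra.
  replace (T 1) with 1 in GS by (unfold T; ring). replace (T 0) with eta in GS by (unfold T; ring).
  apply Rminus_diag_uniq. rewrite <- GS; [ring|..].
  - intros x y Hx Hy. destruct (HF (Phi x y)) as [l Hl].
    { apply homotopy_in_disc. specialize (TP x Hx). lra. }
    eexists. unfold G. apply cdiff_mult; [apply cdiff_const|].
    apply cdiff_mult; [exact Hl|]. apply cdiff_inv; [|now apply NZ].
    apply cdiff_plus; [apply cdiff_id | apply cdiff_const].
  - intros x y. unfold Phi, Phix, T. split; simpl; auto_derive; auto; ring.
  - intros x y. unfold Phi, Phiy. split; simpl; auto_derive; auto; ring.
  - intros x y. apply continuous_const.
  - intros x y. unfold Phiy. apply continuous_Cmult; [apply continuous_const|].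
    apply continuous_Cmult; [apply continuous_const|].
    apply (continuous_comp (fun y => 2 * PI * y) (polar rho)); [|apply continuous_polar].
    apply (ex_derive_continuous (V := R_NormedModule)). auto_derive; auto.
  - intros x y Hx Hy. unfold Phix. rewrite Cmod_mult, Cmod_R, Rabs_pos_eq by lra.
    pose proof (Cmod_polar_sub_le (2 * PI * y)). pose proof (Cmod_ge_0 (polar rho (2 * PI * y) - a)). nra.
  - intros x y Hx Hy. unfold Phiy. specialize (TP x Hx).
    rewrite !Cmod_mult, Cmod_R, Cmod_Ci, Cmod_polar by lra. rewrite Rabs_pos_eq by nra.
    assert (T x * (2 * PI) <= 8) by nra. nra.
Qed.

(** Letting eta tend to 0 freezes F at a. The integrals of the kernel are left unevaluated: at the
    centre the kernel is 1, which gives the mean value property, and that property evaluates them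
    for general a in [poisson_formula]. *)
Lemma cauchy_formula_re :
  RInt (fun t => fst (F (polar rho t) * cauchy_kernel rho a t)%C) 0 (2 * PI) =
  fst (F a) * RInt (fun t => fst (cauchy_kernel rho a t)) 0 (2 * PI)
  - snd (F a) * RInt (fun t => snd (cauchy_kernel rho a t)) 0 (2 * PI).
Proof.
  pose proof PI_RGT_0 as HPI.
  assert (J1 : RInt (fun t => fst (F (polar rho t) * cauchy_kernel rho a t)%C) 0 (2 * PI) = J 1).
  { apply RInt_ext. intros t _. do 2 f_equal. f_equal. ring. }
  assert (IK1 : ex_RInt (fun t => fst (cauchy_kernel rho a t)) 0 (2 * PI))
    by (apply ex_RInt_cont; intros t; apply continuous_fst_C, continuous_cauchy_kernel).
  assert (IK2 : ex_RInt (fun t => snd (cauchy_kernel rho a t)) 0 (2 * PI))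
    by (apply ex_RInt_cont; intros t; apply continuous_snd_C, continuous_cauchy_kernel).
  assert (J0 : is_RInt (fun t => fst (F a * cauchy_kernel rho a t)%C) 0 (2 * PI)
     (fst (F a) * RInt (fun t => fst (cauchy_kernel rho a t)) 0 (2 * PI)
  - snd (F a) * RInt (fun t => snd (cauchy_kernel rho a t)) 0 (2 * PI))).
  { apply (is_RInt_minus (V := R_NormedModule));
    apply (is_RInt_scal (V := R_NormedModule)); now apply (RInt_correct (V := R_CompleteNormedModule)). }
  rewrite J1, <- (is_RInt_unique _ _ _ _ J0).
  set (M := rho / (rho - Cmod a)).
  assert (HM : 0 < M) by (apply Rdiv_lt_0_compat; lra).
  assert (KM : forall t, Cmod (cauchy_kernel rho a t) <= M).
  { intros t. unfold cauchy_kernel. rewrite Cmod_div, Cmod_polar by (try apply polar_sub_neq_0; lra).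
    apply Rmult_le_compat_l; [lra|]. apply Rinv_le_contravar; [lra | apply Cmod_polar_sub_ge]. }
  destruct (HF a) as [l Hl]; [lra|]. apply cdiff_continuous in Hl.
  apply Rminus_diag_uniq. apply cond_eq. intros e He. rewrite Rminus_0_r.
  destruct (proj1 (continuous_Cmod _ _) Hl (e / (4 * PI * M))) as (d & Hd & K).
  { apply Rdiv_lt_0_compat; nra. }
  set (eta := Rmin (1/2) (d / (4 * rho))).
  assert (E0 : 0 < eta) by (apply Rmin_pos; [lra | apply Rdiv_lt_0_compat; lra]).
  assert (E1 : eta <= 1/2) by apply Rmin_l.
  assert (E2 : eta * (2 * rho) < d).
  { apply Rle_lt_trans with (d / (4 * rho) * (2 * rho)).
    - apply Rmult_le_compat_r; [lra | apply Rmin_r].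
    - replace (d / (4 * rho) * (2 * rho)) with (d / 2) by (field; lra). lra. }
  rewrite (homotopy_invariance eta) by lra. unfold J.
  assert (IE : ex_RInt (fun t => fst (F (a + eta * (polar rho t - a)) * cauchy_kernel rho a t)%C) 0 (2*PI)).
  { apply ex_RInt_cont. intros t.
    apply (continuous_fst_C (fun t => (F (a + eta * (polar rho t - a)) * cauchy_kernel rho a t)%C)).
    apply continuous_homotopy. lra. }
  assert (I0 : ex_RInt (fun t => fst (F a * cauchy_kernel rho a t)%C) 0 (2 * PI)) by (eexists; exact J0).
  match goal with |- Rabs (?x - ?y) < _ => change (Rabs (minus x y) < e) end.
  rewrite <- (RInt_minus (V := R_CompleteNormedModule)) by assumption.
  apply Rle_lt_trans with ((2 * PI - 0) * (e / (4 * PI * M) * M)).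
  - apply abs_RInt_le_const; [lra| |].
    + now apply (ex_RInt_minus (V := R_NormedModule)).
    + intros t _.
      replace (minus _ _) with (fst ((F (a + eta * (polar rho t - a)) - F a) * cauchy_kernel rho a t)%C)
        by (unfold minus, plus, opp; simpl; ring).
      eapply Rle_trans; [apply Rabs_fst_Cmod|]. rewrite Cmod_mult.
      apply Rmult_le_compat; try apply Cmod_ge_0; auto.
      apply Rlt_le, K. replace (a + eta * (polar rho t - a) - a)%C with (eta * (polar rho t - a))%C by ring.
      rewrite Cmod_mult, Cmod_R, Rabs_pos_eq by lra.
      pose proof (Cmod_polar_sub_le t). nra.
  - replace ((2 * PI - 0) * (e / (4 * PI * M) * M)) with (e / 2) by (field; lra). lra.
Qed.
End Cauchy.

Lemma mean_value_re (F : C -> C) (rho : R) : 0 < rho -> holo_disc F rho ->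
  RInt (fun t => fst (F (polar rho t))) 0 (2 * PI) = 2 * PI * fst (F 0%C).
Proof.
  intros Hr HF. pose proof (cauchy_formula_re F rho 0%C Hr) as H.
  rewrite Cmod_0 in H. specialize (H Hr HF).
  assert (K : forall t, cauchy_kernel rho 0%C t = 1%C).
  { intros t. unfold cauchy_kernel. 
    assert (N := polar_sub_neq_0 rho 0%C Hr ltac:(rewrite Cmod_0; lra) t).
    replace (polar rho t - 0)%C with (polar rho t) in N |- * by ring. field. exact N. }
  rewrite (RInt_ext (fun t => fst (cauchy_kernel rho 0%C t)) (fun _ => 1)) in H
    by (intros t _; rewrite K; reflexivity).
  rewrite (RInt_ext (fun t => snd (cauchy_kernel rho 0%C t)) (fun _ => 0)) in H
    by (intros t _; rewrite K; reflexivity).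
  rewrite !RInt_const in H. unfold scal in H; simpl in H; unfold mult in H; simpl in H.
  rewrite (RInt_ext (fun t => fst (F (polar rho t) * cauchy_kernel rho 0 t)%C)
    (fun t => fst (F (polar rho t)))) in H by (intros t _; rewrite K; simpl; ring).
  rewrite H. as_R. ring.
Qed.

Definition poisson (rho : R) (a : C) (t : R) : R :=
  (rho ^ 2 - Cmod a ^ 2) / Cmod (polar rho t - a) ^ 2.

(** The Poisson kernel is the sum of the Cauchy kernel of [a] and of a function holomorphic on
    the disc and vanishing at 0 (the reflected Cauchy kernel). *)
Section Poisson.
Variables (F : C -> C) (rho : R) (a : C).
Hypothesis Hrho : 0 < rho.
Hypothesis Ha : Cmod a < rho.
Hypothesis HF : holo_disc F rho.

Let refl (w : C) : C := (Cconj a * w / (RtoC (rho * rho) - Cconj a * w))%C.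

Let refl_den w : Cmod w <= rho -> (RtoC (rho * rho) - Cconj a * w)%C <> 0%C.
Proof.
  intros Hw E. apply Ceq_dec_sub in E.
  assert (M : Cmod (RtoC (rho * rho)) = Cmod (Cconj a * w)) by (now rewrite E).
  rewrite Cmod_mult, Cmod_conj, Cmod_R, Rabs_pos_eq in M by nra.
  pose proof (Cmod_ge_0 a). pose proof (Cmod_ge_0 w). nra.
Qed.

Let refl_holo : holo_disc refl rho.
Proof.
  intros w Hw. eexists. unfold refl.
  apply (cdiff_mult (fun w => Cconj a * w)%C (fun w => / (RtoC (rho * rho) - Cconj a * w))%C).
  - apply cdiff_mult; [apply cdiff_const | apply cdiff_id].
  - apply cdiff_inv; [|now apply refl_den].
    apply (cdiff_plus (fun _ => RtoC (rho * rho)) (fun w => - (Cconj a * w))%C); [apply cdiff_const|].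
    apply (cdiff_ext_loc (fun w => (- Cconj a) * w)%C).
    + apply filter_forall. intros v. as_C. ring.
    + apply cdiff_mult; [apply cdiff_const | apply cdiff_id].
Qed.

(** On the circle [rho * rho] is w times its conjugate, which cancels against the w in the numerator
    of [refl]. *)
Let conj_kernel t : (1 + refl (polar rho t))%C = Cconj (cauchy_kernel rho a t).
Proof.
  pose proof (polar_sub_neq_0 rho a Hrho Ha t) as N.
  assert (D := refl_den (polar rho t) ltac:(rewrite Cmod_polar; lra)).
  unfold refl, cauchy_kernel.
  set (z := polar rho t) in *.
  assert (Z : (z * Cconj z)%C = RtoC (rho * rho)).
  { rewrite <- Cmod2_conj. unfold z. rewrite Cmod_polar by lra. f_equal. ring. }
  assert (N' : Cconj (z - a) <> 0%C).
  { intros E. apply N. apply Cmod_eq_0. rewrite <- Cmod_conj, E. apply Cmod_0. }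
  rewrite <- Z in D |- *.
  rewrite Cdiv_conj by exact N.
  rewrite Cminus_conj in N' |- *.
  assert (NZ : z <> 0%C) by (intros E; apply D; rewrite E; ring).
  replace (z * Cconj z - Cconj a * z)%C with (z * (Cconj z - Cconj a))%C by ring.
  field. now split.
Qed.

(** By [conj_kernel] the left side is k + conj k - 1 for the Cauchy kernel k, which is real. *)
Let kernel_sum t : (cauchy_kernel rho a t + refl (polar rho t))%C = RtoC (poisson rho a t).
Proof.
  pose proof (conj_kernel t) as H.
  replace (refl (polar rho t)) with (Cconj (cauchy_kernel rho a t) - 1)%C by (rewrite <- H; ring).
  pose proof (polar_sub_neq_0 rho a Hrho Ha t) as N.
  unfold cauchy_kernel, poisson. rewrite Cdiv_conj by exact N.
  assert (N' : Cconj (polar rho t - a) <> 0%C).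
  { intros E. apply N. apply Cmod_eq_0. rewrite <- Cmod_conj, E. apply Cmod_0. }
  assert (PM : Cmod (polar rho t - a) ^ 2 <> 0).
  { apply pow_nonzero. apply Rgt_not_eq, Cmod_gt_0, N. }
  rewrite RtoC_div by exact PM. rewrite RtoC_minus, !Cmod2_conj.
  assert (Z : RtoC (rho ^ 2) = (polar rho t * Cconj (polar rho t))%C)
    by (rewrite <- Cmod2_conj, Cmod_polar by lra; reflexivity).
  rewrite Z. rewrite Cminus_conj in N' |- *.
  field. now split.
Qed.

Theorem poisson_formula :
  RInt (fun t => fst (F (polar rho t)) * poisson rho a t) 0 (2 * PI) = 2 * PI * fst (F a).
Proof.
  assert (Cr : forall t, @continuous R_UniformSpace C_UniformSpace (fun t => refl (polar rho t)) t).
  { intros t. destruct (refl_holo (polar rho t)) as [l Hl]; [rewrite Cmod_polar; lra|].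
    apply (continuous_comp (polar rho) refl); [apply continuous_polar|].
    now apply cdiff_continuous with l. }
  assert (CF : forall t, @continuous R_UniformSpace C_UniformSpace (fun t => F (polar rho t)) t).
  { intros t. destruct (HF (polar rho t)) as [l Hl]; [rewrite Cmod_polar; lra|].
    apply (continuous_comp (polar rho) F); [apply continuous_polar|].
    now apply cdiff_continuous with l. }
  assert (H1 : holo_disc (fun w => 1 + refl w)%C rho).
  { intros w Hw. destruct (refl_holo w Hw) as [l Hl]. eexists.
    apply cdiff_plus; [apply cdiff_const | exact Hl]. }
  (* Multiplication by [Ci] turns the imaginary part of the Cauchy kernel into a real part, whose
     mean is the value 0 at the centre. *)
  assert (H2 : holo_disc (fun w => Ci * (1 + refl w))%C rho).
  { intros w Hw. destruct (H1 w Hw) as [l Hl]. eexists.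
    apply cdiff_mult; [apply cdiff_const | exact Hl]. }
  assert (H3 : holo_disc (fun w => F w * refl w)%C rho).
  { intros w Hw. destruct (refl_holo w Hw) as [l Hl]. destruct (HF w Hw) as [m Hm].
    eexists. apply cdiff_mult; eassumption. }
  assert (R0 : refl 0%C = 0%C) by (unfold refl, Cdiv; ring).
  pose proof (mean_value_re _ rho Hrho H1) as M1. cbv beta in M1. rewrite R0 in M1.
  pose proof (mean_value_re _ rho Hrho H2) as M2. cbv beta in M2. rewrite R0 in M2.
  pose proof (mean_value_re _ rho Hrho H3) as M3. cbv beta in M3. rewrite R0 in M3.
  rewrite (RInt_ext (fun t => fst (1 + refl (polar rho t))%C) (fun t => fst (cauchy_kernel rho a t))) in M1
    by (intros t _; rewrite conj_kernel; reflexivity).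
  rewrite (RInt_ext (fun t => fst (Ci * (1 + refl (polar rho t)))%C) (fun t => snd (cauchy_kernel rho a t))) in M2
    by (intros t _; rewrite conj_kernel; simpl; ring).
  pose proof (cauchy_formula_re F rho a Hrho Ha HF) as CFr. rewrite M1, M2 in CFr.
  rewrite (RInt_ext _ (fun t => plus (fst (F (polar rho t) * cauchy_kernel rho a t)%C)
      (fst (F (polar rho t) * refl (polar rho t))%C))).
  - rewrite (RInt_plus (V := R_CompleteNormedModule)).
    + rewrite CFr, M3. unfold plus; simpl. ring.
    + apply ex_RInt_cont. intros t.
      apply (continuous_fst_C (fun t => (F (polar rho t) * cauchy_kernel rho a t)%C)).
      apply continuous_Cmult; [apply CF | now apply continuous_cauchy_kernel].
    + apply ex_RInt_cont. intros t.
      apply (continuous_fst_C (fun t => (F (polar rho t) * refl (polar rho t))%C)).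
      apply continuous_Cmult; [apply CF | apply Cr].
  - intros t _. 
    replace (fst (F (polar rho t)) * poisson rho a t) with
      (fst (F (polar rho t) * RtoC (poisson rho a t))%C) by (simpl; ring).
    rewrite <- kernel_sum. unfold plus; simpl. ring.
Qed.
End Poisson.

(** * A logarithm of a zero-free function *)

Lemma polar_surj (w : C) : exists t, 0 <= t <= 2 * PI /\ w = polar (Cmod w) t.
Proof.
  destruct (Req_dec (Cmod w) 0) as [E|N].
  - exists 0. pose proof PI_RGT_0. split; [lra|]. rewrite E. apply Cmod_eq_0 in E. rewrite E.
    unfold polar, RtoC. f_equal; ring.
  - pose proof (Cmod_ge_0 w) as P0. set (m := Cmod w) in *.
    pose proof (Cmod2_alt w) as H2. fold m in H2. destruct w as [x y]. unfold Re, Im in H2; simpl in H2.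
    assert (Hx : -1 <= x / m <= 1).
    { pose proof (Rabs_fst_Cmod (x, y)) as K. fold m in K. simpl in K. apply Rabs_le_between in K.
      split; [apply Rle_div_r | apply Rle_div_l]; lra. }
    assert (Hs : y ^ 2 = m ^ 2 * (1 - (x/m)²)) by (unfold Rsqr; field_simplify; nra).
    pose proof (acos_bound (x/m)) as AB.
    assert (SA : (m * sin (acos (x/m))) ^ 2 = y ^ 2).
    { rewrite sin_acos, Rpow_mult_distr, pow2_sqrt by (unfold Rsqr; nra). lra. }
    assert (SP : 0 <= sin (acos (x/m))) by (apply sin_ge_0; lra).
    destruct (Rle_dec 0 y) as [Hy|Hy].
    + exists (acos (x/m)). split; [lra|]. unfold polar. rewrite cos_acos by exact Hx.
      f_equal; [field; lra|]. apply Rsqr_inj; unfold Rsqr; nra.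
    + exists (2 * PI - acos (x/m)). split; [lra|]. unfold polar.
      rewrite cos_minus, sin_minus, cos_2PI, sin_2PI, cos_acos by exact Hx.
      f_equal; [field; lra|].
      enough (- y = m * sin (acos (x/m))) by lra. apply Rsqr_inj; unfold Rsqr; nra.
Qed.

Lemma continuity_2d_polar (g : C -> R) (r t : R) :
  @continuous C_UniformSpace R_UniformSpace g (polar r t) ->
  continuity_2d_pt (fun r t => g (polar r t)) r t.
Proof.
  intros H. apply continuity_2d_pt_filterlim.
  assert (K : @continuous (prod_UniformSpace R_UniformSpace R_UniformSpace) C_UniformSpace
     (fun p => polar (fst p) (snd p)) (r, t)).
  { apply continuous_C; unfold polar; cbv beta iota delta [fst snd].
    - apply (continuous_Rmult (U := prod_UniformSpace R_UniformSpace R_UniformSpace)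
        (fun p : R * R => fst p) (fun p : R * R => cos (snd p))).
      + apply continuous_fst.
      + apply (continuous_comp (fun p : prod_UniformSpace R_UniformSpace R_UniformSpace => snd p) cos);
        [apply continuous_snd | apply continuous_cos].
    - apply (continuous_Rmult (U := prod_UniformSpace R_UniformSpace R_UniformSpace)
        (fun p : R * R => fst p) (fun p : R * R => sin (snd p))).
      + apply continuous_fst.
      + apply (continuous_comp (fun p : prod_UniformSpace R_UniformSpace R_UniformSpace => snd p) sin);
        [apply continuous_snd | apply continuous_sin]. }
  exact (continuous_comp (fun p : prod_UniformSpace R_UniformSpace R_UniformSpace =>
     polar (fst p) (snd p)) g (r, t) K H).
Qed.

Lemma ratio_in_half_plane (a b : C) (c : R) : 0 < c -> c <= Cmod a -> Cmod (b - a) < c ->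
  0 < fst (b / a)%C.
Proof.
  intros Hc Ha Hb. assert (N : a <> 0%C) by (apply Cmod_gt_0; lra).
  replace (b / a)%C with (1 + (b - a) / a)%C by (field; exact N).
  assert (K : Cmod ((b - a) / a) < 1).
  { rewrite Cmod_div by exact N. apply Rlt_div_l; lra. }
  pose proof (Rabs_fst_Cmod ((b - a) / a)%C) as A. set (q := ((b - a) / a)%C) in *.
  change (0 < 1 + fst q). apply Rabs_le_between in A. lra.
Qed.

Section LogLift.
Variables (f : C -> C) (c rho : R).
Hypothesis Hf : forall z, inD z -> exists l, cdiff f z l.
Hypothesis Hc : 0 < c.
Hypothesis Hb : forall z, inD z -> c <= Cmod (f z).
Hypothesis Hrho : 0 < rho < 1.

(** In polar coordinates the closed disc is a rectangle, on which continuity is uniform; the two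
    points compared lie on one ray, so only the radius varies. The bound c puts the quotient of
    consecutive values in the domain of [Clog]. *)
Lemma radial_uniform_continuity : exists N : nat, (0 < N)%nat /\ forall (k : nat) w, (k < N)%nat ->
  Cmod w <= rho ->
  Cmod (f (RtoC (INR (S k) / INR N) * w) - f (RtoC (INR k / INR N) * w)) < c.
Proof.
  pose proof PI_RGT_0 as HPI.
  assert (CF : forall r t, 0 <= r <= rho -> @continuous C_UniformSpace C_UniformSpace f (polar r t)).
  { intros r t Hr. destruct (Hf (polar r t)) as [l Hl].
    - unfold inD. rewrite Cmod_polar; lra. - now apply cdiff_continuous with l. }
  assert (Hc4 : 0 < c / 4) by lra.
  destruct (uniform_continuity_2d (fun r t => fst (f (polar r t))) 0 rho 0 (2 * PI)) with
    (eps := mkposreal _ Hc4) as [d1 K1].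
  { intros r t Hr _. apply (continuity_2d_polar (fun z => fst (f z))).
    apply continuous_fst_C. now apply CF. }
  destruct (uniform_continuity_2d (fun r t => snd (f (polar r t))) 0 rho 0 (2 * PI)) with
    (eps := mkposreal _ Hc4) as [d2 K2].
  { intros r t Hr _. apply (continuity_2d_polar (fun z => snd (f z))).
    apply continuous_snd_C. now apply CF. }
  assert (Hd : 0 < Rmin d1 d2) by (apply Rmin_pos; apply cond_pos).
  destruct (archimed_cor1 (Rmin d1 d2) Hd) as (N & HN & HN0).
  exists N. split; [exact HN0|]. intros k w Hk Hw.
  destruct (polar_surj w) as (t & Ht & Ew). 
  assert (Sc : forall s, 0 <= s -> (RtoC s * w)%C = polar (s * Cmod w) t).
  { intros s Hs. rewrite Ew at 1. unfold polar, Cmult, RtoC; simpl. f_equal; ring. }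
  assert (NP : 0 < INR N) by (apply lt_0_INR; exact HN0).
  assert (A0 : forall j, 0 <= INR j / INR N) by (intros j; apply Rdiv_le_0_compat; [apply pos_INR | lra]).
  assert (A1 : forall j, (j <= N)%nat -> INR j / INR N <= 1)
    by (intros j Hj; apply Rle_div_l; [lra|]; rewrite Rmult_1_l; now apply le_INR).
  rewrite !Sc by apply A0.
  pose proof (Cmod_ge_0 w) as M0.
  assert (B1 : forall j, (j <= N)%nat -> 0 <= INR j / INR N * Cmod w <= rho).
  { intros j Hj. specialize (A0 j). specialize (A1 j Hj). nra. }
  assert (B2 : Rabs (INR (S k) / INR N * Cmod w - INR k / INR N * Cmod w) < Rmin d1 d2).
  { rewrite S_INR. replace ((INR k + 1) / INR N * Cmod w - INR k / INR N * Cmod w)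
      with (/ INR N * Cmod w) by (field; lra).
    assert (0 < / INR N) by now apply Rinv_0_lt_compat.
    rewrite Rabs_pos_eq by nra. nra. }
  assert (B3 : Rabs (t - t) < Rmin d1 d2) by (rewrite Rminus_diag, Rabs_R0; exact Hd).
  specialize (K1 (INR k / INR N * Cmod w) t (INR (S k) / INR N * Cmod w) t).
  specialize (K2 (INR k / INR N * Cmod w) t (INR (S k) / INR N * Cmod w) t).
  pose proof (Rmin_l d1 d2). pose proof (Rmin_r d1 d2).
  specialize (K1 (B1 k ltac:(lia)) Ht (B1 (S k) ltac:(lia)) Ht ltac:(lra) ltac:(lra)).
  specialize (K2 (B1 k ltac:(lia)) Ht (B1 (S k) ltac:(lia)) Ht ltac:(lra) ltac:(lra)).
  eapply Rle_lt_trans; [apply Cmod_le_Rabs|]. simpl fst; simpl snd. simpl in K1, K2.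
  unfold Rminus in K1, K2. lra.
Qed.

(** Telescoping along the radius: [f w] is [f 0] times the ratios [f ((k+1) w / N) / f (k w / N)],
    all of which lie in the right half-plane for large [N]. *)
Lemma log_lift : exists F : C -> C, holo_disc F rho /\
  forall w, Cmod w <= rho -> fst (F w) = ln (Cmod (f w)).
Proof.
  destruct radial_uniform_continuity as (N & HN & HU).
  assert (NP : 0 < INR N) by now apply lt_0_INR.
  set (g := fun (k : nat) w => f (RtoC (INR k / INR N) * w)%C).
  set (F := fix F (k : nat) (w : C) : C :=
    match k with O => RtoC (ln (Cmod (f 0%C))) | S j => (F j w + Clog (g (S j) w / g j w))%C end).
  assert (InD : forall k w, (k <= N)%nat -> Cmod w <= rho -> inD (RtoC (INR k / INR N) * w)%C).
  { intros k w Hk Hw. unfold inD. rewrite Cmod_mult, Cmod_R.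
    assert (0 <= INR k / INR N) by (apply Rdiv_le_0_compat; [apply pos_INR | lra]).
    assert (INR k / INR N <= 1) by (apply Rle_div_l; [lra|]; rewrite Rmult_1_l; now apply le_INR).
    rewrite Rabs_pos_eq by lra. pose proof (Cmod_ge_0 w). nra. }
  assert (Gb : forall k w, (k <= N)%nat -> Cmod w <= rho -> c <= Cmod (g k w))
    by (intros; apply Hb; now apply InD).
  assert (Gn : forall k w, (k <= N)%nat -> Cmod w <= rho -> g k w <> 0%C)
    by (intros k w Hk Hw; apply Cmod_gt_0; specialize (Gb k w Hk Hw); lra).
  assert (Gd : forall k w, (k <= N)%nat -> Cmod w <= rho -> exists l, cdiff (g k) w l).
  { intros k w Hk Hw. destruct (Hf _ (InD k w Hk Hw)) as [l Hl]. eexists. unfold g.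
    apply (cdiff_comp f (fun w => RtoC (INR k / INR N) * w)%C); [exact Hl|].
    apply cdiff_mult; [apply cdiff_const | apply cdiff_id]. }
  assert (FF : forall k, (k <= N)%nat -> holo_disc (F k) rho /\
    forall w, Cmod w <= rho -> fst (F k w) = ln (Cmod (g k w))).
  { induction k as [|k IH]; intros Hk.
    - split.
      + intros w Hw. eexists. apply cdiff_const.
      + intros w Hw. simpl. unfold g. do 3 f_equal. simpl. unfold Rdiv. rewrite Rmult_0_l. ring.
    - destruct (IH ltac:(lia)) as [H1 H2]. split.
      + intros w Hw. destruct (H1 w Hw) as [l1 D1].
        destruct (Gd (S k) w Hk Hw) as [l2 D2]. destruct (Gd k w ltac:(lia) Hw) as [l3 D3].
        eexists. apply cdiff_plus; [exact D1|].
        apply (cdiff_comp Clog (fun w => g (S k) w / g k w)%C).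
        * apply cdiff_Clog. apply ratio_in_half_plane with c; auto with arith. now apply HU.
        * apply cdiff_mult; [exact D2|]. apply cdiff_inv; [exact D3|]. apply Gn; auto with arith.
      + intros w Hw. change (fst (F k w) + ln (Cmod (g (S k) w / g k w)) = ln (Cmod (g (S k) w))).
        rewrite H2 by exact Hw. rewrite Cmod_div by (apply Gn; auto with arith).
        pose proof (proj1 (Cmod_gt_0 _) (Gn k w ltac:(lia) Hw)).
        pose proof (proj1 (Cmod_gt_0 _) (Gn (S k) w ltac:(lia) Hw)).
        rewrite ln_div by assumption. ring. }
  exists (F N). destruct (FF N (Nat.le_refl N)) as [H1 H2]. split; [exact H1|].
  intros w Hw. rewrite H2 by exact Hw. unfold g. rewrite Rdiv_diag by lra. do 3 f_equal. ring.
Qed.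
End LogLift.

(** Stands for harmonicity. F may depend on rho because the number of factors in [log_lift] does. *)
Definition re_holo (v : C -> R) : Prop := forall rho, 0 < rho < 1 ->
  exists F, holo_disc F rho /\ forall w, Cmod w <= rho -> fst (F w) = v w.

Lemma re_holo_ln (f : C -> C) (c : R) :
  (forall z, inD z -> exists l, cdiff f z l) -> 0 < c ->
  (forall z, inD z -> c <= Cmod (f z)) ->
  re_holo (fun z => ln (Cmod (f z)) - ln c).
Proof.
  intros Hf Hc Hb rho Hr. destruct (log_lift f c rho Hf Hc Hb Hr) as (F & H1 & H2).
  exists (fun w => (F w + RtoC (- ln c))%C). split.
  - intros w Hw. destruct (H1 w Hw) as [l Hl]. eexists.
    apply cdiff_plus; [exact Hl | apply cdiff_const].
  - intros w Hw. simpl. rewrite H2 by exact Hw. ring.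
Qed.

Section ReHolo.
Variable v : C -> R.
Hypothesis Hv : re_holo v.

Lemma re_holo_continuous rho t : 0 < rho < 1 -> continuous (fun t => v (polar rho t)) t.
Proof.
  intros Hr. destruct (Hv rho Hr) as (F & H1 & H2).
  apply (continuous_ext (fun t => fst (F (polar rho t)))).
  - intros s. apply H2. rewrite Cmod_polar; lra.
  - destruct (H1 (polar rho t)) as [l Hl]; [rewrite Cmod_polar; lra|].
    apply (continuous_fst_C (fun t => F (polar rho t))).
    apply (continuous_comp (polar rho) F); [apply continuous_polar|].
    now apply cdiff_continuous with l.
Qed.

Lemma re_holo_mean rho : 0 < rho < 1 ->
  RInt (fun t => v (polar rho t)) 0 (2 * PI) = 2 * PI * v 0%C.
Proof.
  intros Hr. destruct (Hv rho Hr) as (F & H1 & H2).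
  rewrite <- H2 by (rewrite Cmod_0; lra). rewrite <- (mean_value_re F rho) by (auto; lra).
  apply RInt_ext. intros t _. symmetry. apply H2. rewrite Cmod_polar; lra.
Qed.

Lemma re_holo_poisson rho a : 0 < rho < 1 -> Cmod a < rho ->
  RInt (fun t => v (polar rho t) * poisson rho a t) 0 (2 * PI) = 2 * PI * v a.
Proof.
  intros Hr Ha. destruct (Hv rho Hr) as (F & H1 & H2).
  rewrite <- H2 by lra. rewrite <- (poisson_formula F rho) by (auto; lra).
  apply RInt_ext. intros t _. rewrite H2; [reflexivity | rewrite Cmod_polar; lra].
Qed.
End ReHolo.

(** * Maximal dyadic intervals *)

Definition when (P : Prop) (x : R) : R := if excluded_middle_informative P then x else 0.

Lemma when_true (P : Prop) x : P -> when P x = x.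
Proof. intros H. unfold when. now destruct excluded_middle_informative. Qed.

Lemma when_false (P : Prop) x : ~ P -> when P x = 0.
Proof. intros H. unfold when. now destruct excluded_middle_informative. Qed.

Lemma when_pos (P : Prop) x : 0 <= x -> 0 <= when P x.
Proof. intros H. unfold when. destruct excluded_middle_informative; lra. Qed.

Fixpoint rsum (f : nat -> R) (n : nat) : R :=
  match n with O => 0 | S n => rsum f n + f n end.

Lemma sum_f_R0_rsum f n : sum_f_R0 f n = rsum f (S n).
Proof. induction n as [|n IH]; simpl in *; [ring | now rewrite IH]. Qed.

Lemma rsum_le_index f n m : (n <= m)%nat -> (forall i, (n <= i)%nat -> 0 <= f i) -> rsum f n <= rsum f m.
Proof.
  intros H Hf. induction H as [|m H IH]; [lra|]. simpl. specialize (Hf m H). lra.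
Qed.

(** In the heap numbering the ancestors of [s] are the [s / 2 ^ j]. *)
Definition live (bad : nat -> Prop) (s : nat) : Prop :=
  forall j, (1 <= j)%nat -> ~ bad (s / 2 ^ j)%nat.

Lemma live_child (bad : nat -> Prop) (s e : nat) : (e <= 1)%nat ->
  live bad (2 * s + e) <-> live bad s /\ ~ bad s.
Proof.
  intros He.
  assert (D : forall j, ((2 * s + e) / 2 ^ S j = s / 2 ^ j)%nat).
  { intros j. rewrite Nat.pow_succ_r', <- Nat.Div0.div_div. f_equal.
    symmetry. apply (Nat.div_unique _ 2 s e); lia. }
  split.
  - intros H. split.
    + intros j Hj. rewrite <- D. apply H. lia.
    + specialize (H 1%nat (Nat.le_refl 1)). rewrite D, Nat.pow_0_r, Nat.div_1_r in H. exact H.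
  - intros [H1 H2] [|j] Hj; [lia|]. rewrite D. destruct j as [|j].
    + now rewrite Nat.pow_0_r, Nat.div_1_r.
    + apply H1. lia.
Qed.

(** The nodes of [[n, 2 n)] are the children, outside of [[1, n)], of the nodes of [[1, n)]; the
    mass of the live ones plus the cost of the nodes selected so far never increases with [n]. *)
Lemma maximal_bad_sum (bad : nat -> Prop) (m c : nat -> R) (B : nat) :
  (forall s, (1 <= s)%nat -> m s = m (2 * s)%nat + m (2 * s + 1)%nat) ->
  (forall s, (1 <= s)%nat -> 0 <= m s) -> ~ bad O ->
  (forall s, (s < B)%nat -> bad s -> c s <= m s) ->
  rsum (fun s => when (live bad s /\ bad s) (c s)) B <= m 1%nat.
Proof.
  intros Hm Hp H0 Hc.
  set (g := fun s => when (live bad s) (m s)).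
  assert (gp : forall s, (1 <= s)%nat -> 0 <= g s) by (intros; apply when_pos; auto).
  destruct B as [|B]; [simpl; now apply Hp|].
  assert (K : forall n, (n <= B)%nat -> rsum (fun s => when (live bad s /\ bad s) (c s)) (S n)
     + rsum g (2 * S n) - rsum g (S n) <= m 1%nat).
  { induction n as [|n IH]; intros Hn.
    - simpl. rewrite (when_false (live bad 0 /\ bad 0%nat)) by tauto.
      assert (g 1%nat <= m 1%nat); [|lra]. unfold g, when.
      destruct excluded_middle_informative; [lra | apply Hp; lia].
    - specialize (IH ltac:(lia)). replace (2 * S (S n))%nat with (S (S (2 * S n))) by lia.
      change (rsum (fun s => when (live bad s /\ bad s) (c s)) (S (S n))) with
        (rsum (fun s => when (live bad s /\ bad s) (c s)) (S n) +
         when (live bad (S n) /\ bad (S n)) (c (S n))).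
      change (rsum g (S (S (2 * S n)))) with (rsum g (2 * S n) + g (2 * S n)%nat + g (S (2 * S n))).
      change (rsum g (S (S n))) with (rsum g (S n) + g (S n)).
      set (s := S n) in *.
      enough (when (live bad s /\ bad s) (c s) + g (2 * s)%nat + g (S (2 * s)) <= g s) by lra.
      pose proof (live_child bad s 0 ltac:(lia)) as L0. pose proof (live_child bad s 1 ltac:(lia)) as L1.
      rewrite Nat.add_0_r in L0. rewrite Nat.add_1_r in L1.
      specialize (Hm s ltac:(lia)). rewrite Nat.add_1_r in Hm.
      specialize (Hc s ltac:(lia)). specialize (Hp s ltac:(lia)). unfold g.
      destruct (classic (live bad s)) as [A|A]; destruct (classic (bad s)) as [D|D].
      + rewrite (when_true (_ /\ _)), (when_true (live bad s)) by tauto.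
        rewrite !when_false by tauto. specialize (Hc D). lra.
      + rewrite (when_false (_ /\ _)), !when_true by tauto. lra.
      + rewrite !when_false by tauto. lra.
      + rewrite !when_false by tauto. lra. }
  specialize (K B (Nat.le_refl B)).
  pose proof (rsum_le_index g (S B) (2 * S B) ltac:(lia) ltac:(intros; apply gp; lia)). lra.
Qed.

(** The limit predicate is decided index by index: [b i] holds when, among the m that agree with b
    below i, arbitrarily large ones satisfy [x m i]. Each decision leaves arbitrarily large m, which
    replaces the extraction of nested subsequences. *)
Lemma diagonal_predicate (x : nat -> nat -> Prop) :
  exists b : nat -> Prop, forall M m0, exists m, (m0 <= m)%nat /\ forall i, (i < M)%nat -> x m i <-> b i.
Proof.
  set (agree := fix agree (M : nat) : nat -> Prop := match M with
    | O => fun _ => True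
    | S i => fun m => agree i m /\
       (x m i <-> forall m0, exists m', (m0 <= m')%nat /\ agree i m' /\ x m' i) end).
  exists (fun i => forall m0, exists m', (m0 <= m')%nat /\ agree i m' /\ x m' i).
  assert (K : forall M m0, exists m, (m0 <= m)%nat /\ agree M m).
  { induction M as [|M IH]; intros m0.
    - exists m0. split; [lia | exact I].
    - destruct (classic (forall m0, exists m', (m0 <= m')%nat /\ agree M m' /\ x m' M)) as [Y|Y].
      + destruct (Y m0) as (m & H1 & H2 & H3). exists m. split; auto. split; [exact H2 | tauto].
      (* Here no agreeing index from [m1] on satisfies [x m M], so going beyond [m1] makes both
         sides of the equivalence false. *)
      + apply not_all_ex_not in Y as Y'. destruct Y' as [m1 Hm1].
        destruct (IH (Nat.max m0 m1)) as (m & H1 & H2). exists m. split; [lia|].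
        split; [exact H2|]. split; [|intros F; now destruct Y].
        intros X. exfalso. apply Hm1. exists m. split; [lia | tauto]. }
  intros M m0. destruct (K M m0) as (m & H1 & H2). exists m. split; [exact H1|].
  clear K H1. induction M as [|M IH]; intros i Hi; [lia|].
  destruct H2 as [H2 H3]. destruct (Nat.eq_dec i M) as [->|N]; [exact H3|]. apply IH; auto. lia.
Qed.

(** Heap-indexed dyadic intervals of the root interval [[-4 pi, 4 pi]]. *)
Definition dlen (s : nat) : R := 8 * PI / 2 ^ Nat.log2 s.
Definition dleft (s : nat) : R := - (4 * PI) + INR (s - 2 ^ Nat.log2 s) * dlen s.

Lemma dlen_pos s : 0 < dlen s.
Proof. pose proof PI_RGT_0. apply Rdiv_lt_0_compat; [lra | apply pow_lt; lra]. Qed.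

Lemma dlen_child s e : (1 <= s)%nat -> (e <= 1)%nat ->
  dlen (2 * s + e) = dlen s / 2 /\ dleft (2 * s + e) = dleft s + INR e * (dlen s / 2).
Proof.
  intros Hs He.
  assert (L : Nat.log2 (2 * s + e) = S (Nat.log2 s)).
  { destruct e as [|[|e]]; [|apply Nat.log2_succ_double; lia | lia].
    rewrite Nat.add_0_r. apply Nat.log2_double; lia. }
  assert (E : dlen (2 * s + e) = dlen s / 2).
  { unfold dlen. rewrite L. simpl. field. apply pow_nonzero; lra. }
  split; [exact E|]. unfold dleft. rewrite E, L.
  pose proof (Nat.log2_spec s ltac:(lia)) as [LB _].
  rewrite Nat.pow_succ_r'.
  replace (2 * s + e - 2 * 2 ^ Nat.log2 s)%nat with (2 * (s - 2 ^ Nat.log2 s) + e)%nat by lia.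
  rewrite plus_INR, mult_INR. simpl INR at 1. field.
Qed.

(** The triple of a cell lies in the triple of each of its ancestors, so moving to a bad proper
    ancestor keeps theta covered; the heap number decreases, hence this ends at a maximal bad
    cell. *)
Lemma maximal_bad_ancestor (bad : nat -> Prop) (theta : R) : ~ bad O -> forall s, bad s ->
  dleft s - dlen s <= theta <= dleft s + 2 * dlen s ->
  exists p, (live bad p /\ bad p) /\ dleft p - dlen p <= theta <= dleft p + 2 * dlen p.
Proof.
  intros H0.
  assert (Anc : forall j s, (1 <= s / 2 ^ j)%nat ->
    dleft s - dlen s <= theta <= dleft s + 2 * dlen s ->
    dleft (s / 2 ^ j) - dlen (s / 2 ^ j) <= theta <= dleft (s / 2 ^ j) + 2 * dlen (s / 2 ^ j)).
  { induction j as [|j IH]; intros s Hs Ht.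
    - now rewrite Nat.pow_0_r, Nat.div_1_r.
    - rewrite Nat.pow_succ_r', <- Nat.Div0.div_div in Hs |- *.
      apply IH; [exact Hs|].
      assert (H1 : (1 <= s / 2)%nat).
      { destruct (s / 2)%nat as [|k]; [|lia]. rewrite Nat.Div0.div_0_l in Hs. exact Hs. }
      pose proof (Nat.div_mod_eq s 2) as E.
      assert (M : (s mod 2 <= 1)%nat) by (pose proof (Nat.mod_upper_bound s 2); lia).
      destruct (dlen_child (s / 2) (s mod 2) H1 M) as [E1 E2]. rewrite <- E in E1, E2.
      pose proof (dlen_pos (s/2)).
      assert (0 <= INR (s mod 2) <= 1) by (split; [apply pos_INR | now apply (le_INR _ 1)]).
      assert (0 <= INR (s mod 2) * (dlen (s / 2) / 2) <= dlen (s / 2) / 2) by (split; nra).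
      rewrite E1, E2 in Ht. lra. }
  intros s. induction s as [s IH] using (well_founded_induction lt_wf). intros Hb Ht.
  destruct (classic (live bad s)) as [L|L]; [exists s; auto|].
  apply not_all_ex_not in L. destruct L as [j L].
  assert (Hj : (1 <= j)%nat /\ bad (s / 2 ^ j)%nat) by tauto. destruct Hj as [Hj Hbj].
  assert (H1 : (1 <= s / 2 ^ j)%nat) by (destruct (s / 2 ^ j)%nat; [tauto | lia]).
  apply (IH (s / 2 ^ j)%nat); auto.
  apply Nat.div_lt.
  - destruct s; [rewrite Nat.Div0.div_0_l in H1; lia | lia].
  - apply Nat.pow_gt_1; lia.
Qed.

(** In the shifted coordinate the period [0, 2 pi) is the third quarter of the root interval, so the
    cell of theta has both neighbours in its generation, with consecutive heap numbers. *)
Lemma dyadic_neighbours (theta : R) (j : nat) : 0 <= theta < 2 * PI -> (1 <= j)%nat ->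
  exists s, (2 <= s)%nat /\ Nat.log2 s = (j + 2)%nat /\ Nat.log2 (s - 1) = (j + 2)%nat /\
    Nat.log2 (s + 1) = (j + 2)%nat /\
    dlen s = 2 * PI / 2 ^ j /\ dlen (s - 1) = dlen s /\ dlen (s + 1) = dlen s /\
    dleft (s - 1) = dleft s - dlen s /\ dleft (s + 1) = dleft s + dlen s /\
    dleft s <= theta <= dleft s + dlen s.
Proof.
  intros Ht Hj. pose proof PI_RGT_0 as HP.
  assert (P2 : 0 < 2 ^ j) by (apply pow_lt; lra).
  set (l := 2 * PI / 2 ^ j).
  assert (Hl : 0 < l) by (apply Rdiv_lt_0_compat; lra).
  assert (Q : 2 * 2 ^ j <= (theta + 4 * PI) / l < 3 * 2 ^ j).
  { assert (El : l * 2 ^ j = 2 * PI) by (unfold l; field; lra).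
    assert (Eq : (theta + 4 * PI) / l * l = theta + 4 * PI) by (field; lra).
    split; [apply Rmult_le_reg_r with l | apply Rmult_lt_reg_r with l]; nra. }
  destruct (nfloor_ex ((theta + 4 * PI) / l)) as [k Hk]; [lra|].
  assert (E2 : INR (2 ^ j) = 2 ^ j) by (rewrite pow_INR; reflexivity).
  assert (K1 : (2 * 2 ^ j <= k)%nat).
  { apply Nat.lt_succ_r. apply INR_lt. rewrite S_INR, mult_INR, E2. simpl INR. lra. }
  assert (K2 : (k < 3 * 2 ^ j)%nat).
  { apply INR_lt. rewrite mult_INR, E2. simpl INR. lra. }
  pose proof (Nat.pow_nonzero 2 j ltac:(lia)) as NZ.
  assert (E4 : (2 ^ (j + 2) = 4 * 2 ^ j)%nat) by (rewrite Nat.pow_add_r; simpl; lia).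
  assert (LG : forall k', (k' < 4 * 2 ^ j)%nat -> Nat.log2 (2 ^ (j + 2) + k') = (j + 2)%nat).
  { intros k' Hk'. apply Nat.log2_unique; [lia|]. rewrite Nat.pow_succ_r', E4. lia. }
  assert (DL : forall k', (k' < 4 * 2 ^ j)%nat -> dlen (2 ^ (j + 2) + k') = l /\
     dleft (2 ^ (j + 2) + k') = - (4 * PI) + INR k' * l).
  { intros k' Hk'. assert (E : dlen (2 ^ (j + 2) + k') = l).
    { unfold dlen, l. rewrite LG by exact Hk'. rewrite pow_add. simpl. field. lra. }
    split; [exact E|]. unfold dleft. rewrite E, LG by exact Hk'. do 3 f_equal. lia. }
  exists (2 ^ (j + 2) + k)%nat.
  replace (2 ^ (j + 2) + k - 1)%nat with (2 ^ (j + 2) + (k - 1))%nat by lia.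
  replace (2 ^ (j + 2) + k + 1)%nat with (2 ^ (j + 2) + (k + 1))%nat by lia.
  destruct (DL k ltac:(lia)) as [A1 A2]. destruct (DL (k - 1)%nat ltac:(lia)) as [B1 B2].
  destruct (DL (k + 1)%nat ltac:(lia)) as [C1 C2].
  rewrite A1, A2, B1, B2, C1, C2, !LG by lia.
  rewrite minus_INR, plus_INR by lia. simpl INR.
  assert (INR k * l <= theta + 4 * PI <= INR k * l + l).
  { destruct Hk as [H1 H2]. apply Rle_div_r in H1; [|lra]. apply Rlt_div_l in H2; lra. }
  repeat split; try lia; lra.
Qed.

Lemma exists_dyadic_scale (h : R) : 0 < h <= 1 -> exists n, / 2 ^ n <= h <= 2 * / 2 ^ n.
Proof.
  intros Hh.
  assert (E : exists n, / 2 ^ n < h).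
  { destruct (pow_lt_1_zero (/2) ltac:(rewrite Rabs_pos_eq; lra) h ltac:(lra)) as [N HN].
    exists N. specialize (HN N (Nat.le_refl N)). rewrite pow_inv in HN.
    rewrite Rabs_pos_eq in HN; [exact HN|]. apply Rlt_le, Rinv_0_lt_compat, pow_lt; lra. }
  destruct E as [N HN]. induction N as [|N IH].
  - simpl in HN. rewrite Rinv_1 in HN. lra.
  - destruct (Rlt_dec (/ 2 ^ N) h) as [L|L]; [now apply IH|].
    exists (S N). split; [lra|]. simpl. rewrite Rinv_mult. lra.
Qed.

(** * Trigonometric estimates and integrals of periodic functions *)

Lemma sin_ge_third (y : R) : 0 <= y <= 2 -> y / 3 <= sin y.
Proof.
  intros Hy. destruct (SIN y) as [H _]; [lra|pose proof PI2_3_2; lra|].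
  assert (E : sin_lb y = y * (1 - y * y / 6 + y * y * (y * y) / 120 - y * y * (y * y) * (y * y) / 5040)).
  { unfold sin_lb, sin_approx, sin_term, sum_f_R0.
    replace (INR (fact (2 * 0 + 1))) with 1 by (simpl; ring).
    replace (INR (fact (2 * 1 + 1))) with 6 by (simpl; ring).
    replace (INR (fact (2 * 2 + 1))) with 120 by (rewrite INR_IZR_INZ; reflexivity).
    replace (INR (fact (2 * 3 + 1))) with 5040 by (rewrite INR_IZR_INZ; reflexivity).
    simpl. field. }
  rewrite E in H. eapply Rle_trans; [|exact H]. clear H E.
  assert (0 <= y * y <= 4) by nra. set (u := y * y) in *.
  assert (0 <= u * u) by nra.
  assert (u * u * u <= 4 * (u * u)) by nra. nra.
Qed.

(** 1 - cos x = 2 sin^2 (|x| / 2), and [sin_ge_third] bounds the sine below by |x| / 6. *)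
Lemma one_minus_cos_ge (x : R) : Rabs x <= PI -> x ^ 2 / 18 <= 1 - cos x.
Proof.
  intros Hx. pose proof PI_4.
  replace (cos x) with (cos (2 * (Rabs x / 2))).
  2:{ replace (2 * (Rabs x / 2)) with (Rabs x) by field.
      unfold Rabs. destruct Rcase_abs; [apply cos_neg | reflexivity]. }
  rewrite cos_2a_sin. pose proof (Rabs_pos x).
  pose proof (sin_ge_third (Rabs x / 2) ltac:(lra)) as S.
  rewrite <- (pow2_abs x). nra.
Qed.

Lemma Cmod_polar_diff_sq (rho r t theta : R) :
  Cmod (polar rho t - polar r theta) ^ 2 = (rho - r) ^ 2 + 2 * rho * r * (1 - cos (t - theta)).
Proof.
  rewrite Cmod2_alt. unfold Re, Im, polar; simpl. rewrite cos_minus.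
  pose proof (sin2_cos2 t) as A. pose proof (sin2_cos2 theta) as B. unfold Rsqr in A, B.
  replace ((rho - r) * ((rho - r) * 1)) with
    (rho * rho * (sin t * sin t + cos t * cos t) + r * r * (sin theta * sin theta + cos theta * cos theta)
      - 2 * rho * r) by (rewrite A, B; ring).
  ring.
Qed.

Lemma RInt_Chasles_R (f : R -> R) (a b c : R) : (forall t, continuous f t) ->
  RInt f a c = RInt f a b + RInt f b c.
Proof.
  intros H. symmetry. apply (RInt_Chasles (V := R_CompleteNormedModule)); now apply ex_RInt_cont.
Qed.

Lemma RInt_shift_period (g : R -> R) (p a b : R) : (forall t, continuous g t) ->
  (forall t, g (t + p) = g t) -> RInt g (a + p) (b + p) = RInt g a b.
Proof.
  intros Hc Hp.
  assert (E := RInt_comp_lin (V := R_CompleteNormedModule) g 1 p a b).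
  rewrite !Rmult_1_l in E. rewrite <- E by now apply ex_RInt_cont.
  apply RInt_ext. intros t _. change (1 * g (1 * t + p) = g t). rewrite !Rmult_1_l. apply Hp.
Qed.

Lemma RInt_period (g : R -> R) (p a : R) : (forall t, continuous g t) ->
  (forall t, g (t + p) = g t) -> RInt g a (a + p) = RInt g 0 p.
Proof.
  intros Hc Hp. rewrite (RInt_Chasles_R g a 0 (a + p)), (RInt_Chasles_R g 0 p (a + p)) by auto.
  assert (E := RInt_shift_period g p 0 a Hc Hp). rewrite Rplus_0_l in E. rewrite E.
  rewrite <- (opp_RInt_swap (V := R_CompleteNormedModule) g 0 a) by now apply ex_RInt_cont.
  unfold opp; simpl. ring.
Qed.

Lemma RInt_nonneg (g : R -> R) (a b : R) : a <= b -> (forall t, continuous g t) ->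
  (forall t, 0 <= g t) -> 0 <= RInt g a b.
Proof. intros. apply RInt_ge_0; auto. now apply ex_RInt_cont. Qed.

(** * Covering the limsup set *)

Section Shell.
Variables (phi P : R -> R) (theta : R).
Hypothesis Cphi : forall t, continuous phi t.
Hypothesis CP : forall t, continuous P t.
Hypothesis phi_pos : forall t, 0 <= phi t.

Let weighted_le K a b : a <= b -> (forall t, a < t < b -> P t <= K) ->
  RInt (fun t => phi t * P t) a b <= K * RInt phi a b.
Proof.
  intros Hab H.
  change (K * RInt phi a b) with (scal K (RInt phi a b)).
  rewrite <- (RInt_scal (V := R_CompleteNormedModule)) by now apply ex_RInt_cont.
  apply RInt_le; auto.
  - apply ex_RInt_cont. intros t. now apply continuous_Rmult.
  - apply (ex_RInt_scal (V := R_NormedModule)). now apply ex_RInt_cont.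
  - intros t Ht. unfold scal; simpl; unfold mult; simpl. specialize (H t Ht). specialize (phi_pos t). nra.
Qed.

Lemma core_estimate K s : 0 <= s -> (forall t, P t <= K) ->
  RInt (fun t => phi t * P t) (theta - s) (theta + s) <= K * RInt phi (theta - s) (theta + s).
Proof. intros. apply weighted_le; auto. lra. Qed.

(** K is charged for the mass of the whole outer interval, not just of the shell, because the
    available bounds concern full intervals. *)
Lemma shell_estimate K s' s : 0 <= s' <= s -> 0 <= K ->
  (forall t, s' <= Rabs (t - theta) <= s -> P t <= K) ->
  RInt (fun t => phi t * P t) (theta - s) (theta + s) <=
  RInt (fun t => phi t * P t) (theta - s') (theta + s') + K * RInt phi (theta - s) (theta + s).
Proof.
  intros Hs HK H.
  assert (CC : forall t, continuous (fun t => phi t * P t) t) by (intros; now apply continuous_Rmult).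
  rewrite (RInt_Chasles_R _ (theta - s) (theta - s') (theta + s)) by auto.
  rewrite (RInt_Chasles_R _ (theta - s') (theta + s') (theta + s)) by auto.
  rewrite (RInt_Chasles_R phi (theta - s) (theta - s') (theta + s)) by auto.
  rewrite (RInt_Chasles_R phi (theta - s') (theta + s') (theta + s)) by auto.
  pose proof (weighted_le K (theta - s) (theta - s') ltac:(lra)) as A.
  pose proof (weighted_le K (theta + s') (theta + s) ltac:(lra)) as B.
  pose proof (RInt_nonneg phi (theta - s') (theta + s') ltac:(lra) Cphi phi_pos).
  assert (A' := A ltac:(intros t Ht; apply H; rewrite Rabs_left1 by lra; lra)).
  assert (B' := B ltac:(intros t Ht; apply H; rewrite Rabs_pos_eq by lra; lra)).
  nra.
Qed.
End Shell.

Section Cover.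
Variable v : C -> R.
Hypothesis Hv : re_holo v.
Hypothesis v_pos : forall z, inD z -> 0 <= v z.

Definition circle_mass (rho a b : R) : R := RInt (fun t => v (polar rho t)) a b.

Let v_polar_pos rho t : 0 < rho < 1 -> 0 <= v (polar rho t).
Proof. intros H. apply v_pos. unfold inD. rewrite Cmod_polar; lra. Qed.

Let mass_period rho a : 0 < rho < 1 -> circle_mass rho a (a + 2 * PI) = 2 * PI * v 0%C.
Proof.
  intros H. rewrite <- (re_holo_mean v Hv rho H). apply RInt_period.
  - intros; now apply re_holo_continuous.
  - intros t. now rewrite polar_period.
Qed.

Let mass_pos rho a b : 0 < rho < 1 -> a <= b -> 0 <= circle_mass rho a b.
Proof.
  intros H Hab. apply RInt_nonneg; auto. intros; now apply re_holo_continuous.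
Qed.

Let mass_chasles rho a b c : 0 < rho < 1 ->
  circle_mass rho a c = circle_mass rho a b + circle_mass rho b c.
Proof. intros H. apply RInt_Chasles_R. intros; now apply re_holo_continuous. Qed.

Let continuous_poisson rho a t : 0 < rho -> Cmod a < rho -> continuous (poisson rho a) t.
Proof.
  intros Hr Ha. unfold poisson. apply continuous_Rmult; [apply continuous_const|].
  apply continuous_Rinv_comp.
  - apply (continuous_ext (fun t => fst (polar rho t - a)%C ^ 2 + snd (polar rho t - a)%C ^ 2)).
    + intros s. symmetry. apply Cmod2_alt.
    + unfold polar; simpl.
      apply (ex_derive_continuous (V := R_NormedModule)). auto_derive. auto.
  - apply pow_nonzero, Rgt_not_eq, Cmod_gt_0. now apply polar_sub_neq_0.
Qed.

(** Taking rho at least halfway from r to 1 makes rho - r comparable to 1 - r, so neither bound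
    depends on rho. In the second, [one_minus_cos_ge] and [2 * rho * r >= / 2] bound the denominator
    below by d^2 / 36, while the numerator is at most 2 (1 - r). *)
Lemma poisson_bounds rho r theta t : / 2 <= r < rho -> rho < 1 -> (1 - r) / 2 <= rho - r ->
  poisson rho (polar r theta) t <= 4 / (1 - r) /\
  (forall d, 0 < d -> d <= Rabs (t - theta) <= PI ->
    poisson rho (polar r theta) t <= 72 * (1 - r) / d ^ 2).
Proof.
  intros Hr Hrho Hg. unfold poisson. rewrite Cmod_polar_diff_sq, Cmod_polar by lra.
  pose proof (COS_bound (t - theta)) as CB.
  replace (rho ^ 2 - r ^ 2) with ((rho - r) * (rho + r)) by ring.
  assert (D1 : (rho - r) ^ 2 <= (rho - r) ^ 2 + 2 * rho * r * (1 - cos (t - theta))).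
  { assert (0 <= 2 * rho * r * (1 - cos (t - theta))) by (apply Rmult_le_pos; nra). lra. }
  set (D := (rho - r) ^ 2 + 2 * rho * r * (1 - cos (t - theta))) in *.
  assert (0 < (rho - r) ^ 2) by nra. assert (D0 : 0 < D) by lra.
  split.
  - apply Rle_trans with ((rho - r) * (rho + r) / (rho - r) ^ 2).
    + apply Rmult_le_compat_l; [nra|]. apply Rinv_le_contravar; lra.
    + replace ((rho - r) * (rho + r) / (rho - r) ^ 2) with ((rho + r) * / (rho - r)) by (field; lra).
      replace (4 / (1 - r)) with (2 * / ((1 - r) / 2)) by (field; lra).
      apply Rmult_le_compat; [lra| |lra|].
      * apply Rlt_le, Rinv_0_lt_compat; lra.
      * apply Rinv_le_contravar; lra.
  - intros d Hd Ht.
    assert (D2 : d ^ 2 / 36 <= D).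
    { pose proof (one_minus_cos_ge (t - theta) ltac:(lra)) as Q.
      rewrite <- (pow2_abs (t - theta)) in Q.
      assert (d ^ 2 <= Rabs (t - theta) ^ 2) by nra.
      assert (d ^ 2 / 18 <= 1 - cos (t - theta)) by lra.
      assert (/ 2 <= 2 * rho * r) by nra.
      assert (/ 2 * (d ^ 2 / 18) <= 2 * rho * r * (1 - cos (t - theta)))
        by (apply Rmult_le_compat; nra).
      unfold D. lra. }
    assert (0 < d ^ 2) by nra.
    replace (72 * (1 - r) / d ^ 2) with (2 * (1 - r) * / (d ^ 2 / 36)) by (field; lra).
    apply Rmult_le_compat; [nra| |nra|].
    + apply Rlt_le, Rinv_0_lt_compat; lra.
    + apply Rinv_le_contravar; lra.
Qed.

(** With h = 1 - r, the shell at scale j contributes at most 8 h 4^j times B n / 2^j. These terms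
    grow geometrically and h 2^n <= 2, so the shells give 16 B n and the core 4 B n. Beyond scale N
    only the total mass is used, against a kernel of size 2 h 4^N. *)
Lemma poisson_shells (rho r theta B : R) (N n : nat) :
  / 2 <= r -> rho < 1 -> (1 - r) / 2 <= rho - r -> 0 <= B ->
  (1 <= N <= n)%nat -> / 2 ^ n <= 1 - r <= 2 * / 2 ^ n ->
  (forall j, (N <= j <= n)%nat ->
     circle_mass rho (theta - 2 * PI / 2 ^ j) (theta + 2 * PI / 2 ^ j) <= B * INR n / 2 ^ j) ->
  2 * PI * v (polar r theta) <= 20 * B * INR n + 2 * (1 - r) * 4 ^ N * (2 * PI * v 0%C).
Proof.
  intros Hr Hrho Hg HB HN Hn Hm.
  assert (r1 : r < 1) by (assert (0 < / 2 ^ n) by (apply Rinv_0_lt_compat, pow_lt; lra); lra).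
  assert (rr : r < rho) by lra.
  pose proof PI_RGT_0 as HP0. pose proof PI2_3_2 as HP3.
  assert (Ha : Cmod (polar r theta) < rho) by (rewrite Cmod_polar; lra).
  set (phi := fun t => v (polar rho t)). set (P := poisson rho (polar r theta)).
  assert (Cphi : forall t, continuous phi t) by (intros; apply re_holo_continuous; auto; lra).
  assert (CP : forall t, continuous P t) by (intros; apply continuous_poisson; lra).
  assert (phi_pos : forall t, 0 <= phi t) by (intros; apply v_polar_pos; lra).
  set (I := fun s => RInt (fun t => phi t * P t) (theta - s) (theta + s)).
  set (h := 1 - r) in *. assert (Hg' : (1 - r) / 2 <= rho - r) by exact Hg.
  assert (sp : forall j, 0 < 2 * PI / 2 ^ j) by (intros j; apply Rdiv_lt_0_compat; [lra | apply pow_lt; lra]).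
  assert (sPI : forall j, (1 <= j)%nat -> 2 * PI / 2 ^ j <= PI).
  { intros [|j] Hj; [lia|]. simpl. 
    assert (1 <= 2 ^ j) by (apply pow_R1_Rle; lra).
    apply Rle_div_l; [lra|]. nra. }
  assert (full : I PI = 2 * PI * v (polar r theta)).
  { unfold I. rewrite <- (re_holo_poisson v Hv rho (polar r theta)) by lra.
    replace (theta + PI) with (theta - PI + 2 * PI) by ring.
    apply (RInt_period (fun t => phi t * P t)).
    - intros; now apply continuous_Rmult.
    - intros t. unfold phi, P, poisson. now rewrite polar_period. }
  assert (M1 : RInt phi (theta - PI) (theta + PI) = 2 * PI * v 0%C).
  { replace (theta + PI) with (theta - PI + 2 * PI) by ring. apply mass_period; lra. }
  rewrite <- full.
  assert (Hh : 0 < h) by (unfold h; lra).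
  assert (Pn : 0 < 2 ^ n) by (apply pow_lt; lra).
  pose proof (pos_INR n) as Hn0.
  assert (hn : h * 2 ^ n <= 2 /\ 1 <= h * 2 ^ n).
  { assert (E : / 2 ^ n * 2 ^ n = 1) by (apply Rinv_l; lra). split; nra. }
  assert (Step : forall k, (k <= n - N)%nat ->
     I (2 * PI / 2 ^ (n - k)) <= 4 * B * INR n / (h * 2 ^ n) + 8 * h * B * INR n * (2 ^ n - 2 ^ (n - k))).
  { induction k as [|k IH]; intros Hk.
    - rewrite Nat.sub_0_r, Rminus_diag, Rmult_0_r, Rplus_0_r.
      eapply Rle_trans; [apply (core_estimate phi P theta Cphi CP phi_pos (4 / h))|].
      + left; apply sp. 
      + intros t. now apply poisson_bounds.
      + replace (4 * B * INR n / (h * 2 ^ n)) with (4 / h * (B * INR n / 2 ^ n)) by (field; lra).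
        apply Rmult_le_compat_l; [apply Rlt_le, Rdiv_lt_0_compat; lra|]. apply Hm. lia.
    - specialize (IH ltac:(lia)).
      set (j := (n - S k)%nat) in *. replace (n - k)%nat with (S j) in IH by lia.
      assert (Pj : 0 < 2 ^ j) by (apply pow_lt; lra).
      assert (Sj : 2 * PI / 2 ^ S j = PI / 2 ^ j) by (simpl; field; lra).
      assert (Q := shell_estimate phi P theta Cphi CP phi_pos (8 * h * (2 ^ j) ^ 2)
        (2 * PI / 2 ^ S j) (2 * PI / 2 ^ j)).
      fold (I (2 * PI / 2 ^ S j)) in Q. fold (I (2 * PI / 2 ^ j)) in Q.
      eapply Rle_trans; [apply Q|].
      + split; [left; apply sp|]. rewrite Sj. apply Rmult_le_compat_r; [left; now apply Rinv_0_lt_compat|lra].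
      + nra.
      + intros t Ht. eapply Rle_trans; [apply (poisson_bounds rho r theta t)|]; try lra.
        * exact (sp (S j)).
        * split; [apply Ht|]. eapply Rle_trans; [apply Ht | apply sPI; lia].
        (* The constant 8 is 72 / 9, from PI >= 3. *)
        * rewrite Sj. fold h. replace (72 * h / (PI / 2 ^ j) ^ 2) with (72 * h * (2 ^ j) ^ 2 * / (PI ^ 2)) by (field; lra).
          replace (8 * h * (2 ^ j) ^ 2) with (72 * h * (2 ^ j) ^ 2 * / 9) by field.
          apply Rmult_le_compat_l; [nra|]. apply Rinv_le_contravar; nra.
      + eapply Rle_trans; [apply Rplus_le_compat; [exact IH|
           apply Rmult_le_compat_l; [nra | apply (Hm j); lia]]|].
        right. simpl. field. lra. }
  specialize (Step (n - N)%nat (Nat.le_refl _)). replace (n - (n - N))%nat with N in Step by lia.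
  assert (PN : 0 < 2 ^ N) by (apply pow_lt; lra).
  assert (Q := shell_estimate phi P theta Cphi CP phi_pos (2 * h * 4 ^ N) (2 * PI / 2 ^ N) PI).
  fold (I (2 * PI / 2 ^ N)) in Q. fold (I PI) in Q. rewrite M1 in Q.
  eapply Rle_trans; [apply Q|].
  - split; [left; apply sp | apply sPI; lia].
  - assert (0 < 4 ^ N) by (apply pow_lt; lra). nra.
  - intros t Ht. eapply Rle_trans; [apply (poisson_bounds rho r theta t)|]; try lra.
    + exact (sp N).
    + exact Ht.
    + fold h. replace (4 ^ N) with ((2 ^ N) ^ 2) by (rewrite <- pow_mult, Nat.mul_comm, pow_mult; f_equal; ring).
      replace (72 * h / (2 * PI / 2 ^ N) ^ 2) with (18 * h * (2 ^ N) ^ 2 * / (PI ^ 2)) by (field; lra).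
      replace (2 * h * (2 ^ N) ^ 2) with (18 * h * (2 ^ N) ^ 2 * / 9) by field.
      apply Rmult_le_compat_l; [nra|]. apply Rinv_le_contravar; nra.
  - apply Rplus_le_compat_r. eapply Rle_trans; [exact Step|].
    assert (BN : 0 <= B * INR n) by nra.
    assert (4 * B * INR n / (h * 2 ^ n) <= 4 * B * INR n).
    { apply Rle_div_l; [lra|]. nra. }
    assert (8 * h * B * INR n * (2 ^ n - 2 ^ N) <= 16 * (B * INR n)).
    { replace (8 * h * B * INR n * (2 ^ n - 2 ^ N)) with (8 * (B * INR n) * (h * (2 ^ n - 2 ^ N))) by ring.
      assert (h * (2 ^ n - 2 ^ N) <= 2) by nra. nra. }
    lra.
Qed.

Lemma lam_log_pos t : 0 <= t -> 0 <= lam_log t.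
Proof. intros H. apply Rmult_le_pos; [exact H | apply Rabs_pos]. Qed.

(** The length is 6 pi / 2^j with 6 pi <= 24. For j >= 5 it is at most 1, so the absolute logarithm
    is j ln 2 - ln (6 pi), at most j. *)
Lemma lam_log_triple_dyadic (j : nat) : (5 <= j)%nat ->
  lam_log (3 * (2 * PI / 2 ^ j)) <= 24 * INR j / 2 ^ j.
Proof.
  intros Hj. pose proof PI_4. pose proof PI2_3_2.
  assert (P : 0 < 2 ^ j) by (apply pow_lt; lra).
  assert (P5 : 32 <= 2 ^ j) by (replace 32 with (2 ^ 5) by ring; apply Rle_pow; [lra | exact Hj]).
  unfold lam_log. replace (3 * (2 * PI / 2 ^ j)) with (6 * PI * / 2 ^ j) by (field; lra).
  assert (I : 0 < / 2 ^ j) by (now apply Rinv_0_lt_compat).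
  assert (L : ln (6 * PI * / 2 ^ j) = ln (6 * PI) - INR j * ln 2).
  { rewrite ln_mult, ln_Rinv, ln_pow by lra. ring. }
  assert (L1 : 0 <= ln (6 * PI)) by (rewrite <- ln_1; apply ln_le; lra).
  assert (L2 : 0 < ln 2 < 1).
  { split; [rewrite <- ln_1; apply ln_increasing; lra|].
    rewrite <- (ln_exp 1). apply ln_increasing; [lra|]. pose proof (exp_ineq1 1). lra. }
  assert (L3 : ln (6 * PI * / 2 ^ j) <= 0).
  { rewrite <- ln_1. apply ln_le; [nra|].
    replace 1 with (2 ^ j * / 2 ^ j) by (apply Rinv_r; lra). apply Rmult_le_compat_r; lra. }
  rewrite Rabs_left1 by exact L3. rewrite L.
  pose proof (pos_INR j).
  replace (24 * INR j / 2 ^ j) with (24 * / 2 ^ j * INR j) by (field; lra).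
  apply Rmult_le_compat; try nra.
Qed.

(** The cost is that of the triple, since the triples form the covering; the bound [g0] on the
    generation keeps its arcs short. *)
Definition heavy (b rho : R) (g0 s : nat) : Prop :=
  (g0 <= Nat.log2 s)%nat /\ b * lam_log (3 * dlen s) <= circle_mass rho (dleft s) (dleft s + dlen s).

(** One radius r is fixed before rho, so [B] and [rho0] serve all later rho. If no cell near theta
    were heavy, [poisson_shells] would give 2 pi v <= eps n + eps / 4, whereas v >= eps n / 4 gives
    2 pi v >= 3/2 eps n. The constant is 1440 = 20 * 3 * 24: the shells, the three neighbouring
    cells, and [lam_log_triple_dyadic]. *)
Lemma exists_heavy (eps theta : R) (N : nat) : 0 < eps -> (5 <= N)%nat -> in_period theta ->
  (forall r0, 0 <= r0 < 1 -> exists r, r0 < r < 1 /\ eps * Rabs (ln (1 - r)) <= v (polar r theta)) ->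
  exists (B : nat) (rho0 : R), rho0 < 1 /\ forall rho, rho0 < rho < 1 ->
    exists s, (s < B)%nat /\ heavy (eps / 1440) rho (N + 2) s /\
      dleft s - dlen s <= theta <= dleft s + 2 * dlen s.
Proof.
  intros He HN Ht Hl. pose proof PI_RGT_0 as HP0. pose proof PI2_3_2 as HP3.
  set (b := eps / 1440).
  assert (v0 : 0 <= v 0%C) by (apply v_pos; unfold inD; rewrite Cmod_0; lra).
  assert (P4N : 0 < 4 ^ N) by (apply pow_lt; lra).
  assert (P2N : 0 < / 2 ^ N) by (apply Rinv_0_lt_compat, pow_lt; lra).
  set (K := 2 * 4 ^ N * (2 * PI * v 0%C) + 1).
  assert (HK : 1 <= K) by (unfold K; assert (0 <= 4 ^ N * (PI * v 0%C)) by (apply Rmult_le_pos; nra); lra).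
  set (h0 := Rmin (/ 2) (Rmin (/ 2 ^ N) (eps / (4 * K)))).
  assert (h0p : 0 < h0).
  { apply Rmin_pos; [lra|]. apply Rmin_pos; [lra|]. apply Rdiv_lt_0_compat; lra. }
  assert (h01 : h0 <= / 2) by apply Rmin_l.
  assert (h02 : h0 <= / 2 ^ N) by (eapply Rle_trans; [apply Rmin_r | apply Rmin_l]).
  assert (h03 : h0 <= eps / (4 * K)) by (eapply Rle_trans; [apply Rmin_r | apply Rmin_r]).
  destruct (Hl (1 - h0)) as (r & Hr & Hvr); [lra|].
  destruct (exists_dyadic_scale (1 - r)) as [n Hn]; [lra|].
  assert (HNn : (N <= n)%nat).
  { destruct (le_lt_dec N n) as [L|L]; [exact L|]. exfalso.
    assert (2 * / 2 ^ N <= / 2 ^ n); [|lra].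
    assert (2 ^ S n <= 2 ^ N) by (apply Rle_pow; [lra | exact L]). simpl in H.
    assert (0 < 2 ^ n) by (apply pow_lt; lra). 
    replace (/ 2 ^ n) with (2 * / (2 * 2 ^ n)) by (field; lra).
    apply Rmult_le_compat_l; [lra|]. apply Rinv_le_contravar; lra. }
  (* Scale j is generation j + 2 of the heap, so scales up to n have heap numbers below
     [2 ^ (n + 3)]; [rho0] is the midpoint of r and 1. *)
  exists (2 ^ (n + 3))%nat, (1 - (1 - r) / 2). split; [lra|].
  intros rho Hrho. apply NNPP. intros Hno.
  assert (Hm : forall j, (N <= j <= n)%nat ->
     circle_mass rho (theta - 2 * PI / 2 ^ j) (theta + 2 * PI / 2 ^ j) <= (72 * b) * INR n / 2 ^ j).
  { intros j Hj.
    destruct (dyadic_neighbours theta j Ht ltac:(lia)) as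
      (s & S2 & Lg & Lg1 & Lg2 & D & D1 & D2 & X1 & X2 & XT).
    set (l := 2 * PI / 2 ^ j) in *.
    assert (Sm : (s + 1 < 2 ^ (n + 3))%nat).
    { pose proof (Nat.log2_spec (s + 1) ltac:(lia)) as [_ U]. rewrite Lg2 in U.
      eapply Nat.lt_le_trans; [exact U|]. apply Nat.pow_le_mono_r; lia. }
    assert (lp : 0 < l) by (rewrite <- D; apply dlen_pos).
    assert (NH : forall k, (k < 2 ^ (n + 3))%nat -> Nat.log2 k = (j + 2)%nat -> dlen k = l ->
      dleft k - l <= theta <= dleft k + 2 * l ->
      circle_mass rho (dleft k) (dleft k + l) <= b * (24 * INR j / 2 ^ j)).
    { intros k Hk Lk Dk Tk. apply Rnot_lt_le. intros A. apply Hno. exists k.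
      split; [exact Hk|]. rewrite <- Dk in Tk. split; [|exact Tk]. split; [lia|].
      rewrite Dk. eapply Rle_trans; [|apply Rlt_le, A].
      apply Rmult_le_compat_l; [unfold b; lra|]. apply lam_log_triple_dyadic. lia. }
    rewrite D in *.
    pose proof (NH s ltac:(lia) Lg D ltac:(lra)) as N0.
    pose proof (NH (s - 1)%nat ltac:(lia) Lg1 D1 ltac:(lra)) as N1.
    pose proof (NH (s + 1)%nat ltac:(lia) Lg2 D2 ltac:(lra)) as N2.
    rewrite X1 in N1. rewrite X2 in N2. replace (dleft s - l + l) with (dleft s) in N1 by ring.
    assert (rho01 : 0 < rho < 1) by lra.
    pose proof (mass_pos rho (dleft s - l) (theta - l) rho01 ltac:(lra)) as M1.
    pose proof (mass_pos rho (theta + l) (dleft s + l + l) rho01 ltac:(lra)) as M2.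
    assert (Ch : circle_mass rho (dleft s - l) (dleft s + l + l) =
       circle_mass rho (dleft s - l) (dleft s) + circle_mass rho (dleft s) (dleft s + l)
        + circle_mass rho (dleft s + l) (dleft s + l + l)).
    { rewrite (mass_chasles rho _ (dleft s + l) _ rho01).
      now rewrite (mass_chasles rho _ (dleft s) (dleft s + l) rho01). }
    rewrite (mass_chasles rho _ (theta - l) _ rho01) in Ch.
    rewrite (mass_chasles rho _ (theta + l) (dleft s + l + l) rho01) in Ch.
    assert (Hjn : b * (24 * INR j / 2 ^ j) <= b * (24 * INR n / 2 ^ j)).
    { apply Rmult_le_compat_l; [unfold b; lra|]. apply Rmult_le_compat_r.
      - apply Rlt_le, Rinv_0_lt_compat, pow_lt; lra.
      - pose proof (le_INR j n ltac:(lia)). lra. }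
    replace (72 * b * INR n / 2 ^ j) with (3 * (b * (24 * INR n / 2 ^ j)))
      by (field; apply pow_nonzero; lra).
    lra. }
  pose proof (poisson_shells rho r theta (72 * b) N n ltac:(lra) ltac:(lra) ltac:(lra)
    ltac:(unfold b; lra) ltac:(lia) Hn Hm) as PS.
  assert (HL : INR n / 4 <= Rabs (ln (1 - r))).
  { assert (P2n : 0 < 2 ^ n) by (apply pow_lt; lra).
    assert (A : ln (1 - r) <= ln 2 - INR n * ln 2).
    { rewrite <- ln_pow by lra. rewrite <- ln_div by lra. apply ln_le; [lra|]. unfold Rdiv. lra. }
    pose proof ln_lt_2. pose proof (le_INR 5 n ltac:(lia)) as H5. simpl in H5.
    rewrite <- Rabs_Ropp. eapply Rle_trans; [|apply Rle_abs].
    assert (1/2 * (INR n - 1) <= ln 2 * (INR n - 1)) by (apply Rmult_le_compat_r; lra). lra. }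
  assert (HS : 2 * (1 - r) * 4 ^ N * (2 * PI * v 0%C) <= eps / 4).
  { apply Rle_trans with (h0 * K).
    - replace (2 * (1 - r) * 4 ^ N * (2 * PI * v 0%C)) with ((1 - r) * (K - 1)) by (unfold K; ring). nra.
    - apply Rle_trans with (eps / (4 * K) * K); [apply Rmult_le_compat_r; lra|].
      right. field. lra. }
  assert (H5 : 5 <= INR n) by (pose proof (le_INR 5 n ltac:(lia)) as Q; simpl in Q; lra).
  assert (E1 : eps * (INR n / 4) <= v (polar r theta)).
  { eapply Rle_trans; [|exact Hvr]. apply Rmult_le_compat_l; lra. }
  assert (E2 : 6 * (eps * (INR n / 4)) <= 2 * PI * v (polar r theta)).
  { assert (0 <= eps * (INR n / 4)) by nra. nra. }
  unfold b in PS. replace (20 * (72 * (eps / 1440)) * INR n) with (eps * INR n) in PS by field. nra.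
Qed.

Lemma limsup_cover (eps : R) (A : R -> Prop) (delta : R) : 0 < eps -> 0 < delta ->
  (forall theta, A theta -> in_period theta /\
     forall r0, 0 <= r0 < 1 -> exists r, r0 < r < 1 /\ eps * Rabs (ln (1 - r)) <= v (polar r theta)) ->
  exists J, arc_cover A delta J /\
    forall n, sum_f_R0 (fun s => lam_log (snd (J s))) n <= 8 * PI * v 0%C / (eps / 1440).
Proof.
  intros He Hd HA. pose proof PI_4 as HP4. pose proof PI_RGT_0 as HP0.
  assert (EN : exists N, (5 <= N)%nat /\ 24 / 2 ^ N < delta).
  { destruct (pow_lt_1_zero (/2) ltac:(rewrite Rabs_pos_eq; lra) (delta / 24) ltac:(lra)) as [N HN].
    exists (N + 5)%nat. split; [lia|]. specialize (HN (N + 5)%nat ltac:(lia)).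
    rewrite pow_inv, Rabs_pos_eq in HN by (apply Rlt_le, Rinv_0_lt_compat, pow_lt; lra).
    unfold Rdiv. lra. }
  destruct EN as (N & HN & HNd).
  set (b := eps / 1440). assert (Hb : 0 < b) by (unfold b; lra).
  set (rho := fun m => 1 - / (INR m + 2)).
  assert (Hrho : forall m, 0 < rho m < 1).
  { intros m. unfold rho. pose proof (pos_INR m).
    assert (0 < / (INR m + 2)) by (apply Rinv_0_lt_compat; lra).
    assert (/ (INR m + 2) <= / 2) by (apply Rinv_le_contravar; lra). lra. }
  destruct (diagonal_predicate (fun m s => heavy b (rho m) (N + 2) s)) as [bad Hbad].
  assert (Bg : forall s, bad s -> (N + 2 <= Nat.log2 s)%nat).
  { intros s Hs. destruct (Hbad (S s) O) as (m & _ & Hm). now apply (Hm s (Nat.lt_succ_diag_r s)). }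
  assert (B0 : ~ bad O).
  { intros H. specialize (Bg _ H). rewrite (Nat.log2_nonpos 0) in Bg by lia. lia. }
  (* Unselected indices receive a degenerate arc, whose cost is 0 because of the factor t in
     [lam_log]. *)
  set (J := fun s => if excluded_middle_informative (live bad s /\ bad s)
     then (dleft s - dlen s, 3 * dlen s) else (0, 0)).
  assert (Jc : forall s, lam_log (snd (J s)) = when (live bad s /\ bad s) (lam_log (3 * dlen s))).
  { intros s. unfold J, when. destruct excluded_middle_informative; simpl; auto.
    unfold lam_log. ring. }
  exists J. split; [split|].
  - intros s. unfold J. destruct excluded_middle_informative as [[_ H]|]; simpl; [|lra].
    pose proof (dlen_pos s). split; [lra|]. apply Bg in H.
    apply Rle_lt_trans with (24 / 2 ^ N); [|exact HNd].
    unfold dlen. assert (P2 : 0 < 2 ^ N) by (apply pow_lt; lra).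
    assert (2 ^ (N + 2) <= 2 ^ Nat.log2 s) by (apply Rle_pow; [lra | exact H]).
    rewrite pow_add in H1. simpl in H1.
    apply Rle_trans with (3 * (8 * PI / (4 * 2 ^ N))).
    + apply Rmult_le_compat_l; [lra|]. apply Rmult_le_compat_l; [lra|]. apply Rinv_le_contravar; lra.
    + replace (3 * (8 * PI / (4 * 2 ^ N))) with (6 * PI / 2 ^ N) by (field; lra).
      apply Rmult_le_compat_r; [left; now apply Rinv_0_lt_compat | lra].
  - intros theta Hth. destruct (HA theta Hth) as [Hp Hl].
    destruct (exists_heavy eps theta N He HN Hp Hl) as (Bd & rho0 & Hr0 & K).
    destruct (archimed_cor1 (1 - rho0)) as (m0 & Hm0 & Hm0p); [lra|].
    destruct (Hbad Bd m0) as (m & Hm & Ag).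
    destruct (K (rho m)) as (s & Hs & Hh & Ht).
    { split; [|apply Hrho]. unfold rho.
      assert (/ (INR m + 2) < / INR m0).
      { apply Rinv_lt_contravar.
        - apply Rmult_lt_0_compat; [now apply lt_0_INR | pose proof (pos_INR m); lra].
        - apply le_INR in Hm. lra. }
      lra. }
    apply Ag in Hh; [|exact Hs].
    destruct (maximal_bad_ancestor bad theta B0 s Hh Ht) as (p & Hp1 & Hp2).
    exists p. unfold J. destruct excluded_middle_informative as [_|F]; [|now destruct F].
    split; [exact Hp|]. simpl. exists (theta - (dleft p - dlen p)). split; [lra|].
    exists 0%Z. ring.
  - intros n. rewrite sum_f_R0_rsum.
    assert (E : rsum (fun s => lam_log (snd (J s))) (S n) =
       rsum (fun s => when (live bad s /\ bad s) (lam_log (3 * dlen s))) (S n)).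
    { generalize (S n). induction n0 as [|k IH]; simpl; [reflexivity|]. now rewrite IH, Jc. }
    (* A partial sum involves only the nodes up to n, on which [bad] is heaviness for one and the
       same radius [rho m]. *)
    rewrite E. destruct (Hbad (S n) O) as (m & _ & Ag).
    assert (Hr := Hrho m).
    assert (Q := maximal_bad_sum bad (fun s => circle_mass (rho m) (dleft s) (dleft s + dlen s) / b)
      (fun s => lam_log (3 * dlen s)) (S n)).
    eapply Rle_trans; [apply Q|].
    + intros s Hs. destruct (dlen_child s 0 Hs ltac:(lia)) as [A1 A2].
      destruct (dlen_child s 1 Hs ltac:(lia)) as [A3 A4]. rewrite Nat.add_0_r in A1, A2.
      rewrite A1, A2, A3, A4. simpl INR. rewrite Rmult_0_l, Rplus_0_r, Rmult_1_l.
      replace (dleft s + dlen s / 2 + dlen s / 2) with (dleft s + dlen s) by field.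
      rewrite (mass_chasles (rho m) (dleft s) (dleft s + dlen s / 2) _ Hr). field. lra.
    + intros s Hs. apply Rdiv_le_0_compat; [|exact Hb]. apply mass_pos; auto.
      pose proof (dlen_pos s). lra.
    + exact B0.
    + intros s Hs Hbs. apply Ag in Hbs; [|exact Hs].
      destruct Hbs as [_ Hbs]. apply Rmult_le_reg_l with b; [exact Hb|].
      eapply Rle_trans; [exact Hbs|]. right. field. lra.
    + apply Rmult_le_compat_r; [left; now apply Rinv_0_lt_compat|]. right.
      unfold dleft, dlen. simpl. rewrite Rmult_0_l, Rplus_0_r.
      replace (8 * PI / 1) with (8 * PI) by field.
      (* The root interval has length 8 pi, that is four periods, each of mass 2 pi v(0). *)
      rewrite (mass_chasles _ _ (- (4 * PI) + 2 * PI) _ Hr).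
      rewrite (mass_chasles _ (- (4 * PI) + 2 * PI) (- (4 * PI) + 2 * PI + 2 * PI) _ Hr).
      rewrite (mass_chasles _ (- (4 * PI) + 2 * PI + 2 * PI) (- (4 * PI) + 2 * PI + 2 * PI + 2 * PI) _ Hr).
      replace (- (4 * PI) + 8 * PI) with (- (4 * PI) + 2 * PI + 2 * PI + 2 * PI + 2 * PI) by ring.
      rewrite !mass_period by exact Hr. ring.
Qed.
End Cover.

(** * From coverings to the measure, and the proof of (a) *)

Lemma Sup_seq_le_bound (u : nat -> Rbar) (M : Rbar) :
  (forall n, Rbar_le (u n) M) -> Rbar_le (Sup_seq u) M.
Proof.
  intros H. rewrite <- (is_sup_seq_unique (fun _ => M) M).
  - now apply Sup_seq_le.
  - destruct M as [m| |]; simpl.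
    + intros e. split; [intros _; simpl; destruct e; simpl; lra | exists O; simpl; destruct e; simpl; lra].
    + intros; exists O; exact I.
    + intros; exact I.
Qed.

Lemma cover_sum_bounded (lam : R -> R) (J : nat -> R * R) (M : R) :
  (forall n, sum_f_R0 (fun s => lam (snd (J s))) n <= M) ->
  exists x, cover_sum lam J = Finite x /\ x <= M.
Proof.
  intros H. unfold cover_sum. set (u := fun n => Finite (sum_f_R0 (fun s => lam (snd (J s))) n)).
  assert (U : Rbar_le (Sup_seq u) M) by (apply Sup_seq_le_bound; intros n; apply H).
  assert (L : Rbar_le (u O) (Sup_seq u)) by (apply (is_sup_seq_major u), Sup_seq_correct).
  destruct (Sup_seq u) as [x| |]; [exists x; auto | destruct U | destruct L].
Qed.

Lemma H_lambda_le (lam : R -> R) (A : R -> Prop) (M : R) :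
  (forall delta, 0 < delta -> exists J, arc_cover A delta J /\
    forall n, sum_f_R0 (fun s => lam (snd (J s))) n <= M) ->
  Rbar_le (H_lambda lam A) M.
Proof.
  intros H. apply Sup_seq_le_bound. intros n.
  destruct (H (/ (INR n + 1))) as (J & HJ & HS).
  { apply Rinv_0_lt_compat. pose proof (pos_INR n). lra. }
  destruct (cover_sum_bounded lam J M HS) as (x & Ex & Hx).
  apply Rbar_le_trans with x; [|exact Hx].
  apply (proj1 (Glb_Rbar_correct _)). exists J. now split.
Qed.

Lemma neg_ln_large (K : R) : exists r1, 0 <= r1 < 1 /\ forall r, r1 < r < 1 -> K <= Rabs (ln (1 - r)).
Proof.
  exists (Rmax 0 (1 - exp (- K))). split.
  - split; [apply Rmax_l|]. apply Rmax_lub_lt; [lra|]. pose proof (exp_pos (- K)). lra.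
  - intros r [H1 H2]. assert (1 - exp (- K) < r) by (eapply Rle_lt_trans; [apply Rmax_r | exact H1]).
    assert (ln (1 - r) <= - K).
    { rewrite <- (ln_exp (- K)). apply ln_le; lra. }
    rewrite <- Rabs_Ropp. eapply Rle_trans; [|apply Rle_abs]. lra.
Qed.

Theorem Gplus_sigma_finite (f : C -> C) : holomorphic_on_D f ->
  (exists c : R, 0 < c /\ forall z : C, inD z -> c <= Cmod (f z)) ->
  exists A : nat -> (R -> Prop),
    (forall theta, Gplus f theta <-> exists n, A n theta) /\
    (forall n, Rbar_lt (H_lambda lam_log (A n)) p_infty).
Proof.
  intros Hf (c & Hc & Hb).
  assert (Hd : forall z, inD z -> exists l, cdiff f z l).
  { intros z Hz. destruct (Hf z Hz) as [l Hl]. exists l. now apply is_derive_cdiff. }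
  set (v := fun z => ln (Cmod (f z)) - ln c).
  assert (Hv : re_holo v) by now apply re_holo_ln.
  assert (vp : forall z, inD z -> 0 <= v z).
  { intros z Hz. unfold v. pose proof (ln_le c (Cmod (f z)) Hc (Hb z Hz)). lra. }
  set (e := fun n => / (INR n + 1)).
  assert (ep : forall n, 0 < e n) by (intros n; apply Rinv_0_lt_compat; pose proof (pos_INR n); lra).
  exists (fun n theta => in_period theta /\ forall r0 : R, 0 <= r0 < 1 ->
    exists r : R, r0 < r < 1 /\ 0 < Cmod (f (polar r theta)) /\ e n <= ratio f theta r).
  split.
  - intros theta. split.
    + intros [Hp (eps & He & H)].
      destruct (archimed_cor1 eps He) as (N & HN & HN0). exists N. split; [exact Hp|].
      intros r0 Hr0. destruct (H r0 Hr0) as (r & H1 & H2 & H3). exists r. repeat split; try tauto.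
      apply Rle_trans with eps; [|exact H3]. left. eapply Rlt_trans; [|exact HN].
      apply Rinv_lt_contravar; [|lra]. apply lt_0_INR in HN0. nra.
    + intros [n [Hp H]]. split; [exact Hp|]. exists (e n). now split.
  - intros n. apply Rbar_le_lt_trans with (Finite (8 * PI * v 0%C / (e n / 2 / 1440))); [|exact I].
    apply H_lambda_le. intros delta Hdl.
    apply (limsup_cover v Hv vp (e n / 2) _ delta); auto.
    { specialize (ep n). lra. }
    intros theta [Hp H]. split; [exact Hp|]. intros r0 Hr0.
    (* Close enough to the circle, subtracting [ln c] costs at most half of
       [e n * Rabs (ln (1 - r))]; the 1 keeps the denominator of the ratio positive. *)
    destruct (neg_ln_large (Rmax 1 (2 * ln c / e n))) as (r1 & Hr1 & K).
    destruct (H (Rmax r0 r1)) as (r & H1 & H2 & H3).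
    { split; [eapply Rle_trans; [apply Hr0 | apply Rmax_l] | apply Rmax_lub_lt; lra]. }
    pose proof (Rmax_l r0 r1). pose proof (Rmax_r r0 r1).
    exists r. split; [lra|]. specialize (K r ltac:(lra)).
    pose proof (Rmax_l 1 (2 * ln c / e n)). pose proof (Rmax_r 1 (2 * ln c / e n)).
    unfold ratio in H3. set (L := Rabs (ln (1 - r))) in *. specialize (ep n).
    assert (A1 : e n * L <= ln (Cmod (f (polar r theta)))).
    { replace (ln (Cmod (f (polar r theta)))) with (ln (Cmod (f (polar r theta))) / L * L) by (field; lra).
      apply Rmult_le_compat_r; lra. }
    assert (A2 : ln c <= e n / 2 * L).
    { replace (ln c) with (e n / 2 * (2 * ln c / e n)) by (field; lra).
      apply Rmult_le_compat_l; lra. }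
    unfold v. lra.
Qed.

(** * Independent binary digits *)

Definition step (n : nat) : R := 2 * PI / 2 ^ n.

Lemma step_pos n : 0 < step n.
Proof. pose proof PI_RGT_0. apply Rdiv_lt_0_compat; [lra | apply pow_lt; lra]. Qed.

Lemma step_S n : step (S n) = step n / 2.
Proof. unfold step. simpl. field. apply pow_nonzero; lra. Qed.

Lemma step_le n : step n <= 8 * / 2 ^ n.
Proof.
  pose proof PI_4. unfold step, Rdiv. apply Rmult_le_compat_r; [|lra].
  apply Rlt_le, Rinv_0_lt_compat, pow_lt; lra.
Qed.

Lemma step_lim L e : 0 < e -> exists N, forall n, (N <= n)%nat -> L * step n < e.
Proof.
  intros He. pose proof (Rabs_pos L) as HL.
  destruct (pow_lt_1_zero (/2) ltac:(rewrite Rabs_pos_eq; lra) (e / (8 * (Rabs L + 1)))) as [N HN].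
  { apply Rdiv_lt_0_compat; lra. }
  exists N. intros n Hn. specialize (HN n Hn). rewrite pow_inv, Rabs_pos_eq in HN
    by (apply Rlt_le, Rinv_0_lt_compat, pow_lt; lra).
  pose proof (step_le n). pose proof (step_pos n). pose proof (Rle_abs L).
  assert (E : e / (8 * (Rabs L + 1)) * (8 * (Rabs L + 1)) = e) by (field; lra). nra.
Qed.

(** Expectation of [g] at the dyadic point reached from [x] by drawing [m] independent binary
    digits at the positions [n, n + 1, ...], the digit at position [l] being 1 with
    probability [q l]. *)
Fixpoint tsum (q : nat -> R) (g : R -> R) (m n : nat) (x : R) : R :=
  match m with
  | O => g x
  | S m => (1 - q n) * tsum q g m (S n) x + q n * tsum q g m (S n) (x + step (S n))
  end.

Definition lipschitz (g : R -> R) : Prop := exists L, forall y y', Rabs (g y - g y') <= L * Rabs (y - y').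

Lemma tsum_shift q g c m : forall n x, tsum q g m n (x + c) = tsum q (fun y => g (y + c)) m n x.
Proof.
  induction m as [|m IH]; intros n x; simpl; [reflexivity|].
  rewrite IH. replace (x + c + step (S n)) with (x + step (S n) + c) by ring. now rewrite IH.
Qed.

Lemma tsum_ext q g h m : (forall y, g y = h y) -> forall n x, tsum q g m n x = tsum q h m n x.
Proof.
  intros H. induction m as [|m IH]; intros n x; simpl; [apply H|]. now rewrite !IH.
Qed.

Lemma tsum_add q g m k : forall n x,
  tsum q g (m + k) n x = tsum q (fun y => tsum q g k (n + m) y) m n x.
Proof.
  induction m as [|m IH]; intros n x; simpl.
  - now rewrite Nat.add_0_r.
  - rewrite !IH. rewrite !(tsum_ext q (fun y => tsum q g k (S n + m) y)
      (fun y => tsum q g k (n + S m) y)) by (intros; f_equal; lia). reflexivity.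
Qed.

Lemma tsum_average q g h a b m : forall n x,
  a * tsum q g m n x + b * tsum q h m n x = tsum q (fun y => a * g y + b * h y) m n x.
Proof.
  induction m as [|m IH]; intros n x; simpl; [reflexivity|]. rewrite <- !IH. ring.
Qed.

(** Doubling the point turns digits starting at position n + 1 into digits starting at n; this
    drives the induction of [uniform_poisson_bound]. *)
Lemma tsum_half_dilation g m : forall n x,
  tsum (fun _ => /2) (fun y => g (2 * y)) m (S n) x = tsum (fun _ => /2) g m n (2 * x).
Proof.
  induction m as [|m IH]; intros n x; simpl; [reflexivity|].
  rewrite !IH. replace (2 * (x + step (S (S n)))) with (2 * x + step (S n)); [reflexivity|].
  rewrite (step_S (S n)). field.
Qed.

Section Tree.
Variable q : nat -> R.
Hypothesis Hq : forall l, 0 <= q l <= 1.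

Lemma tsum_le g h m : forall n x, (forall y, x <= y <= x + step n -> g y <= h y) ->
  tsum q g m n x <= tsum q h m n x.
Proof.
  induction m as [|m IH]; intros n x H; simpl.
  - apply H. pose proof (step_pos n). lra.
  - specialize (Hq n). pose proof (step_pos n). pose proof (step_S n).
    apply Rplus_le_compat; apply Rmult_le_compat_l; try lra; apply IH; intros y Hy; apply H; lra.
Qed.

Lemma tsum_const c m : forall n x, tsum q (fun _ => c) m n x = c.
Proof. induction m as [|m IH]; intros n x; simpl; [reflexivity|]. rewrite !IH. ring. Qed.

(** The shape of one component of F(w) - F(z) - F'(z) h, where multiplication by h mixes the two
    components of the derivative. With a = b = 0 it compares two averages. *)
Lemma tsum_combination_bound g1 g2 g3 g4 a b e :
  (forall y, Rabs (g1 y - g2 y - (a * g3 y + b * g4 y)) <= e) -> forall m n x,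
  Rabs (tsum q g1 m n x - tsum q g2 m n x - (a * tsum q g3 m n x + b * tsum q g4 m n x)) <= e.
Proof.
  intros H. induction m as [|m IH]; intros n x; simpl; [apply H|].
  pose proof (IH (S n) x) as A. pose proof (IH (S n) (x + step (S n))) as B.
  apply Rabs_le_between in A, B. apply Rabs_le. specialize (Hq n).
  set (T1 := tsum q g1 m (S n) x) in *. set (T2 := tsum q g2 m (S n) x) in *.
  set (T3 := tsum q g3 m (S n) x) in *. set (T4 := tsum q g4 m (S n) x) in *.
  set (S1 := tsum q g1 m (S n) (x + step (S n))) in *. set (S2 := tsum q g2 m (S n) (x + step (S n))) in *.
  set (S3 := tsum q g3 m (S n) (x + step (S n))) in *. set (S4 := tsum q g4 m (S n) (x + step (S n))) in *.
  replace ((1 - q n) * T1 + q n * S1 - ((1 - q n) * T2 + q n * S2) -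
    (a * ((1 - q n) * T3 + q n * S3) + b * ((1 - q n) * T4 + q n * S4))) with
   ((1 - q n) * (T1 - T2 - (a * T3 + b * T4)) + q n * (S1 - S2 - (a * S3 + b * S4))) by ring.
  split; nra.
Qed.

(** [A] bounds the densities of the dyadic cells: cells of generation [n] have mass
    at most [A n / 2 ^ n]. *)
Lemma tsum_le_uniform (A : nat -> R) g : (forall l, 0 < A l) ->
  (forall l, 2 * q l * A l <= A (S l)) -> (forall l, 2 * (1 - q l) * A l <= A (S l)) ->
  (forall y, 0 <= g y) -> forall m n x,
  A n * tsum q g m n x <= A (n + m)%nat * tsum (fun _ => /2) g m n x.
Proof.
  intros HA H1 H2 Hg. 
  assert (P : forall m n x, 0 <= tsum q g m n x).
  { intros m n x. rewrite <- (tsum_const 0 m n x). apply tsum_le. auto. }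
  induction m as [|m IH]; intros n x; simpl.
  - rewrite Nat.add_0_r. lra.
  - pose proof (IH (S n) x) as I1. pose proof (IH (S n) (x + step (S n))) as I2.
    replace (S n + m)%nat with (n + S m)%nat in I1, I2 by lia.
    pose proof (P m (S n) x). pose proof (P m (S n) (x + step (S n))).
    specialize (H1 n). specialize (H2 n).
    assert (2 * (1 - q n) * A n * tsum q g m (S n) x <= A (S n) * tsum q g m (S n) x)
      by (apply Rmult_le_compat_r; auto).
    assert (2 * q n * A n * tsum q g m (S n) (x + step (S n)) <= A (S n) * tsum q g m (S n) (x + step (S n)))
      by (apply Rmult_le_compat_r; auto).
    lra.
Qed.

Lemma tsum_lipschitz_tail g L : 0 <= L -> (forall y y', Rabs (g y - g y') <= L * Rabs (y - y')) ->
  forall k n x, Rabs (tsum q g k n x - g x) <= L * step n.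
Proof.
  intros HL Hg k n x. apply Rabs_le. pose proof (step_pos n).
  assert (K : forall y, x <= y <= x + step n -> g x - L * step n <= g y <= g x + L * step n).
  { intros y Hy. specialize (Hg y x). apply Rabs_le_between in Hg.
    assert (Rabs (y - x) <= step n) by (apply Rabs_le; lra).
    assert (L * Rabs (y - x) <= L * step n) by (apply Rmult_le_compat_l; auto). lra. }
  assert (A : tsum q (fun _ => g x - L * step n) k n x <= tsum q g k n x) by (apply tsum_le; apply K).
  assert (B : tsum q g k n x <= tsum q (fun _ => g x + L * step n) k n x) by (apply tsum_le; apply K).
  rewrite tsum_const in A, B. lra.
Qed.

(** The integral of g against the law of the point when the digits before position n are already
    fixed and have led to x. By [is_tlim] the limit exists for Lipschitz g. *)
Definition tlim (g : R -> R) (n : nat) (x : R) : R := real (Lim_seq (fun m => tsum q g m n x)).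

Lemma is_tlim g n x : lipschitz g -> is_lim_seq (fun m => tsum q g m n x) (tlim g n x).
Proof.
  intros [L0 HL0]. set (L := Rmax L0 0).
  assert (HL : 0 <= L) by apply Rmax_r.
  assert (Hg : forall y y', Rabs (g y - g y') <= L * Rabs (y - y')).
  { intros y y'. eapply Rle_trans; [apply HL0|]. apply Rmult_le_compat_r; [apply Rabs_pos | apply Rmax_l]. }
  apply Lim_seq_correct'. apply ex_lim_seq_cauchy_corr. intros [e He].
  destruct (step_lim L (e / 2) ltac:(lra)) as [N HN].
  assert (K : forall p, (N <= p)%nat -> Rabs (tsum q g p n x - tsum q g N n x) < e / 2).
  { intros p Hp. replace p with (N + (p - N))%nat by lia. rewrite tsum_add.
    apply Rle_lt_trans with (L * step (n + N)); [|apply HN; lia].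
    pose proof (tsum_combination_bound (fun y => tsum q g (p - N) (n + N) y) g (fun _ => 0) (fun _ => 0)
      0 0 (L * step (n + N))) as C.
    assert (C' := C ltac:(intros y; rewrite !Rmult_0_l, Rplus_0_r, Rminus_0_r; now apply tsum_lipschitz_tail) N n x).
    rewrite !Rmult_0_l, Rplus_0_r, Rminus_0_r in C'. exact C'. }
  exists N. intros p r Hp Hr. simpl.
  replace (tsum q g p n x - tsum q g r n x) with
    ((tsum q g p n x - tsum q g N n x) - (tsum q g r n x - tsum q g N n x)) by ring.
  pose proof (K p Hp) as A. pose proof (K r Hr) as B.
  eapply Rle_lt_trans; [apply Rabs_triang|]. rewrite Rabs_Ropp. lra.
Qed.

Lemma tlim_step g n x : lipschitz g ->
  tlim g n x = (1 - q n) * tlim g (S n) x + q n * tlim g (S n) (x + step (S n)).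
Proof.
  intros Hg. pose proof (is_tlim g n x Hg) as H0. apply is_lim_seq_incr_1 in H0.
  pose proof (is_tlim g (S n) x Hg) as H1. pose proof (is_tlim g (S n) (x + step (S n)) Hg) as H2.
  apply (is_lim_seq_scal_l _ (1 - q n)) in H1. apply (is_lim_seq_scal_l _ (q n)) in H2.
  pose proof (is_lim_seq_plus' _ _ _ _ H1 H2) as H3. simpl in H0.
  apply is_lim_seq_unique in H0, H3. rewrite H0 in H3. now injection H3.
Qed.

Lemma tlim_ge_bound g c n x : lipschitz g -> (forall y, x <= y <= x + step n -> c <= g y) -> c <= tlim g n x.
Proof.
  intros Hg H. apply (is_lim_seq_le (fun _ => c) (fun m => tsum q g m n x) c (tlim g n x)).
  - intros m. rewrite <- (tsum_const c m n x). now apply tsum_le.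
  - apply is_lim_seq_const.
  - now apply is_tlim.
Qed.

(** Digits from position n + m on move the point by at most [step (n + m)], over which g changes by
    at most the factor C; so truncating the expansion there costs C. *)
Lemma tlim_le_tsum g C m n x : lipschitz g ->
  (forall y y', Rabs (y - y') <= step (n + m) -> g y <= C * g y') ->
  tlim g n x <= C * tsum q g m n x.
Proof.
  intros Hg H.
  apply (is_lim_seq_le (fun k => tsum q g (k + m) n x) (fun _ => C * tsum q g m n x) (tlim g n x)
    (C * tsum q g m n x)).
  - intros k. rewrite Nat.add_comm, tsum_add.
    rewrite <- (Rplus_0_r (C * _)), <- (Rmult_0_l (tsum q (fun _ => 0) m n x)), tsum_average.
    apply tsum_le. intros y _. rewrite Rmult_0_l, Rplus_0_r.
    rewrite <- (tsum_const (C * g y) k (n + m) y). apply tsum_le. intros y' Hy. apply H.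
    apply Rabs_le. lra.
  - apply (is_lim_seq_incr_n (fun k => tsum q g k n x) m). now apply is_tlim.
  - apply is_lim_seq_const.
Qed.

Lemma tlim_combination_bound g1 g2 g3 g4 a b e n x :
  lipschitz g1 -> lipschitz g2 -> lipschitz g3 -> lipschitz g4 ->
  (forall y, Rabs (g1 y - g2 y - (a * g3 y + b * g4 y)) <= e) ->
  Rabs (tlim g1 n x - tlim g2 n x - (a * tlim g3 n x + b * tlim g4 n x)) <= e.
Proof.
  intros L1 L2 L3 L4 H.
  apply (is_lim_seq_le (fun m => Rabs (tsum q g1 m n x - tsum q g2 m n x
     - (a * tsum q g3 m n x + b * tsum q g4 m n x))) (fun _ => e)
    (Rabs (tlim g1 n x - tlim g2 n x - (a * tlim g3 n x + b * tlim g4 n x))) e).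
  - intros m. now apply tsum_combination_bound.
  - apply (is_lim_seq_abs _ (tlim g1 n x - tlim g2 n x - (a * tlim g3 n x + b * tlim g4 n x))).
    apply is_lim_seq_minus'; [apply is_lim_seq_minus'; now apply is_tlim|].
    apply is_lim_seq_plus'.
    + apply (is_lim_seq_scal_l _ a (tlim g3 n x)). now apply is_tlim.
    + apply (is_lim_seq_scal_l _ b (tlim g4 n x)). now apply is_tlim.
  - apply is_lim_seq_const.
Qed.

(** The probability of the cell of generation n that contains the branch d; [dpoint d n] is its left
    endpoint. *)
Fixpoint weight (d : nat -> bool) (n : nat) : R :=
  match n with O => 1 | S n => weight d n * (if d n then q n else 1 - q n) end.

Fixpoint dpoint (d : nat -> bool) (n : nat) : R :=
  match n with O => 0 | S n => if d n then dpoint d n + step (S n) else dpoint d n end.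

Lemma weight_pos d n : 0 <= weight d n.
Proof.
  induction n as [|n IH]; simpl; [lra|]. apply Rmult_le_pos; [exact IH|]. specialize (Hq n). destruct (d n); lra.
Qed.

Lemma weight_tlim g d n : lipschitz g -> (forall y, 0 <= g y) ->
  weight d n * tlim g n (dpoint d n) <= tlim g 0 0.
Proof.
  intros Hg Hp. induction n as [|n IH]; simpl; [lra|].
  eapply Rle_trans; [|exact IH]. rewrite Rmult_assoc. apply Rmult_le_compat_l; [apply weight_pos|].
  rewrite (tlim_step g n) by exact Hg. pose proof (Hq n).
  pose proof (tlim_ge_bound g 0 (S n) (dpoint d n) Hg ltac:(auto)).
  pose proof (tlim_ge_bound g 0 (S n) (dpoint d n + step (S n)) Hg ltac:(auto)).
  destruct (d n); nra.
Qed.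
End Tree.

Lemma dpoint_limit (d : nat -> bool) : exists theta,
  forall n, dpoint d n <= theta <= dpoint d n + step n.
Proof.
  assert (M : forall n m, dpoint d n <= dpoint d (m + n) <= dpoint d n + step n - step (m + n)).
  { intros n m. induction m as [|m IH]; simpl; [lra|].
    pose proof (step_S (m + n)). pose proof (step_pos (m + n)). destruct (d (m + n)%nat); lra. }
  destruct (ex_finite_lim_seq_incr (dpoint d) (step 0)) as [t Ht].
  - intros n. apply (M n 1%nat).
  - intros n. pose proof (M O n) as A. rewrite Nat.add_0_r in A. simpl in A. pose proof (step_pos n). lra.
  - exists t. intros n. pose proof (proj1 (is_lim_seq_incr_n _ n t) Ht) as L. split.
    + apply (is_lim_seq_le (fun _ => dpoint d n) (fun m => dpoint d (m + n)) (dpoint d n) t); auto.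
      * intros m; apply M. * apply is_lim_seq_const.
    + apply (is_lim_seq_le (fun m => dpoint d (m + n)) (fun _ => dpoint d n + step n) t (dpoint d n + step n)); auto.
      * intros m. pose proof (M n m). pose proof (step_pos (m + n)). lra.
      * apply is_lim_seq_const.
Qed.

(** * The function of part (b) *)

Definition herglotz (z : C) (y : R) : C := ((polar 1 y + z) / (polar 1 y - z))%C.
(** The derivative of [herglotz z y] with respect to z. *)
Definition herglotz' (z : C) (y : R) : C := (2 * polar 1 y * (/ (polar 1 y - z) * / (polar 1 y - z)))%C.
Definition pk (z : C) (y : R) : R := fst (herglotz z y).

Lemma unit_sub_neq_0 z y : inD z -> (polar 1 y - z)%C <> 0%C.
Proof. intros Hz. apply polar_sub_neq_0; [lra | exact Hz]. Qed.

Lemma unit_sub_ge z y : inD z -> 1 - Cmod z <= Cmod (polar 1 y - z).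
Proof. intros Hz. apply Cmod_polar_sub_ge; unfold inD in Hz; lra. Qed.

Lemma chord_le y y' : Cmod (polar 1 y - polar 1 y') <= 2 * Rabs (y - y').
Proof.
  pose proof (Rabs_pos (y - y')). pose proof (Cmod_ge_0 (polar 1 y - polar 1 y')).
  apply Rsqr_incr_0; try lra. unfold Rsqr.
  pose proof (Cmod_polar_diff_sq 1 1 y y') as E.
  pose proof (cos_minus_1_bound (y - y')) as B. apply Rabs_le_between in B.
  pose proof (pow2_abs (y - y')). nra.
Qed.

Lemma pk_formula z y : inD z -> pk z y = (1 - Cmod z ^ 2) / Cmod (polar 1 y - z) ^ 2.
Proof.
  intros Hz. pose proof (unit_sub_neq_0 z y Hz) as N. apply Cnz_sq in N.
  rewrite !Cmod2_alt. unfold pk, herglotz, Re, Im. destruct z as [a b]. unfold polar in *.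
  simpl in *. pose proof (sin2_cos2 y) as S. unfold Rsqr in S.
  replace (1 - (a * (a * 1) + b * (b * 1))) with
    (sin y * sin y + cos y * cos y - (a * a + b * b)) by (rewrite S; ring).
  field. intros E. apply N. rewrite <- E. ring.
Qed.

Lemma pk_pos z y : inD z -> 0 <= pk z y.
Proof.
  intros Hz. rewrite pk_formula by exact Hz. unfold inD in Hz. pose proof (Cmod_ge_0 z).
  apply Rdiv_le_0_compat; [nra|]. apply pow_lt, Cmod_gt_0. now apply unit_sub_neq_0.
Qed.

Lemma pk_upper z y : inD z -> pk z y <= 2 / (1 - Cmod z).
Proof.
  intros Hz. rewrite pk_formula by exact Hz. pose proof (unit_sub_ge z y Hz) as G.
  unfold inD in Hz. pose proof (Cmod_ge_0 z).
  apply Rle_trans with ((1 - Cmod z ^ 2) / (1 - Cmod z) ^ 2).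
  - apply Rmult_le_compat_l; [nra|]. apply Rinv_le_contravar; [apply pow_lt; lra|].
    apply pow_incr. lra.
  - replace ((1 - Cmod z ^ 2) / (1 - Cmod z) ^ 2) with ((1 + Cmod z) / (1 - Cmod z)) by (field; lra).
    apply Rmult_le_compat_r; [left; apply Rinv_0_lt_compat; lra | lra].
Qed.

Lemma pk_lower z y K : inD z -> 0 < K -> Cmod (polar 1 y - z) <= K * (1 - Cmod z) ->
  / (K ^ 2 * (1 - Cmod z)) <= pk z y.
Proof.
  intros Hz HK H. rewrite pk_formula by exact Hz.
  pose proof (proj1 (Cmod_gt_0 _) (unit_sub_neq_0 z y Hz)) as P.
  unfold inD in Hz. pose proof (Cmod_ge_0 z).
  replace (/ (K ^ 2 * (1 - Cmod z))) with ((1 - Cmod z) * / (K * (1 - Cmod z)) ^ 2) by (field; lra).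
  apply Rmult_le_compat; [lra| |nra|].
  - left. apply Rinv_0_lt_compat, pow_lt. nra.
  - apply Rinv_le_contravar; [now apply pow_lt|]. apply pow_incr. lra.
Qed.

(** Moving y by [step n] changes the distance to z by at most 16 / 2^n, hence by at most 16 times
    that distance; 289 = (1 + 16)^2. *)
Lemma pk_harnack z n y y' : inD z -> / 2 ^ n <= 1 - Cmod z -> Rabs (y - y') <= step n ->
  pk z y <= 289 * pk z y'.
Proof.
  intros Hz Hn Hy. rewrite !pk_formula by exact Hz.
  pose proof (proj1 (Cmod_gt_0 _) (unit_sub_neq_0 z y Hz)) as P.
  pose proof (proj1 (Cmod_gt_0 _) (unit_sub_neq_0 z y' Hz)) as P'.
  assert (B : Cmod (polar 1 y' - z) <= 17 * Cmod (polar 1 y - z)).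
  { replace (polar 1 y' - z)%C with ((polar 1 y' - polar 1 y) + (polar 1 y - z))%C by ring.
    eapply Rle_trans; [apply Cmod_triangle|].
    pose proof (chord_le y' y) as C1. rewrite Rabs_minus_sym in C1.
    pose proof (step_le n). pose proof (unit_sub_ge z y Hz). lra. }
  unfold inD in Hz. pose proof (Cmod_ge_0 z).
  replace (289 * ((1 - Cmod z ^ 2) / Cmod (polar 1 y' - z) ^ 2)) with
    ((1 - Cmod z ^ 2) * / (Cmod (polar 1 y' - z) / 17) ^ 2) by (field; lra).
  apply Rmult_le_compat_l; [nra|]. apply Rinv_le_contravar.
  - apply pow_lt. lra.
  - apply pow_incr. lra.
Qed.

Lemma lipschitz_components (K : R -> C) L :
  (forall y y', Cmod (K y - K y') <= L * Rabs (y - y')) ->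
  lipschitz (fun y => fst (K y)) /\ lipschitz (fun y => snd (K y)).
Proof.
  intros H. split; exists L; intros y y'; (eapply Rle_trans; [|apply H]).
  - apply (Rabs_fst_Cmod (K y - K y')%C).
  - apply (Rabs_snd_Cmod (K y - K y')%C).
Qed.

Lemma Cmod_inv_unit_sub z y : inD z -> Cmod (/ (polar 1 y - z)) <= / (1 - Cmod z).
Proof.
  intros Hz. rewrite Cmod_inv by now apply unit_sub_neq_0.
  apply Rinv_le_contravar; [unfold inD in Hz; lra | now apply unit_sub_ge].
Qed.

Lemma herglotz_lipschitz z : inD z ->
  lipschitz (pk z) /\ lipschitz (fun y => snd (herglotz z y)).
Proof.
  intros Hz. set (k := / (1 - Cmod z)).
  assert (Hk : 0 < k) by (apply Rinv_0_lt_compat; unfold inD in Hz; lra).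
  apply (lipschitz_components (herglotz z) (2 * (k * k) * 2)). intros y y'.
  replace (herglotz z y - herglotz z y')%C with
    (2 * z * (polar 1 y' - polar 1 y) * (/ (polar 1 y - z) * / (polar 1 y' - z)))%C.
  2:{ unfold herglotz. field. split; now apply unit_sub_neq_0. }
  rewrite !Cmod_mult.
  pose proof (Cmod_inv_unit_sub z y Hz) as A. pose proof (Cmod_inv_unit_sub z y' Hz) as B. fold k in A, B.
  pose proof (chord_le y' y) as C1. rewrite Rabs_minus_sym in C1.
  replace (Cmod 2) with 2 by (rewrite Cmod_R, Rabs_pos_eq; lra).
  unfold inD in Hz. pose proof (Cmod_ge_0 z).
  pose proof (Cmod_ge_0 (/ (polar 1 y - z))). pose proof (Cmod_ge_0 (/ (polar 1 y' - z))).
  pose proof (Cmod_ge_0 (polar 1 y' - polar 1 y)). pose proof (Rabs_pos (y - y')).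
  replace (2 * (k * k) * 2 * Rabs (y - y')) with (2 * 1 * (2 * Rabs (y - y')) * (k * k)) by ring.
  repeat apply Rmult_le_compat; try lra; try (apply Rmult_le_pos; lra).
Qed.

Lemma herglotz'_lipschitz z : inD z ->
  lipschitz (fun y => fst (herglotz' z y)) /\ lipschitz (fun y => snd (herglotz' z y)).
Proof.
  intros Hz. set (k := / (1 - Cmod z)).
  assert (Hk : 0 < k) by (apply Rinv_0_lt_compat; unfold inD in Hz; lra).
  apply (lipschitz_components (herglotz' z) (4 * (k * k) + 8 * (k * k * k))). intros y y'.
  set (p := (/ (polar 1 y - z))%C). set (p' := (/ (polar 1 y' - z))%C).
  set (e := (polar 1 y - polar 1 y')%C).
  replace (herglotz' z y - herglotz' z y')%C with
    (2 * (e * (p * p)) + 2 * polar 1 y' * (e * (p * p') * - (p + p')))%C.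
  2:{ unfold herglotz', e, p, p'. field. split; now apply unit_sub_neq_0. }
  eapply Rle_trans; [apply Cmod_triangle|]. rewrite !Cmod_mult, Cmod_opp, Cmod_polar by lra.
  replace (Cmod 2) with 2 by (rewrite Cmod_R, Rabs_pos_eq; lra).
  pose proof (Cmod_inv_unit_sub z y Hz) as A. pose proof (Cmod_inv_unit_sub z y' Hz) as B. fold k p p' in A, B.
  pose proof (chord_le y y') as C1. fold e in C1.
  pose proof (Cmod_triangle p p') as T.
  pose proof (Cmod_ge_0 p). pose proof (Cmod_ge_0 p'). pose proof (Cmod_ge_0 e). pose proof (Cmod_ge_0 (p + p')).
  assert (P1 : Cmod p * Cmod p <= k * k) by (apply Rmult_le_compat; lra).
  assert (P2 : Cmod p * Cmod p' <= k * k) by (apply Rmult_le_compat; lra).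
  assert (Cmod e * (Cmod p * Cmod p) <= 2 * Rabs (y - y') * (k * k))
    by (apply Rmult_le_compat; try lra; apply Rmult_le_pos; lra).
  assert (Cmod e * (Cmod p * Cmod p') <= 2 * Rabs (y - y') * (k * k))
    by (apply Rmult_le_compat; try lra; apply Rmult_le_pos; lra).
  assert (Cmod e * (Cmod p * Cmod p') * Cmod (p + p') <= 2 * Rabs (y - y') * (k * k) * (2 * k)).
  { apply Rmult_le_compat; try lra. apply Rmult_le_pos; [lra|]. apply Rmult_le_pos; lra. }
  lra.
Qed.

(** Averaging the Poisson kernel of [z] over the rotations by multiples of [2 pi / 2 ^ m] gives
    the Poisson kernel of [z ^ (2 ^ m)]. *)
Lemma uniform_poisson_bound m : forall z x, inD z ->
  tsum (fun _ => /2) (pk z) m 0 x <= 2 / (1 - Cmod z ^ (2 ^ m)).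
Proof.
  induction m as [|m IH]; intros z x Hz.
  - simpl. rewrite Rmult_1_r. now apply pk_upper.
  - simpl tsum. rewrite tsum_shift.
    replace (1 - / 2) with (/ 2) by field. rewrite tsum_average.
    assert (Hz2 : inD (z * z)).
    { unfold inD in *. rewrite Cmod_mult. pose proof (Cmod_ge_0 z). nra. }
    rewrite (tsum_ext _ _ (fun y => pk (z * z)%C (2 * y))).
    + rewrite tsum_half_dilation.
      replace (Cmod z ^ 2 ^ S m) with (Cmod (z * z) ^ 2 ^ m); [now apply IH|].
      rewrite Cmod_mult, Nat.pow_succ_r', pow_mult. f_equal. ring.
    + intros y. unfold pk.
      assert (E1 : polar 1 (y + step 1) = (- polar 1 y)%C).
      { unfold polar, step. replace (2 * PI / 2 ^ 1) with PI by field.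
        rewrite neg_cos, neg_sin. unfold Copp; simpl. f_equal; ring. }
      assert (E2 : polar 1 (2 * y) = (polar 1 y * polar 1 y)%C).
      { unfold polar, Cmult; simpl. rewrite cos_2a, sin_2a. f_equal; ring. }
      assert (E : herglotz (z * z) (2 * y) = (RtoC (/2) * herglotz z y + RtoC (/2) * herglotz z (y + step 1))%C).
      { pose proof (unit_sub_neq_0 _ (2 * y) Hz2) as N1. pose proof (unit_sub_neq_0 z y Hz) as N2.
        pose proof (unit_sub_neq_0 z (y + step 1) Hz) as N3.
        unfold herglotz. rewrite E1, E2 in *. rewrite RtoC_inv by lra.
        field. now repeat split. }
      rewrite E. simpl. ring.
Qed.

Lemma uniform_poisson_le_4 z n x : inD z -> / 2 ^ n <= 1 - Cmod z ->
  tsum (fun _ => /2) (pk z) n 0 x <= 4.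
Proof.
  intros Hz Hn. eapply Rle_trans; [now apply uniform_poisson_bound|].
  pose proof (Cmod_ge_0 z) as Z0. set (t := / 2 ^ n) in *.
  assert (P : 0 < 2 ^ n) by (apply pow_lt; lra).
  assert (Ht : 0 < t) by now apply Rinv_0_lt_compat.
  (* Bernoulli's inequality gives (1 + t)^(2^n) >= 2, while |z| (1 + t) <= 1. *)
  assert (K : Cmod z ^ 2 ^ n <= / 2).
  { assert (B : 2 <= (1 + t) ^ 2 ^ n).
    { pose proof (poly (2 ^ n) t Ht) as Q. replace (INR (2 ^ n)) with (2 ^ n) in Q by (rewrite pow_INR; reflexivity).
      assert (2 ^ n * t = 1) by (apply Rinv_r; lra). lra. }
    assert (C : (Cmod z * (1 + t)) ^ 2 ^ n <= 1).
    { apply Rle_trans with (1 ^ (2 ^ n)); [|rewrite pow1; lra]. apply pow_incr.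
      split; [apply Rmult_le_pos; lra | nra]. }
    rewrite Rpow_mult_distr in C. pose proof (pow_le _ (2 ^ n) Z0). nra. }
  apply Rle_div_l; lra.
Qed.

(** Truncation at generation n costs the Harnack factor 289, passing to fair digits costs the
    density [A n], and the fair average is at most 4; 1156 = 289 * 4. *)
Lemma pk_mass_bound (q A : nat -> R) : (forall l, 0 <= q l <= 1) -> (forall l, 0 < A l) -> A O = 1 ->
  (forall l, 2 * q l * A l <= A (S l)) -> (forall l, 2 * (1 - q l) * A l <= A (S l)) ->
  forall z n, inD z -> / 2 ^ n <= 1 - Cmod z -> tlim q (pk z) 0 0 <= 1156 * A n.
Proof.
  intros Hq HA A0 H1 H2 z n Hz Hn.
  pose proof (proj1 (herglotz_lipschitz z Hz)) as L.
  pose proof (tlim_le_tsum q Hq (pk z) 289 n 0 0 L) as T.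
  assert (T' := T ltac:(intros; apply (pk_harnack z n); auto)).
  pose proof (tsum_le_uniform q Hq A (pk z) HA H1 H2 ltac:(intros; now apply pk_pos) n 0 0) as U.
  rewrite A0, Rmult_1_l, Nat.add_0_l in U.
  pose proof (uniform_poisson_le_4 z n 0 Hz Hn) as V.
  assert (A n * tsum (fun _ => /2) (pk z) n 0 0 <= A n * 4) by (apply Rmult_le_compat_l; auto; left; auto).
  lra.
Qed.

Definition herglotz_transform (q : nat -> R) (z : C) : C :=
  (tlim q (pk z) 0 0, tlim q (fun y => snd (herglotz z y)) 0 0).

(** The second-order remainder of the Herglotz kernel is bounded uniformly in y as long as w stays
    within half the distance from z to the circle, and [tlim_combination_bound] carries such a bound
    through the limit. This replaces differentiation under an integral. *)
Lemma cdiff_herglotz_transform (q : nat -> R) (z : C) : (forall l, 0 <= q l <= 1) -> inD z ->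
  exists l, cdiff (herglotz_transform q) z l.
Proof.
  intros Hq Hz. pose proof Hz as Hz'. unfold inD in Hz'. set (del := 1 - Cmod z).
  exists (tlim q (fun y => fst (herglotz' z y)) 0 0, tlim q (fun y => snd (herglotz' z y)) 0 0).
  assert (Hdel : 0 < del) by (unfold del; lra).
  set (k := / del). assert (Hk : 0 < k) by now apply Rinv_0_lt_compat.
  apply (cdiff_bigO _ _ _ (8 * k ^ 3) (del / 2)); [lra|].
  intros w Hw. set (h := (w - z)%C) in *.
  assert (Wn : Cmod w <= Cmod z + del / 2).
  { replace w with (z + h)%C by (unfold h; ring). eapply Rle_trans; [apply Cmod_triangle|]. lra. }
  assert (Hw1 : inD w) by (unfold inD; unfold del in *; lra).
  destruct (herglotz_lipschitz z Hz) as [L1 L2]. destruct (herglotz_lipschitz w Hw1) as [L3 L4].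
  destruct (herglotz'_lipschitz z Hz) as [L5 L6].
  assert (Tay : forall y, Cmod (herglotz w y - herglotz z y - herglotz' z y * h) <= 4 * k ^ 3 * Cmod h ^ 2).
  { intros y.
    replace (herglotz w y - herglotz z y - herglotz' z y * h)%C with
     (2 * polar 1 y * (h * h) * (/ (polar 1 y - z) * / (polar 1 y - z) * / (polar 1 y - w)))%C.
    2:{ unfold herglotz, herglotz', h. field. split; now apply unit_sub_neq_0. }
    rewrite !Cmod_mult, Cmod_polar by lra.
    replace (Cmod 2) with 2 by (rewrite Cmod_R, Rabs_pos_eq; lra).
    pose proof (Cmod_inv_unit_sub z y Hz) as A. pose proof (Cmod_inv_unit_sub w y Hw1) as B.
    fold del in A. fold k in A.
    assert (B' : / (1 - Cmod w) <= 2 * k).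
    { unfold k. replace (2 * / del) with (/ (del / 2)) by (field; lra). apply Rinv_le_contravar; unfold del in *; lra. }
    pose proof (Cmod_ge_0 (/ (polar 1 y - z))). pose proof (Cmod_ge_0 (/ (polar 1 y - w))). pose proof (Cmod_ge_0 h).
    set (p := Cmod (/ (polar 1 y - z))) in *. set (p' := Cmod (/ (polar 1 y - w))) in *.
    assert (p * p <= k * k) by (apply Rmult_le_compat; lra).
    assert (p * p * p' <= k * k * (2 * k)) by (apply Rmult_le_compat; try lra; nra).
    assert (0 <= Cmod h * Cmod h) by nra.
    assert (Cmod h * Cmod h * (p * p * p') <= Cmod h * Cmod h * (k * k * (2 * k)))
      by (apply Rmult_le_compat_l; lra).
    lra. }
  assert (R1 := tlim_combination_bound q Hq (pk w) (pk z) (fun y => fst (herglotz' z y))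
    (fun y => snd (herglotz' z y)) (fst h) (- snd h) (4 * k ^ 3 * Cmod h ^ 2) 0 0 L3 L1 L5 L6).
  assert (R2 := tlim_combination_bound q Hq (fun y => snd (herglotz w y)) (fun y => snd (herglotz z y))
    (fun y => fst (herglotz' z y))
    (fun y => snd (herglotz' z y)) (snd h) (fst h) (4 * k ^ 3 * Cmod h ^ 2) 0 0 L4 L2 L5 L6).
  eapply Rle_trans; [apply Cmod_le_Rabs|].
  replace (8 * k ^ 3 * Cmod h ^ 2) with (4 * k ^ 3 * Cmod h ^ 2 + 4 * k ^ 3 * Cmod h ^ 2) by ring.
  apply Rplus_le_compat; unfold herglotz_transform; simpl fst; simpl snd.
  - eapply Rle_trans; [|apply R1].
    + right. f_equal. simpl. ring.
    + intros y. eapply Rle_trans; [|apply (Tay y)]. eapply Rle_trans; [|apply Rabs_fst_Cmod].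
      right. unfold pk. f_equal. simpl. ring.
  - eapply Rle_trans; [|apply R2].
    + right. f_equal. simpl. ring.
    + intros y. eapply Rle_trans; [|apply (Tay y)]. eapply Rle_trans; [|apply Rabs_snd_Cmod].
      right. f_equal. simpl. ring.
Qed.

(** Position [l] is special when [l + 1] is a power of two (greater than 1). *)
Definition special (l : nat) : bool := Nat.ltb (Nat.log2 l) (Nat.log2 (S l)).

Lemma log2_S_cases l : if special l then Nat.log2 (S l) = S (Nat.log2 l) else Nat.log2 (S l) = Nat.log2 l.
Proof.
  unfold special. pose proof (Nat.log2_succ_le l). pose proof (Nat.log2_le_mono l (S l) ltac:(lia)).
  destruct (Nat.ltb_spec (Nat.log2 l) (Nat.log2 (S l))); lia.
Qed.

(** Positive, so that cells keep positive mass whatever the first special digits are; small at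
    special positions, so that a 0 there almost doubles the density, with a convergent product of
    losses. *)
Definition rare_one_prob (l : nat) : R := if special l then / (4 * 2 ^ Nat.log2 (S l)) else / 2.

Lemma rare_one_prob_bound l : 0 < rare_one_prob l <= / 2.
Proof.
  unfold rare_one_prob. destruct (special l); [|lra].
  assert (1 <= 2 ^ Nat.log2 (S l)) by (apply pow_R1_Rle; lra).
  split; [apply Rinv_0_lt_compat; lra | apply Rinv_le_contravar; lra].
Qed.

Definition cascade_fun (z : C) : C := Cexp (herglotz_transform rare_one_prob z).

Lemma rare_one_prob_01 l : 0 <= rare_one_prob l <= 1.
Proof. pose proof (rare_one_prob_bound l). lra. Qed.

Lemma cascade_fun_holomorphic : holomorphic_on_D cascade_fun.
Proof.
  intros z Hz. destruct (cdiff_herglotz_transform rare_one_prob z rare_one_prob_01 Hz) as [l Hl].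
  eexists. apply is_derive_cdiff. apply (cdiff_comp Cexp (herglotz_transform rare_one_prob)); [|exact Hl].
  apply cdiff_Cexp.
Qed.

Lemma Cmod_cascade_fun z : Cmod (cascade_fun z) = exp (tlim rare_one_prob (pk z) 0 0).
Proof. unfold cascade_fun. now rewrite Cmod_Cexp. Qed.

Lemma cascade_fun_ge_1 z : inD z -> 1 <= Cmod (cascade_fun z).
Proof.
  intros Hz. rewrite Cmod_cascade_fun, <- exp_0.
  assert (0 <= tlim rare_one_prob (pk z) 0 0).
  { apply tlim_ge_bound; [apply rare_one_prob_01 | now apply herglotz_lipschitz|]. intros. now apply pk_pos. }
  destruct H as [H|H]; [left; now apply exp_increasing | right; now rewrite <- H].
Qed.

Lemma pow2_log2_le n : (1 <= n)%nat -> 2 ^ Nat.log2 n <= INR n.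
Proof.
  intros Hn. pose proof (Nat.log2_spec n ltac:(lia)) as [H _].
  apply le_INR in H. rewrite pow_INR in H. exact H.
Qed.

Lemma pow2_log2_ge n : (1 <= n)%nat -> INR n <= 2 * 2 ^ Nat.log2 n.
Proof.
  intros Hn. pose proof (Nat.log2_spec n ltac:(lia)) as [_ H].
  apply lt_INR in H. rewrite pow_INR in H.
  change (INR n < 2 * 2 ^ Nat.log2 n) in H. lra.
Qed.

(** A fair digit leaves the density unchanged and a special one at most doubles it. There are
    [Nat.log2 n] special positions below n, so the density is at most [2 ^ Nat.log2 n], hence at
    most n. *)
Lemma cascade_fun_exponent_bound z n : inD z -> (1 <= n)%nat -> / 2 ^ n <= 1 - Cmod z ->
  tlim rare_one_prob (pk z) 0 0 <= 1156 * INR n.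
Proof.
  intros Hz H1 Hn.
  assert (P : forall l, 0 < 2 ^ Nat.log2 l) by (intros; apply pow_lt; lra).
  eapply Rle_trans; [apply (pk_mass_bound rare_one_prob (fun l => 2 ^ Nat.log2 l)); try exact Hn; auto|].
  - apply rare_one_prob_01.
  - intros l. pose proof (rare_one_prob_bound l). pose proof (log2_S_cases l) as E. pose proof (P l).
    unfold rare_one_prob in *. destruct (special l); rewrite E in *; simpl in *; nra.
  - intros l. pose proof (rare_one_prob_bound l). pose proof (log2_S_cases l) as E. pose proof (P l).
    unfold rare_one_prob in *. destruct (special l); rewrite E in *; simpl in *; nra.
  - apply Rmult_le_compat_l; [lra|]. now apply pow2_log2_le.
Qed.

Lemma cascade_fun_A_minus_infty : A_minus_infty cascade_fun.
Proof.
  (* With L = - ln (1 - |z|), the scale satisfies n <= 2 + 2 L, so 1156 (n + 1) <= 3468 + 2312 L;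
     one more unit makes the inequality strict. *)
  split; [exact cascade_fun_holomorphic|]. exists (exp 3469), 2312. intros z Hz.
  pose proof Hz as Hz'. unfold inD in Hz'. pose proof (Cmod_ge_0 z).
  destruct (exists_dyadic_scale (1 - Cmod z)) as [n Hn]; [lra|].
  rewrite Cmod_cascade_fun. unfold Rpower. rewrite <- exp_plus.
  apply Rlt_le, exp_increasing.
  assert (P : 0 < 2 ^ n) by (apply pow_lt; lra).
  assert (B : tlim rare_one_prob (pk z) 0 0 <= 1156 * INR (S n)).
  { apply cascade_fun_exponent_bound; [exact Hz | lia|]. eapply Rle_trans; [|apply Hn].
    apply Rinv_le_contravar; [exact P|]. simpl. lra. }
  rewrite S_INR in B.
  assert (A : ln (1 - Cmod z) <= ln 2 - INR n * ln 2).
  { rewrite <- ln_pow by lra. rewrite <- ln_div by lra. apply ln_le; [lra|]. unfold Rdiv. lra. }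
  pose proof ln_lt_2. pose proof (pos_INR n).
  assert (ln 2 <= 1).
  { rewrite <- (ln_exp 1). apply ln_le; [lra|]. pose proof (exp_ineq1_le 1). lra. }
  assert (INR n * / 2 <= INR n * ln 2) by (apply Rmult_le_compat_l; lra).
  lra.
Qed.

(** A special l is 2^j - 1 and has [Nat.log2 l] equal to j - 1, so the condition bears on the j
    greater than i. *)
Definition vanishes_from (i : nat) (d : nat -> bool) : Prop :=
  forall l, special l = true -> (i <= Nat.log2 l)%nat -> d l = false.

Lemma weight_rare_one_prob_pos d n : 0 < weight rare_one_prob d n.
Proof.
  induction n as [|n IH]; simpl; [lra|]. apply Rmult_lt_0_compat; [exact IH|].
  pose proof (rare_one_prob_bound n). destruct (d n); lra.
Qed.

(** The invariant carries [2 ^ log2 n + 1] rather than [2 ^ log2 n] to absorb the factors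
    [1 - rare_one_prob l] at the special positions. *)
Lemma weight_lower i d : vanishes_from i d -> exists c, 0 < c /\ forall n, (2 ^ i <= n)%nat ->
  c * INR n <= weight rare_one_prob d n * 2 ^ n.
Proof.
  intros Hd. pose proof (Nat.pow_nonzero 2 i ltac:(lia)) as NZ.
  set (n0 := (2 ^ i)%nat) in *.
  assert (P : forall l, 1 <= 2 ^ Nat.log2 l) by (intros; apply pow_R1_Rle; lra).
  set (c := weight rare_one_prob d n0 * 2 ^ n0 / (2 ^ Nat.log2 n0 + 1)).
  assert (Hc : 0 < c).
  { apply Rdiv_lt_0_compat; [|specialize (P n0); lra].
    apply Rmult_lt_0_compat; [apply weight_rare_one_prob_pos | apply pow_lt; lra]. }
  assert (K : forall k, c * (2 ^ Nat.log2 (k + n0) + 1) <= weight rare_one_prob d (k + n0) * 2 ^ (k + n0)).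
  { induction k as [|k IH].
    - right. unfold c. simpl. field. specialize (P n0). lra.
    - set (n := (k + n0)%nat) in *. change (S k + n0)%nat with (S n).
      pose proof (log2_S_cases n) as E. specialize (P n).
      pose proof (weight_rare_one_prob_pos d n) as W. assert (0 < 2 ^ n) by (apply pow_lt; lra).
      change (weight rare_one_prob d (S n)) with (weight rare_one_prob d n * (if d n then rare_one_prob n else 1 - rare_one_prob n)).
      change (2 ^ S n) with (2 * 2 ^ n).
      set (T := weight rare_one_prob d n * 2 ^ n) in *.
      replace (weight rare_one_prob d n * (if d n then rare_one_prob n else 1 - rare_one_prob n) * (2 * 2 ^ n)) with
        (T * (2 * (if d n then rare_one_prob n else 1 - rare_one_prob n))) by (unfold T; ring).
      destruct (special n) eqn:Sp.
      + rewrite (Hd n Sp).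
        2:{ rewrite <- (Nat.log2_pow2 i) by lia. apply Nat.log2_le_mono. unfold n. lia. }
        unfold rare_one_prob. rewrite Sp, E. simpl (2 ^ S _). set (a := 2 ^ Nat.log2 n) in *.
        replace (2 * (1 - / (4 * (2 * a)))) with (2 - / 4 * / a) by (field; lra).
        assert (Ia : / a <= 1) by (rewrite <- Rinv_1; apply Rinv_le_contravar; lra).
        assert (Ia0 : a * / a = 1) by (apply Rinv_r; lra).
        assert (Ia1 : 0 < / a) by (apply Rinv_0_lt_compat; lra).
        apply Rle_trans with (c * (a + 1) * (2 - / 4 * / a)).
        * rewrite Rmult_assoc. apply Rmult_le_compat_l; [lra|]. nra.
        * apply Rmult_le_compat_r; lra.
      + rewrite E. unfold rare_one_prob. rewrite Sp. destruct (d n); lra. }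
  exists (c / 2). split; [lra|]. intros n Hn. specialize (K (n - n0)%nat).
  replace (n - n0 + n0)%nat with n in K by lia. eapply Rle_trans; [|exact K].
  pose proof (pow2_log2_ge n ltac:(lia)). nra.
Qed.

(** The potential at z is at least the weight of the cell of generation n times the mean of the
    kernel over that cell. Points of the cell are within 17 (1 - r) of z, so the kernel is at least
    2^n / 648 there, and [weight_lower] leaves c n / 648, where n >= |ln (1 - r)|. *)
Lemma Dplus_cascade_fun i d theta : vanishes_from i d -> in_period theta ->
  (forall n, dpoint d n <= theta <= dpoint d n + step n) -> Dplus cascade_fun theta.
Proof.
  intros Hd Hp Ht. split; [exact Hp|].
  destruct (weight_lower i d Hd) as (c & Hc & HW).
  exists (c / 648). split; [lra|].
  assert (P0 : 0 < / 2 ^ (2 ^ i)) by (apply Rinv_0_lt_compat, pow_lt; lra).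
  assert (P1 : / 2 ^ (2 ^ i) <= 1) by (rewrite <- Rinv_1; apply Rinv_le_contravar; [lra | apply pow_R1_Rle; lra]).
  (* Beyond this radius the scale n of 1 - r is at least [2 ^ i], where [weight_lower] applies. *)
  exists (1 - / 2 ^ (2 ^ i)). split; [lra|].
  intros r Hr. set (z := polar r theta).
  assert (Mz : Cmod z = r) by (apply Cmod_polar; lra).
  assert (Hz : inD z) by (unfold inD; lra).
  split; [pose proof (cascade_fun_ge_1 z Hz); lra|].
  unfold ratio. fold z. rewrite Cmod_cascade_fun, ln_exp.
  destruct (exists_dyadic_scale (1 - r)) as [n Hn]; [lra|].
  assert (P : 0 < 2 ^ n) by (apply pow_lt; lra).
  assert (Hin : (2 ^ i <= n)%nat).
  { destruct (le_lt_dec (2 ^ i) n) as [L|L]; [exact L|]. exfalso.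
    assert (2 ^ n <= 2 ^ (2 ^ i)) by (apply Rle_pow; [lra | lia]).
    apply Rinv_le_contravar in H; lra. }
  assert (n1 : (1 <= n)%nat) by (pose proof (Nat.pow_nonzero 2 i ltac:(lia)); lia).
  assert (Lz := proj1 (herglotz_lipschitz z Hz)).
  assert (Low : 2 ^ n / 324 / 2 <= tlim rare_one_prob (pk z) n (dpoint d n)).
  { apply tlim_ge_bound; [apply rare_one_prob_01 | exact Lz|]. intros y Hy.
    eapply Rle_trans; [|apply (pk_lower z y 17 Hz)].
    - rewrite Mz. replace (2 ^ n / 324 / 2) with (/ (324 * (2 * / 2 ^ n))) by (field; lra).
      apply Rinv_le_contravar; [|nra]. apply Rmult_lt_0_compat; lra.
    - lra.
    - replace (polar 1 y - z)%C with ((polar 1 y - polar 1 theta) + RtoC (1 - r) * polar 1 theta)%C.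
      + eapply Rle_trans; [apply Cmod_triangle|]. rewrite Cmod_mult, Cmod_R, (Cmod_polar 1), Mz, Rabs_pos_eq by lra.
        pose proof (chord_le y theta) as Ch. pose proof (step_le n) as St. specialize (Ht n).
        assert (Rabs (y - theta) <= step n) by (apply Rabs_le; lra).
        lra.
      + unfold z, polar, Cminus, Cplus, Copp, Cmult, RtoC; simpl. f_equal; ring. }
  pose proof (weight_tlim rare_one_prob rare_one_prob_01 (pk z) d n Lz ltac:(intros; now apply pk_pos)) as WT.
  specialize (HW n Hin). pose proof (weight_rare_one_prob_pos d n) as Wp.
  assert (A : ln (/ 2 ^ n) <= ln (1 - r)) by (apply ln_le; [now apply Rinv_0_lt_compat | lra]).
  rewrite ln_Rinv, ln_pow in A by lra.
  assert (L2 : / 2 < ln 2 <= / 2 * 2).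
  { split; [apply ln_lt_2|]. rewrite <- (ln_exp (/ 2 * 2)). apply ln_le; [lra|].
    pose proof (exp_ineq1_le (/ 2 * 2)). lra. }
  assert (Ln : ln (1 - r) < 0).
  { rewrite <- ln_1. apply ln_increasing; lra. }
  rewrite Rabs_left by exact Ln.
  pose proof (pos_INR n).
  assert (LB : - ln (1 - r) <= INR n) by nra.
  assert (WB : weight rare_one_prob d n * (2 ^ n / 324 / 2) <= weight rare_one_prob d n * tlim rare_one_prob (pk z) n (dpoint d n))
    by (apply Rmult_le_compat_l; lra).
  apply Rmult_le_reg_r with (- ln (1 - r)); [lra|].
  replace (tlim rare_one_prob (pk z) 0 0 / - ln (1 - r) * - ln (1 - r)) with (tlim rare_one_prob (pk z) 0 0) by (field; lra).
  apply Rle_trans with (c / 648 * INR n); [apply Rmult_le_compat_l; lra|].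
  lra.
Qed.

(** * Lower bound for coverings *)

(** Digits drawn with these probabilities form a sequence in [vanishes_from i]. *)
Definition vanishing_prob (i l : nat) : R := if (special l && Nat.leb i (Nat.log2 l))%bool then 0 else / 2.

Lemma vanishing_prob_01 i l : 0 <= vanishing_prob i l <= 1.
Proof. unfold vanishing_prob. destruct (_ && _)%bool; lra. Qed.

(** The subtraction in the density [2 ^ (Nat.log2 l - i)] is truncated: the first i special digits
    are fair and leave the density at 1, and each later one doubles it. *)
Lemma vanishing_prob_mass_bound i z n : inD z -> (2 ^ i <= n)%nat -> / 2 ^ n <= 1 - Cmod z ->
  tlim (vanishing_prob i) (pk z) 0 0 <= 1156 * INR n / 2 ^ i.
Proof.
  intros Hz Hi Hn. pose proof (Nat.pow_nonzero 2 i ltac:(lia)) as NZ.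
  assert (P : forall l, 0 < 2 ^ (Nat.log2 l - i)) by (intros; apply pow_lt; lra).
  eapply Rle_trans; [apply (pk_mass_bound (vanishing_prob i) (fun l => 2 ^ (Nat.log2 l - i))); try exact Hn; auto|].
  - apply vanishing_prob_01.
  - intros l. pose proof (vanishing_prob_01 i l). pose proof (log2_S_cases l) as E. specialize (P l).
    unfold vanishing_prob in *. destruct (special l); rewrite E in *; simpl andb in *.
    + destruct (Nat.leb_spec i (Nat.log2 l)).
      * replace (S (Nat.log2 l) - i)%nat with (S (Nat.log2 l - i)) by lia. simpl. nra.
      * replace (S (Nat.log2 l) - i)%nat with 0%nat by lia.
        replace (Nat.log2 l - i)%nat with 0%nat by lia. simpl. lra.
    + lra.
  - intros l. pose proof (vanishing_prob_01 i l). pose proof (log2_S_cases l) as E. specialize (P l).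
    unfold vanishing_prob in *. destruct (special l); rewrite E in *; simpl andb in *.
    + destruct (Nat.leb_spec i (Nat.log2 l)).
      * replace (S (Nat.log2 l) - i)%nat with (S (Nat.log2 l - i)) by lia. simpl. nra.
      * replace (S (Nat.log2 l) - i)%nat with 0%nat by lia.
        replace (Nat.log2 l - i)%nat with 0%nat by lia. simpl. lra.
    + lra.
  - assert (Pi : 0 < 2 ^ i) by (apply pow_lt; lra).
    assert (Li : (i <= Nat.log2 n)%nat).
    { rewrite <- (Nat.log2_pow2 i) by lia. now apply Nat.log2_le_mono. }
    assert (E : 2 ^ (Nat.log2 n - i) * 2 ^ i = 2 ^ Nat.log2 n) by (rewrite <- pow_add; f_equal; lia).
    pose proof (pow2_log2_le n ltac:(lia)) as L.
    apply Rmult_le_reg_r with (2 ^ i); [exact Pi|].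
    replace (1156 * INR n / 2 ^ i * 2 ^ i) with (1156 * INR n) by (field; lra).
    rewrite Rmult_assoc, E. lra.
Qed.

Lemma linear_over_exponential (n0 : nat) (eta : R) : 0 < eta ->
  exists n, (n0 <= n)%nat /\ INR n / 2 ^ n <= eta.
Proof.
  intros He.
  destruct (pow_lt_1_zero (/2) ltac:(rewrite Rabs_pos_eq; lra) (eta / 2) ltac:(lra)) as [N HN].
  set (m := Nat.max N n0). specialize (HN m ltac:(lia)).
  assert (P : 0 < 2 ^ m) by (apply pow_lt; lra).
  rewrite pow_inv, Rabs_pos_eq in HN by (left; now apply Rinv_0_lt_compat).
  exists (2 * m)%nat. split; [lia|].
  pose proof (poly m 1 ltac:(lra)) as Q. rewrite Rmult_1_r in Q. replace (1 + 1) with 2 in Q by ring.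
  rewrite mult_INR. simpl (INR 2). replace (2 * m)%nat with (m + m)%nat by lia. rewrite pow_add.
  apply Rle_trans with (2 * / 2 ^ m); [|lra].
  apply Rmult_le_reg_r with (2 ^ m * 2 ^ m); [nra|].
  replace ((1 + 1) * INR m / (2 ^ m * 2 ^ m) * (2 ^ m * 2 ^ m)) with (2 * INR m) by (field; lra).
  replace (2 * / 2 ^ m * (2 ^ m * 2 ^ m)) with (2 * 2 ^ m) by (field; lra). lra.
Qed.

(** For l > 0 one has 2^(-n) <= 2 l and n <= 2 |ln l|, whence the factor 4. An arc of length 0 costs
    nothing but still needs a scale, which the slack [eta] pays for. *)
Lemma arc_scale (i : nat) (l eta : R) : 0 <= l < / 2 * / 2 ^ (2 ^ i) -> 0 < eta ->
  exists n, (2 ^ i <= n)%nat /\ l <= / 2 ^ n /\ INR n / 2 ^ n <= 4 * lam_log l + eta.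
Proof.
  intros [[Hl|<-] Hl2] He.
  - assert (P0 : 0 < 2 ^ (2 ^ i)) by (apply pow_lt; lra).
    assert (P1 : / 2 ^ (2 ^ i) <= 1) by (rewrite <- Rinv_1; apply Rinv_le_contravar; [lra | apply pow_R1_Rle; lra]).
    destruct (exists_dyadic_scale l) as [[|n] Hn]; [lra | simpl in Hn; rewrite Rinv_1 in Hn; lra|].
    assert (P : 0 < 2 ^ n) by (apply pow_lt; lra).
    assert (E : 2 * / 2 ^ S n = / 2 ^ n) by (simpl; field; lra).
    rewrite E in Hn.
    assert (Hn2 : / 2 ^ n <= 2 * l) by (rewrite <- E; lra).
    exists n. split; [|split; [lra|]].
    + destruct (le_lt_dec (2 ^ i) n) as [L|L]; [exact L|]. exfalso.
      assert (A : 2 ^ n <= 2 ^ (2 ^ i)) by (apply Rle_pow; [lra | lia]).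
      apply Rinv_le_contravar in A; lra.
    + assert (A : ln l <= ln (/ 2 ^ n)) by (apply ln_le; lra).
      rewrite ln_Rinv, ln_pow in A by lra.
      pose proof ln_lt_2. pose proof (pos_INR n).
      assert (N2 : INR n <= 2 * Rabs (ln l)).
      { rewrite <- Rabs_Ropp. pose proof (Rle_abs (- ln l)). nra. }
      unfold lam_log, Rdiv. pose proof (Rabs_pos (ln l)).
      assert (INR n * / 2 ^ n <= 2 * Rabs (ln l) * (2 * l)).
      { apply Rmult_le_compat; auto. left. now apply Rinv_0_lt_compat. }
      lra.
  - destruct (linear_over_exponential (2 ^ i) eta He) as (n & H1 & H2).
    exists n. split; [exact H1|]. split; [left; apply Rinv_0_lt_compat, pow_lt; lra|].
    unfold lam_log. lra.
Qed.

Lemma polar_period_Z r a k : polar r (a + 2 * PI * IZR k) = polar r a.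
Proof.
  assert (N : forall n b, polar r (b + 2 * PI * INR n) = polar r b).
  { intros n b. unfold polar. replace (b + 2 * PI * INR n) with (b + 2 * INR n * PI) by ring.
    now rewrite cos_period, sin_period. }
  destruct (Z_le_gt_dec 0 k) as [H|H].
  - replace (IZR k) with (INR (Z.to_nat k)) by (rewrite INR_IZR_INZ, Z2Nat.id by lia; reflexivity). apply N.
  - rewrite <- (N (Z.to_nat (- k)) (a + 2 * PI * IZR k)). f_equal.
    rewrite INR_IZR_INZ, Z2Nat.id, opp_IZR by lia. ring.
Qed.

(** The point at height 2^(-n) above the endpoint of the arc is within 19 / 2^n of every cell of
    generation n meeting the arc: 16 for the cell, 2 for the arc, 1 for the height. Its kernel,
    large on all these cells, stands in for the indicator of the arc; 361 = 19^2. *)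
Lemma pk_on_arc a l n theta y : 0 <= l <= / 2 ^ n -> arc a l theta -> Rabs (y - theta) <= step n ->
  2 ^ n / 361 <= pk (polar (1 - / 2 ^ n) a) y.
Proof.
  intros Hl (_ & t & Ht & k & E) Hy.
  assert (P : 0 < / 2 ^ n) by (apply Rinv_0_lt_compat, pow_lt; lra).
  assert (P1 : / 2 ^ n <= 1) by (rewrite <- Rinv_1; apply Rinv_le_contravar; [lra | apply pow_R1_Rle; lra]).
  set (h := / 2 ^ n) in *. set (z := polar (1 - h) a).
  assert (Mz : Cmod z = 1 - h) by (apply Cmod_polar; lra).
  assert (Hz : inD z) by (unfold inD; lra).
  eapply Rle_trans; [|apply (pk_lower z y 19 Hz)]; [|lra|].
  - rewrite Mz. replace (1 - (1 - h)) with h by ring. unfold h. right. field. apply pow_nonzero; lra.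
  - rewrite Mz.
    replace (polar 1 y - z)%C with ((polar 1 y - polar 1 theta) + ((polar 1 theta - polar 1 a) + RtoC h * polar 1 a))%C.
    + eapply Rle_trans; [apply Cmod_triangle|].
      eapply Rle_trans; [apply Rplus_le_compat_l, Cmod_triangle|].
      rewrite Cmod_mult, Cmod_R, (Cmod_polar 1), Rabs_pos_eq by lra.
      pose proof (chord_le y theta) as C1. pose proof (step_le n) as St. fold h in St.
      assert (C2 : Cmod (polar 1 theta - polar 1 a) <= 2 * Rabs t).
      { rewrite E, polar_period_Z. eapply Rle_trans; [apply chord_le|].
        right. do 2 f_equal. ring. }
      rewrite (Rabs_pos_eq t) in C2 by lra. lra.
    + unfold z, polar, Cminus, Cplus, Copp, Cmult, RtoC; simpl. f_equal; ring.
Qed.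

Lemma rsum_le f g n : (forall i, (i < n)%nat -> f i <= g i) -> rsum f n <= rsum g n.
Proof.
  induction n as [|n IH]; intros H; simpl; [lra|].
  pose proof (H n ltac:(lia)). specialize (IH ltac:(intros; apply H; lia)). lra.
Qed.

Lemma rsum_ext f g n : (forall i, f i = g i) -> rsum f n = rsum g n.
Proof. intros H. induction n as [|n IH]; simpl; [reflexivity|]. now rewrite IH, H. Qed.

Lemma rsum_lin f g a b n : rsum (fun s => a * f s + b * g s) n = a * rsum f n + b * rsum g n.
Proof. induction n as [|n IH]; simpl; [ring|]. rewrite IH. ring. Qed.

Lemma rsum_inv_pow n : rsum (fun s => / 2 ^ s) n = 2 - 2 * / 2 ^ n.
Proof.
  induction n as [|n IH]; simpl; [rewrite Rinv_1; ring|]. rewrite IH, Rinv_mult. field. apply pow_nonzero; lra.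
Qed.

(** If all cells on a branch carry potential less than 1, no point of the branch lies on one
    of the arcs, since the arc [J s] contributes at least 1 at generation [ns s]. *)
Section Descent.
Variables (i : nat) (zs : nat -> C) (ns : nat -> nat).
Hypothesis Hzs : forall s, inD (zs s).

(** The factor normalises the bound of [pk_on_arc] to 1. *)
Definition potential (s n : nat) (x : R) : R := 361 * / 2 ^ (ns s) * tlim (vanishing_prob i) (pk (zs s)) n x.

(** A common M below 1 for all partial sums handles countably many arcs without summing a series. *)
Definition light (n : nat) (x : R) : Prop :=
  exists M, M < 1 /\ forall N, rsum (fun s => potential s n x) N <= M.

Lemma potential_pos s n x : 0 <= potential s n x.
Proof.
  apply Rmult_le_pos.
  - apply Rmult_le_pos; [lra|]. left. apply Rinv_0_lt_compat, pow_lt; lra.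
  - apply tlim_ge_bound; [apply vanishing_prob_01 | now apply herglotz_lipschitz|]. intros. now apply pk_pos.
Qed.

Lemma potential_step s n x : potential s n x =
  (1 - vanishing_prob i n) * potential s (S n) x + vanishing_prob i n * potential s (S n) (x + step (S n)).
Proof.
  unfold potential. rewrite (tlim_step (vanishing_prob i) (vanishing_prob_01 i) _ n x) by now apply herglotz_lipschitz. ring.
Qed.

(** The sum at a cell is the average of the sums at its children, so both cannot exceed M. Partial
    sums exceeding M may occur at different lengths for the two children; nonnegativity allows the
    larger length for both. *)
Lemma light_child n x : light n x -> light (S n) x \/ (vanishing_prob i n <> 0 /\ light (S n) (x + step (S n))).
Proof.
  intros (M & HM & HS).
  assert (E : forall N, rsum (fun s => potential s n x) N =
    (1 - vanishing_prob i n) * rsum (fun s => potential s (S n) x) N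
     + vanishing_prob i n * rsum (fun s => potential s (S n) (x + step (S n))) N).
  { intros N. rewrite <- rsum_lin. apply rsum_ext. intros; apply potential_step. }
  destruct (Req_dec (vanishing_prob i n) 0) as [Z|Z].
  - left. exists M. split; [exact HM|]. intros N. specialize (HS N). rewrite E, Z in HS. lra.
  - assert (Q : vanishing_prob i n = / 2) by (unfold vanishing_prob in *; destruct (_ && _)%bool; lra).
    destruct (classic (light (S n) x)) as [L|L1]; [now left|].
    destruct (classic (light (S n) (x + step (S n)))) as [L|L2]; [now right|]. exfalso.
    assert (A1 : exists N, M < rsum (fun s => potential s (S n) x) N).
    { apply NNPP. intros F. apply L1. exists M. split; [exact HM|]. intros N.
      apply Rnot_lt_le. intros G. apply F. now exists N. }
    assert (A2 : exists N, M < rsum (fun s => potential s (S n) (x + step (S n))) N).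
    { apply NNPP. intros F. apply L2. exists M. split; [exact HM|]. intros N.
      apply Rnot_lt_le. intros G. apply F. now exists N. }
    destruct A1 as [N1 A1], A2 as [N2 A2].
    specialize (HS (Nat.max N1 N2)). rewrite E, Q in HS.
    pose proof (rsum_le_index (fun s => potential s (S n) x) N1 (Nat.max N1 N2) ltac:(lia)
      ltac:(intros; apply potential_pos)).
    pose proof (rsum_le_index (fun s => potential s (S n) (x + step (S n))) N2 (Nat.max N1 N2) ltac:(lia)
      ltac:(intros; apply potential_pos)). lra.
Qed.

Lemma light_branch : light 0 0 -> exists d, vanishes_from i d /\ forall n, light n (dpoint d n).
Proof.
  intros H0.
  (* The digit 0 is preferred, so a 1 is taken only under the second alternative of [light_child],
     which excludes positions of probability 0. *)
  set (xs := fix xs n := match n with O => 0 | S n =>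
     if excluded_middle_informative (light (S n) (xs n)) then xs n else xs n + step (S n) end).
  set (d := fun n => if excluded_middle_informative (light (S n) (xs n)) then false else true).
  assert (E : forall n, dpoint d n = xs n).
  { induction n as [|n IH]; simpl; [reflexivity|]. rewrite IH. unfold d.
    destruct excluded_middle_informative; reflexivity. }
  assert (L : forall n, light n (xs n)).
  { induction n as [|n IH]; [exact H0|]. simpl.
    destruct excluded_middle_informative as [Y|N]; [exact Y|].
    destruct (light_child n (xs n) IH) as [Y|[_ Y]]; [now destruct N | exact Y]. }
  exists d. split.
  - intros l Sp Hi. unfold d. destruct excluded_middle_informative as [Y|N]; [reflexivity|].
    destruct (light_child l (xs l) (L l)) as [Y|[Q _]]; [now destruct N|]. exfalso. apply Q.
    unfold vanishing_prob. rewrite Sp. destruct (Nat.leb_spec i (Nat.log2 l)); [reflexivity | lia].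
  - intros n. rewrite E. apply L.
Qed.
End Descent.

(** Only a branch of ones alone could end at 2 pi, outside the half-open period; the special
    position [2 ^ S i - 1] carries a 0. *)
Lemma vanishes_from_in_period i d theta : vanishes_from i d ->
  (forall n, dpoint d n <= theta <= dpoint d n + step n) -> in_period theta.
Proof.
  intros Hd Ht. split; [pose proof (Ht O) as H; simpl in H; lra|].
  assert (M : forall n, dpoint d n + step n <= 2 * PI).
  { induction n as [|n IH]; [unfold step; simpl; lra|]. simpl. pose proof (step_S n). pose proof (step_pos n).
    destruct (d n); lra. }
  set (l := (2 ^ S i - 1)%nat).
  pose proof (Nat.pow_nonzero 2 i ltac:(lia)) as NZ.
  assert (L1 : Nat.log2 l = i) by (apply Nat.log2_unique; [lia|]; unfold l; rewrite Nat.pow_succ_r'; lia).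
  assert (L2 : Nat.log2 (S l) = S i).
  { replace (S l) with (2 ^ S i)%nat by (unfold l; rewrite Nat.pow_succ_r'; lia). apply Nat.log2_pow2; lia. }
  assert (F : d l = false).
  { apply Hd; [|lia]. unfold special. rewrite L1, L2. apply Nat.ltb_lt. lia. }
  pose proof (Ht (S l)) as [_ H]. simpl in H. rewrite F in H.
  pose proof (step_S l). pose proof (step_pos l). specialize (M l). lra.
Qed.

(** Mass distribution principle for the law [vanishing_prob i]: a cheap covering makes the root
    light, the descent then yields a point of the set whose cells all stay light, and the arc
    covering that point contradicts this. *)
Lemma cover_lower (i : nat) (J : nat -> R * R) (x : R) :
  arc_cover (Dplus cascade_fun) (/ 2 * / 2 ^ (2 ^ i)) J ->
  (forall n, sum_f_R0 (fun s => lam_log (snd (J s))) n <= x) -> 2 ^ i / 10000000 <= x.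
Proof.
  intros [HJ1 HJ2] Hx. apply Rnot_lt_le. intros Hlt.
  assert (Pi : 0 < 2 ^ i) by (apply pow_lt; lra).
  set (eta := 2 ^ i / 10000000) in *. assert (He : 0 < eta) by (unfold eta; lra).
  assert (Sc : forall s, { n | (2 ^ i <= n)%nat /\ snd (J s) <= / 2 ^ n /\
     INR n / 2 ^ n <= 4 * lam_log (snd (J s)) + eta * / 2 ^ s }).
  { intros s. apply constructive_indefinite_description. apply arc_scale; [apply HJ1|].
    apply Rmult_lt_0_compat; [exact He|]. apply Rinv_0_lt_compat, pow_lt; lra. }
  set (ns := fun s => proj1_sig (Sc s)).
  assert (Hns : forall s, (2 ^ i <= ns s)%nat /\ snd (J s) <= / 2 ^ ns s /\
     INR (ns s) / 2 ^ ns s <= 4 * lam_log (snd (J s)) + eta * / 2 ^ s)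
    by (intros s; unfold ns; apply (proj2_sig (Sc s))).
  clearbody ns.
  set (zs := fun s => polar (1 - / 2 ^ ns s) (fst (J s))).
  assert (P : forall n, 0 < / 2 ^ n) by (intros; apply Rinv_0_lt_compat, pow_lt; lra).
  assert (P1 : forall n, / 2 ^ n <= 1)
    by (intros; rewrite <- Rinv_1; apply Rinv_le_contravar; [lra | apply pow_R1_Rle; lra]).
  assert (Mz : forall s, Cmod (zs s) = 1 - / 2 ^ ns s)
    by (intros s; apply Cmod_polar; specialize (P1 (ns s)); lra).
  assert (Hzs : forall s, inD (zs s)) by (intros s; unfold inD; rewrite Mz; specialize (P (ns s)); lra).
  assert (X0 : forall N, rsum (fun s => lam_log (snd (J s))) N <= x).
  { intros [|N]; [|rewrite <- sum_f_R0_rsum; apply Hx].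
    eapply Rle_trans; [|apply (Hx O)]. simpl. apply lam_log_pos. apply HJ1. }
  assert (Root : light i zs ns 0 0).
  (* 417316 = 361 * 1156 comes from the normalisation of [potential] and from
     [vanishing_prob_mass_bound]; the slacks [eta * / 2 ^ s] add up to at most [2 * eta]. As x <
     eta, the total is below 6 * 417316 / 10000000. *)
  { exists (417316 / 2 ^ i * (4 * x + eta * 2)). split.
    - apply Rle_lt_trans with (417316 / 2 ^ i * (6 * eta)).
      + apply Rmult_le_compat_l; [left; apply Rdiv_lt_0_compat; lra | lra].
      + unfold eta. replace (417316 / 2 ^ i * (6 * (2 ^ i / 10000000))) with (417316 * 6 / 10000000) by (field; lra).
        lra.
    - intros N.
      apply Rle_trans with (rsum (fun s => 417316 / 2 ^ i * 4 * lam_log (snd (J s)) +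
        417316 / 2 ^ i * eta * / 2 ^ s) N).
      + apply rsum_le. intros s _. destruct (Hns s) as (A1 & A2 & A3).
        pose proof (vanishing_prob_mass_bound i (zs s) (ns s) (Hzs s) A1 ltac:(rewrite Mz; lra)) as B.
        unfold potential.
        apply Rle_trans with (417316 / 2 ^ i * (INR (ns s) / 2 ^ ns s)).
        * replace (417316 / 2 ^ i * (INR (ns s) / 2 ^ ns s)) with
           (361 * / 2 ^ ns s * (1156 * INR (ns s) / 2 ^ i)) by (field; split; apply pow_nonzero; lra).
          apply Rmult_le_compat_l; [specialize (P (ns s)); lra | exact B].
        * eapply Rle_trans; [apply Rmult_le_compat_l; [left; apply Rdiv_lt_0_compat; lra | exact A3]|].
          right. ring.
      + rewrite rsum_lin, rsum_inv_pow. specialize (P N). specialize (X0 N).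
        assert (K : 0 < 417316 / 2 ^ i) by (apply Rdiv_lt_0_compat; lra).
        set (k := 417316 / 2 ^ i) in *.
        replace (k * (4 * x + eta * 2)) with (k * 4 * x + k * eta * 2) by ring.
        apply Rplus_le_compat; apply Rmult_le_compat_l; try nra. }
  destruct (light_branch i zs ns Hzs Root) as (d & Hd & Ld).
  destruct (dpoint_limit d) as [theta Ht].
  destruct (HJ2 theta) as [s Hs].
  { apply (Dplus_cascade_fun i d); auto. now apply (vanishes_from_in_period i d). }
  destruct (Ld (ns s)) as (M & HM & HS). specialize (HS (S s)).
  destruct (Hns s) as (A1 & A2 & A3).
  assert (Big : 1 <= potential i zs ns s (ns s) (dpoint d (ns s))).
  { unfold potential.
    assert (B : 2 ^ ns s / 361 <= tlim (vanishing_prob i) (pk (zs s)) (ns s) (dpoint d (ns s))).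
    { apply tlim_ge_bound; [apply vanishing_prob_01 | now apply herglotz_lipschitz|]. intros y Hy.
      apply (pk_on_arc _ (snd (J s)) _ theta); [split; [apply HJ1 | exact A2] | exact Hs|].
      specialize (Ht (ns s)). apply Rabs_le. lra. }
    apply Rle_trans with (361 * / 2 ^ ns s * (2 ^ ns s / 361)).
    - right. field. apply pow_nonzero; lra.
    - apply Rmult_le_compat_l; [specialize (P (ns s)); lra | exact B]. }
  simpl in HS.
  pose proof (rsum_le_index (fun s0 => potential i zs ns s0 (ns s) (dpoint d (ns s))) 0 s ltac:(lia)
    ltac:(intros; now apply potential_pos)) as Z. simpl in Z. lra.
Qed.

Lemma H_lambda_Dplus_cascade_fun : H_lambda lam_log (Dplus cascade_fun) = p_infty.
Proof.
  assert (Low : forall i : nat, Rbar_le (Finite (2 ^ i / 10000000)) (H_lambda lam_log (Dplus cascade_fun))).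
  { intros i.
    assert (Dp : 0 < / 2 * / 2 ^ (2 ^ i)).
    { apply Rmult_lt_0_compat; [lra|]. apply Rinv_0_lt_compat, pow_lt; lra. }
    (* The measure is a supremum over mesh sizes, so one mesh fine enough for [cover_lower] suffices
       for each i. *)
    destruct (archimed_cor1 _ Dp) as (N & HN & HN0).
    assert (HNN : / (INR N + 1) <= / INR N).
    { apply Rinv_le_contravar; [now apply lt_0_INR | lra]. }
    apply Rbar_le_trans with (H_pre lam_log (Dplus cascade_fun) (/ (INR N + 1))).
    - apply (proj2 (Glb_Rbar_correct _)). intros x (J & [HJ1 HJ2] & HS).
      apply (cover_lower i J).
      + split; [|exact HJ2]. intros s. specialize (HJ1 s). lra.
      + intros n. change (Rbar_le (Finite (sum_f_R0 (fun s => lam_log (snd (J s))) n)) x).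
        rewrite <- HS. unfold cover_sum.
        apply (is_sup_seq_major (fun n => Finite (sum_f_R0 (fun s => lam_log (snd (J s))) n))),
          Sup_seq_correct.
    - unfold H_lambda.
      apply (is_sup_seq_major (fun n => H_pre lam_log (Dplus cascade_fun) (/ (INR n + 1)))), Sup_seq_correct. }
  destruct (H_lambda lam_log (Dplus cascade_fun)) as [h| |]; [|reflexivity|destruct (Low O)].
  exfalso.
  destruct (INR_unbounded (h * 10000000)) as [i Hi].
  specialize (Low i). simpl in Low.
  pose proof (poly i 1 ltac:(lra)) as Q. rewrite Rmult_1_r in Q. replace (1 + 1) with 2 in Q by ring.
  lra.
Qed.

Theorem theorem5 :
  (forall f : C -> C,
     A_minus_infty f ->
     (exists c : R, 0 < c /\ forall z : C, inD z -> c <= Cmod (f z)) ->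
     exists A : nat -> (R -> Prop),
       (forall theta, Gplus f theta <-> exists n, A n theta) /\
       (forall n, Rbar_lt (H_lambda lam_log (A n)) p_infty))
  /\
  (exists f : C -> C,
     A_minus_infty f /\
     (exists c : R, 0 < c /\ forall z : C, inD z -> c <= Cmod (f z)) /\
     H_lambda lam_log (Dplus f) = p_infty).
Proof.
  split.
  - intros f [Hf _] Hb. now apply Gplus_sigma_finite.
  - exists cascade_fun. split; [exact cascade_fun_A_minus_infty|]. split; [|exact H_lambda_Dplus_cascade_fun].
    exists 1. split; [lra | exact cascade_fun_ge_1].
Qed.
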